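(* Let $\Omega=(\omega_k)_{k\in\mathbb{Z}}$ be a family of real numbers satisfying the gap condition $\inf_{k\neq n}|\omega_k-\omega_n|>0$, let $D^+=D^+(\Omega)$ be its Pólya upper density, let $(U_k)_{k\in\mathbb{Z}}$ be a family of unit vectors in a complex Hilbert space $H$, and let $I$ be a bounded interval of length $|I|>0$. Consider the estimates $$\int_I\|x(t)\|_H^2\,dt\asymp\sum_{k\in\mathbb{Z}}|x_k|^2,\qquad x(t)=\sum_{k\in\mathbb{Z}}x_kU_ke^{i\omega_kt},\qquad (\ast)$$ for square summable complex coefficients $(x_k)_{k\in\mathbb{Z}}$. (a) If $|I|>2\pi D^+$, then the estimates $(\ast)$ hold true. (b) If the estimates $(\ast)$ hold true and $H$ has a finite dimension $d$, then $|I|\ge 2\pi D^+/d$.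
   Context: The Pólya upper density of $\Omega=(\omega_k)_{k\in\mathbb{Z}}$ is $D^+(\Omega):=\lim_{r\to\infty}r^{-1}n^+(r)$, where $n^+(r)$ denotes the largest number of terms of the sequence $(\omega_k)_{k\in\mathbb{Z}}$ contained in an interval of length $r$. The notation $A\asymp B$ means that there exist two positive constants $c_1,c_2$ with $c_1A\le B\le c_2A$. ''The estimates $(\ast)$ hold true'' means that such constants $c_1,c_2$ exist, independent of the coefficients, so that the inequalities hold for all square summable complex families $(x_k)_{k\in\mathbb{Z}}$; the sum $x$ is understood as the sum of the series in $L^2(I,H)$. *)

(* Defs.v *)
From HB Require Import structures.
From mathcomp Require Import all_boot all_order all_algebra finmap.
From mathcomp Require Import all_classical all_reals all_analysis.
From mathcomp Require Import complex.
From mathcomp Require analysis.showcase.summability.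

Set Implicit Arguments.
Unset Strict Implicit.
Unset Printing Implicit Defensive.

Import Order.TTheory GRing.Theory Num.Theory.
Import numFieldNormedType.Exports.

Local Open Scope classical_set_scope.
Local Open Scope ring_scope.
Local Open Scope complex_scope.

(* Norms over R[i] take their (real) values in R[i]. *)
Definition rnorm (R : realType) (V : normedZmodType R[i]) (v : V) : R :=
  complex.Re `|v|.

Definition expi (R : realType) (t : R) : R[i] := cos t +i* sin t.

(* The flags say whether each endpoint is included; BSide true a as a left
   bound includes a, BSide true b as a right bound excludes b. *)
Definition bounded_itv (R : realType) (l r : bool) (a b : R) : set R :=
  [set` Interval (BSide l a) (BSide r b)].

Definition gap_condition (R : realType) (omega : int -> R) : Prop :=
  0 < inf [set `|omega p.1 - omega p.2| | p in [set p : int * int | p.1 != p.2]].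

(* Counts indices k, hence terms with multiplicity. *)
Definition max_terms (R : realType) (omega : int -> R) (r : R) : \bar R :=
  ereal_sup [set z | exists (b1 b2 : bool) (c : R),
    z = counting (omega @^-1` bounded_itv b1 b2 c (c + r))].

Definition polya_upper_density (R : realType) (omega : int -> R) : \bar R :=
  lim (((r^-1)%:E * max_terms omega r)%E @[r --> +oo]).

Definition has_dimension (K : fieldType) (V : lmodType K) (d : nat) : Prop :=
  exists e : 'I_d -> V, forall v : V,
    exists! c : {ffun 'I_d -> K}, v = \sum_(i < d) c i *: e i.

Definition simple_vfun (R : realType) (V : Type) (s : R -> V) : Prop :=
  finite_set (range s) /\
  forall v, measurable (s @^-1` [set v] : set (measurableTypeR R)).

Definition strongly_measurable (R : realType) (V : normedModType R[i])
    (D : set R) (f : R -> V) : Prop :=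
  exists2 s : nat -> R -> V, (forall n, simple_vfun (s n)) &
    forall t, D t -> s n t @[n --> \oo] --> f t.

Definition L2_normsq (R : realType) (V : normedModType R[i])
    (D : set R) (f : R -> V) : \bar R :=
  (\int[lebesgue_measure]_(t in D) (rnorm (f t) ^+ 2)%:E)%E.

(* Elements of L^2(D, V) are handled through representatives that are strongly
   measurable everywhere on D; every class of functions modulo equality almost
   everywhere has one. *)
Definition in_L2 (R : realType) (V : normedModType R[i])
    (D : set R) (f : R -> V) : Prop :=
  strongly_measurable D f /\ (L2_normsq D f < +oo)%E.

(* f is the sum in L^2(D, V) of the family (g k): the finite partial sums
   converge to f along the directed set of finite sets of indices. *)
Definition L2_sum (R : realType) (V : normedModType R[i])
    (D : set R) (g : int -> R -> V) (f : R -> V) : Prop :=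
  in_L2 D f /\
  L2_normsq D (fun t => f t - \sum_(k <- F) g k t)
    @[F --> @summability.totally int] --> 0%E.

Definition l2_normsq (R : realType) (x : int -> R[i]) : \bar R :=
  \esum_(k in [set: int]) (rnorm (x k) ^+ 2)%:E.

Definition estimates (R : realType) (V : normedModType R[i])
    (omega : int -> R) (U : int -> V) (D : set R) : Prop :=
  exists c1 c2 : R, [/\ 0 < c1, 0 < c2 &
    forall x : int -> R[i], (l2_normsq x < +oo)%E ->
    exists f : R -> V,
      [/\ L2_sum D (fun k t => (x k * expi (omega k * t)) *: U k) f,
          (c1%:E * L2_normsq D f <= l2_normsq x)%E &
          (l2_normsq x <= c2%:E * L2_normsq D f)%E]].

(* Main.v *)
(* Everything is done on finite sums S(t) = sum_k e^(i u_k t) V_k sampled on an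
   arithmetic progression of step h, so that S(a + h m) = sum_k z_k^m V'_k with
   z_k = e^(i h u_k) on the unit circle; Riemann sums with h -> 0 give the
   integrals.

   (a) The upper estimate is a large sieve inequality. For the lower one choose
   r such that every half-open interval of length r contains at most M
   frequencies with 2 pi M / r < |I|, and h = 2 pi / (J r). For each k there is a
   polynomial of degree M J + o(J) which is 1 at z_k, vanishes at the other z_l
   and has coefficients O(1/J): a product of M families of factors
   (z - z_l) / (1 - z_l), each compared with the roots of z^J + 1, times a power
   of a geometric mean. This bounds |V_k| by the samples, and the dual large
   sieve sums these bounds over k. Square summable families follow by choosing
   partial sums converging rapidly in L^2 and almost everywhere.

   (b) If an interval of length s contains more than d w frequencies, where
   w Delta >= s + 2 B and Delta = 2 pi E / ((E + 2) |I|), linear algebra gives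
   nonzero coefficients for which w consecutive discrete Fourier coefficients
   of the smoothed samples vanish. The remaining ones are at distance at least
   B from the frequencies, so the energy of the samples is O(1/B) relative to
   the coefficients, contradicting the lower estimate for large B. Hence
   n^+(s) <= d (s + 2 B) / Delta + d; let s and then E tend to infinity. *)
Require Import Defs.
From HB Require Import structures.
From mathcomp Require Import all_boot all_order all_algebra finmap.
From mathcomp Require Import all_classical all_reals all_analysis measurable_realfun.
From mathcomp Require Import complex ring lra zify.

Set Implicit Arguments.
Unset Strict Implicit.
Unset Printing Implicit Defensive.

Import Order.TTheory GRing.Theory Num.Theory.
Import numFieldNormedType.Exports.

Local Open Scope classical_set_scope.
Local Open Scope ring_scope.
Local Open Scope complex_scope.

(** * Norms and the complex exponential *)

(** A Dirichlet kernel decays only like the inverse of the distance, which is not summable over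
    separated points. Wherever a bound has to be summed, quadratic decay is therefore produced
    first: by two box windows in the large sieve and in (b), by the two spare powers of the
    geometric mean in (a). Such smoothing costs samples, and the parameter E keeps the cost to a
    proportion of order 1/E of them: windows of length K with J = E K in (a), windows of length q in
    a period (E + 2) q in (b). E is fixed before the step h tends to 0, so the discrete constants
    depend neither on h nor on the sum considered. Only the error of the Riemann sums depends on the
    individual sum, and it vanishes with h. In (a) the relation J r h = 2 pi makes one turn of the
    circle correspond to a frequency range J r, so that intervals of length r become the J arcs
    between consecutive roots of z^J + 1. *)

Section RealNorm.
Variables (R : realType).
Implicit Types (z : R[i]) (a t : R).

Section ZmodNorm.
Variable V : normedZmodType R[i].
Implicit Types u v : V.

Lemma normC_rnorm v : `|v| = (rnorm v)%:C.
Proof. by rewrite /rnorm RRe_real // ger0_real. Qed.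

Lemma rnorm_ge0 v : 0 <= rnorm v.
Proof. by rewrite -ler0c -normC_rnorm. Qed.

Lemma rnormD u v : rnorm (u + v) <= rnorm u + rnorm v.
Proof. by rewrite -lecR rmorphD /= -!normC_rnorm ler_normD. Qed.

Lemma rnormN v : rnorm (- v) = rnorm v.
Proof. by rewrite /rnorm normrN. Qed.

Lemma rnorm0 : rnorm (0 : V) = 0.
Proof. by rewrite /rnorm normr0. Qed.

Lemma rnormB_sym u v : rnorm (u - v) = rnorm (v - u).
Proof. by rewrite /rnorm distrC. Qed.

Lemma rnormB u v : rnorm (u - v) <= rnorm u + rnorm v.
Proof. by rewrite -[rnorm v]rnormN rnormD. Qed.

Lemma rnorm_sum (I : Type) (s : seq I) (P : pred I) (F : I -> V) :
  rnorm (\sum_(i <- s | P i) F i) <= \sum_(i <- s | P i) rnorm (F i).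
Proof.
elim/big_rec2: _ => [|i x y _ le_xy]; first by rewrite rnorm0.
by rewrite (le_trans (rnormD _ _)) // lerD2l.
Qed.

Lemma rnorm_eq0 v : (rnorm v == 0) = (v == 0).
Proof. by rewrite -(normr_eq0 v) normC_rnorm eq_complex /= eqxx andbT. Qed.

Lemma ler_dist_rnorm u v : `|rnorm u - rnorm v| <= rnorm (u - v).
Proof.
rewrite ler_norml; apply/andP; split.
  rewrite lerNl opprB lerBlDr rnormB_sym.
  by rewrite -{1}[v](subrK u) rnormD.
by rewrite lerBlDr -{1}[u](subrK v) rnormD.
Qed.

Lemma rnormD_sqr u v :
  rnorm (u + v) ^+ 2 <= 2 * rnorm u ^+ 2 + 2 * rnorm v ^+ 2.
Proof.
have := rnormD u v; have := rnorm_ge0 u; have := rnorm_ge0 v.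
have := rnorm_ge0 (u + v).
move: (rnorm u) (rnorm v) (rnorm _) => x y w w0 y0 x0 h.
have h2 : w ^+ 2 <= (x + y) ^+ 2 by rewrite ler_sqr ?nnegrE ?addr_ge0.
have := sqr_ge0 (x - y); nra.
Qed.

End ZmodNorm.

Lemma rnormZ (V : normedModType R[i]) z (v : V) :
  rnorm (z *: v) = rnorm z * rnorm v.
Proof.
by apply: (@complexI R); rewrite -normC_rnorm normrZ !normC_rnorm rmorphM.
Qed.

Lemma rnormM z1 z2 : rnorm (z1 * z2) = rnorm z1 * rnorm z2.
Proof.
by apply: (@complexI R); rewrite -normC_rnorm normrM !normC_rnorm rmorphM.
Qed.

Lemma rnorm1 : rnorm (1 : R[i]) = 1.
Proof. by rewrite /rnorm normr1. Qed.

Lemma rnormX z n : rnorm (z ^+ n) = rnorm z ^+ n.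
Proof.
by elim: n => [|n IH]; rewrite ?expr0 ?rnorm1 // !exprS rnormM IH.
Qed.

Lemma rnormV z : rnorm z^-1 = (rnorm z)^-1.
Proof.
by apply: (@complexI R); rewrite -normC_rnorm normfV normC_rnorm fmorphV.
Qed.

Lemma rnorm_prod (I : Type) (s : seq I) (P : pred I) (F : I -> R[i]) :
  rnorm (\prod_(i <- s | P i) F i) = \prod_(i <- s | P i) rnorm (F i).
Proof.
by elim/big_rec2: _ => [|i x y _ <-]; rewrite ?rnorm1 ?rnormM.
Qed.

Lemma rnorm_real a : rnorm (a%:C : R[i]) = `|a|.
Proof. by rewrite /rnorm normc_def /= expr0n addr0 sqrtr_sqr. Qed.

Lemma rnorm_nat n : rnorm (n%:R : R[i]) = n%:R.
Proof. by rewrite -(rmorph_nat (real_complex R)) rnorm_real ger0_norm. Qed.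

Lemma rnorm_sqr z : rnorm z ^+ 2 = complex.Re z ^+ 2 + complex.Im z ^+ 2.
Proof.
by apply: (@complexI R); rewrite add_Re2_Im2 normC_rnorm rmorphXn.
Qed.

Lemma rnorm_conj z : rnorm z^*%C = rnorm z.
Proof. by rewrite /rnorm normcJ. Qed.

Lemma rnorm1_conj z : rnorm z = 1 -> z * z^*%C = 1.
Proof. by move=> h; rewrite -sqr_normc normC_rnorm h expr1n. Qed.

Lemma rnorm1_inv z : rnorm z = 1 -> z^-1 = z^*%C.
Proof.
move=> h; have /(congr1 (fun x => z^-1 * x)) := rnorm1_conj h.
rewrite mulrA mulVf ?mul1r ?mulr1 //.
by rewrite -rnorm_eq0 h oner_eq0.
Qed.

End RealNorm.

Section Expi.
Variable R : realType.
Implicit Types (s t : R).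

Lemma expiD s t : expi (s + t) = expi s * expi t.
Proof.
by rewrite /expi cosD sinD; simpc; congr (_ +i* _); ring.
Qed.

Lemma expi0 : expi (0 : R) = 1.
Proof. by rewrite /expi cos0 sin0. Qed.

Lemma rnorm_expi t : rnorm (expi t) = 1.
Proof. by rewrite /rnorm normc_def /= cos2Dsin2 sqrtr1. Qed.

Lemma expi_neq0 t : expi t != 0.
Proof. by rewrite -rnorm_eq0 rnorm_expi oner_eq0. Qed.

Lemma expiN t : expi (- t) = (expi t)^*%C.
Proof. by rewrite /expi cosN sinN. Qed.

Lemma expiNV t : expi (- t) = (expi t)^-1.
Proof. by rewrite expiN rnorm1_inv // rnorm_expi. Qed.

Lemma expiB s t : expi (s - t) = expi s / expi t.
Proof. by rewrite expiD expiNV. Qed.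

Lemma expiX t n : expi t ^+ n = expi (t * n%:R).
Proof.
elim: n => [|n IH]; first by rewrite mulr0 expr0 expi0.
by rewrite exprSr IH -natr1 mulrDr mulr1 expiD.
Qed.

Lemma expi2pi : expi (2 * pi) = 1 :> R[i].
Proof. by rewrite mulr_natl /expi cos2pi sin2pi. Qed.

Lemma expipi : expi pi = -1 :> R[i].
Proof. by rewrite /expi cospi sinpi; apply/eqP; rewrite eq_complex /= oppr0 !eqxx. Qed.

Lemma sin_le t : 0 <= t -> sin t <= t.
Proof.
rewrite le_eqVlt => /orP[/eqP<-|t0]; first by rewrite sin0.
have [|c _] := @MVT_segment R sin cos 0 t (ltW t0).
  by apply: continuous_subspaceT; exact: continuous_sin.
rewrite sin0 !subr0 => ->.
by rewrite ler_piMl ?cos_le1 // ltW.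
Qed.

Lemma sin_ge_cos t : 0 <= t <= pi -> t * cos t <= sin t.
Proof.
move=> /andP[]; rewrite le_eqVlt => /orP[/eqP<-|t0 tpi].
  by rewrite mul0r sin0.
have [|c] := @MVT_segment R sin cos 0 t (ltW t0).
  by apply: continuous_subspaceT; exact: continuous_sin.
rewrite in_itv /= => /andP[c0 ct]; rewrite sin0 !subr0 => ->.
rewrite mulrC ler_wpM2r ?(ltW t0) //.
have [->//|cneq] := eqVneq c t.
apply: ltW; rewrite ltr_cos ?in_itv /= ?c0 ?(ltW t0) ?(le_trans ct) //.
by rewrite lt_neqAle cneq.
Qed.

(** Doubling the angle in the previous bound gives sin t >= t cos(t/2)^2 = t (1 + cos t) / 2, and
    cos t >= 0 on this range. *)
Lemma sin_ge_half t : 0 <= t <= pi / 2 -> t / 2 <= sin t.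
Proof.
move=> /andP[t0 tp]; have pi0 := pi_gt0 R.
have h : t / 2 * cos (t / 2) <= sin (t / 2).
  by apply: sin_ge_cos; apply/andP; split; lra.
have ct : 0 <= cos t by apply: cos_ge0_pihalf; apply/andP; split; lra.
have ct2 : 0 <= cos (t / 2) by apply: cos_ge0_pihalf; apply/andP; split; lra.
have tE : t = (t / 2) *+ 2 by rewrite -mulr_natr divfK.
have := cos_mulr2n (t / 2); rewrite -tE => c2.
rewrite {2}tE sin_mulr2n.
have := cos_le1 (t / 2).
by move: c2 h ct ct2; move: (cos (t / 2)) (sin (t / 2)) (cos t) => c s d; nra.
Qed.

Lemma rnorm_expiB1 t : rnorm (expi t - 1) = 2 * `|sin (t / 2)|.
Proof.
have tE : t = (t / 2) *+ 2 by rewrite -mulr_natr divfK.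
apply/eqP; rewrite -(@eqrXn2 _ 2%N) ?rnorm_ge0 ?mulr_ge0 //.
rewrite rnorm_sqr exprMn real_normK ?num_real //.
have -> : complex.Re (expi t - 1) = cos t - 1 by [].
have -> : complex.Im (expi t - 1) = sin t by rewrite /= oppr0 addr0.
rewrite {1 2}tE sin_mulr2n cos_mulr2n.
have := cos2Dsin2 (t / 2); move: (cos _) (sin _) => c s h.
by apply/eqP; nra.
Qed.

Lemma rnorm_expiB1_le t : rnorm (expi t - 1) <= `|t|.
Proof.
rewrite rnorm_expiB1.
have -> : `|sin (t / 2)| = `|sin (`|t| / 2)|.
  by case: (ger0P t) => // _; rewrite mulNr sinN normrN.
move: (normr_ge0 t); move: `|t| => {}t t0.
have [tpi|/ltW tpi] := leP (t / 2) pi; last first.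
  have := sin_max (t / 2); have := pi_ge2 R; lra.
rewrite ger0_norm ?sin_ge0_pi ?tpi ?divr_ge0 //.
have := @sin_le (t / 2); lra.
Qed.

Lemma rnorm_expiB s t : rnorm (expi s - expi t) = rnorm (expi (s - t) - 1).
Proof.
have -> : expi s - expi t = (expi (s - t) - 1) * expi t.
  by rewrite mulrBl mul1r -expiD subrK.
by rewrite rnormM rnorm_expi mulr1.
Qed.

Lemma rnorm_expi_dist s t : rnorm (expi s - expi t) <= `|s - t|.
Proof. by rewrite rnorm_expiB rnorm_expiB1_le. Qed.

Lemma rnorm_expiB1_ge t : `|t| <= pi -> `|t| / 2 <= rnorm (expi t - 1).
Proof.
move=> tpi; rewrite rnorm_expiB1.
have -> : `|sin (t / 2)| = `|sin (`|t| / 2)|.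
  by case: (ger0P t) => // _; rewrite mulNr sinN normrN.
move: (normr_ge0 t) tpi; move: `|t| => {}t t0 tpi.
have tpi2 : 0 <= t / 2 <= pi / 2 by apply/andP; split; lra.
have := sin_ge_half tpi2; have := ler_norm (sin (t / 2)); lra.
Qed.

End Expi.

(** * The large sieve *)

Section SeparatedSums.
Variable R : realType.
Implicit Types (L d : R).

(** Telescoping: 1 / (x + d)^2 <= 1 / (d x) - 1 / (d (x + d)). The induction carries the remaining
    negative term along. *)
Lemma arith_sum_le L d N : 0 < L -> 0 < d ->
  \sum_(n < N) (L + d * n%:R) ^- 2 <= L ^- 2 + (d * L)^-1.
Proof.
move=> L0 d0.
suff H n : \sum_(i < n.+1) (L + d * i%:R) ^- 2 <=
    L ^- 2 + (d * L)^-1 - (d * (L + d * n%:R))^-1.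
  case: N => [|N].
    by rewrite big_ord0 addr_ge0 // invr_ge0 ?exprn_ge0 ?mulr_ge0 ?ltW.
  apply: le_trans (H N) _; rewrite lerBlDr lerDl invr_ge0 mulr_ge0 ?ltW //.
  by rewrite ltr_wpDr // mulr_ge0 // ltW.
elim: n => [|n IH]; first by rewrite big_ord1 !mulr0 !addr0 addrK.
rewrite big_ord_recr /=; apply: le_trans (lerD IH (lexx _)) _.
have n0 : 0 <= d * n%:R by rewrite mulr_ge0 // ltW.
have -> : d * n.+1%:R = d * n%:R + d by rewrite -natr1 mulrDr mulr1.
rewrite addrA; move: (d * n%:R) n0 => y y0; move: (L ^- 2 + _) => c.
have x0 : 0 < L + y by rewrite ltr_wpDr.
move: (L + y) x0 => x x0.
have xd0 : 0 < x + d by rewrite addr_gt0.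
have h : (x + d) ^- 2 <= (d * x)^-1 - (d * (x + d))^-1.
  have -> : (d * x)^-1 - (d * (x + d))^-1 = (x * (x + d))^-1.
    by field; rewrite !gt_eqF.
  by rewrite lef_pV2 ?posrE ?exprn_gt0 ?mulr_gt0 // expr2 ler_pM2r // lerDl ltW.
move: h; move: ((x + d) ^- 2) ((d * x)^-1) ((d * (x + d))^-1) => *; lra.
Qed.

(** Each cell [n d, (n + 1) d) contains at most one y k, so rounding down to multiples of d is
    injective and compares the sum with an arithmetic progression. *)
Lemma separated_sum_half (I : finType) (P : pred I) (y : I -> R) L d :
    0 < L -> 0 < d -> (forall k, P k -> 0 <= y k) ->
    (forall k l, k != l -> d <= `|y k - y l|) ->
  \sum_(k | P k) (L + y k) ^- 2 <= L ^- 2 + (d * L)^-1.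
Proof.
move=> L0 d0 y0 sep.
pose n k := Num.truncn (y k / d).
have nP k : P k -> (n k)%:R * d <= y k < (n k).+1%:R * d.
  move=> Pk; rewrite -ler_pdivlMr // -ltr_pdivrMr //.
  by apply: truncn_itv; rewrite divr_ge0 ?y0 // ltW.
pose N := (\max_k n k)%N.
pose f k : 'I_N.+1 := inord (n k).
have fE k : f k = n k :> nat.
  by rewrite /f inordK // ltnS /N (bigD1 k) //= leq_maxl.
have finj : {in P &, injective f}.
  move=> k l Pk Pl /(congr1 val) /=; rewrite !fE => nkl; apply/eqP.
  apply/negPn/negP => /sep; apply/negP; rewrite -ltNge ltr_norml.
  move: (nP _ Pk) (nP _ Pl); rewrite nkl -natr1 mulrDl mul1r.
  by move=> /andP[? ?] /andP[? ?]; apply/andP; split; lra.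
apply: le_trans (arith_sum_le N.+1 L0 d0).
apply: (@le_trans _ _ (\sum_(k | P k) (L + d * (f k)%:R) ^- 2)).
  apply: ler_sum => k Pk; rewrite lef_pV2 ?posrE ?exprn_gt0 //.
  - rewrite ler_sqr ?nnegrE ?addr_ge0 ?mulr_ge0 ?y0 ?(ltW L0) ?(ltW d0) //.
    by rewrite lerD2l fE mulrC; case/andP: (nP _ Pk).
  - by rewrite ltr_wpDr ?y0.
  - by rewrite ltr_wpDr // mulr_ge0 // ltW.
rewrite -(big_imset (fun j : 'I_N.+1 => (L + d * j%:R) ^- 2) finj) /=.
rewrite big_mkcond /=; apply: ler_sum => j _; case: ifP => // _.
by rewrite invr_ge0 exprn_ge0 // addr_ge0 ?mulr_ge0 // ltW.
Qed.

Lemma separated_sum_le (I : finType) (y : I -> R) L d :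
    0 < L -> 0 < d -> (forall k l, k != l -> d <= `|y k - y l|) ->
  \sum_k (L + `|y k|) ^- 2 <= 2 * (L ^- 2 + (d * L)^-1).
Proof.
move=> L0 d0 sep; rewrite (bigID (fun k => 0 <= y k)) /= mulr_natl mulr2n.
apply: lerD.
  under eq_bigr => k k0 do rewrite ger0_norm //.
  exact: separated_sum_half.
under eq_bigr => k k0 do rewrite ltr0_norm ?ltNge //.
apply: (@separated_sum_half _ _ (fun k => - y k)) => // k; last first.
  by move=> l /sep; rewrite -opprD normrN.
by rewrite -ltNge oppr_ge0 => /ltW.
Qed.

End SeparatedSums.

Section Geometric.
Variable R : realType.
Implicit Types w : R[i].

Lemma rnorm_geom_le w n : rnorm w = 1 -> rnorm (\sum_(i < n) w ^+ i) <= n%:R.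
Proof.
move=> w1; apply: le_trans (rnorm_sum _ _ _) _.
under eq_bigr do rewrite rnormX w1 expr1n.
by rewrite sumr_const card_ord.
Qed.

Lemma rnorm_geom_mul_le w n :
  rnorm w = 1 -> rnorm (w - 1) * rnorm (\sum_(i < n) w ^+ i) <= 2.
Proof.
move=> w1; rewrite -rnormM -subrX1.
by apply: le_trans (rnormB _ _) _; rewrite rnormX w1 expr1n rnorm1.
Qed.

End Geometric.

Section Hilbert.
Variables (R : realType) (H : normedModType R[i]) (dot : {dot H for Num.conj}).
Hypothesis hdot : forall v : H, dot v v = `|v| ^+ 2.
Implicit Types (u v : H).

Lemma dot_rnorm v : dot v v = ((rnorm v) ^+ 2)%:C.
Proof. by rewrite hdot normC_rnorm rmorphXn. Qed.

Lemma dot_conj u v : dot u v = (dot v u)^*%C.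
Proof. by rewrite hermC expr0 mul1r. Qed.

(** Expand |t u - v|^2 >= 0. The weight t is taken as 1 / |g| to absorb a scalar factor g, and as B
    in the dual large sieve. *)
Lemma Re_dot_le u v t : 0 < t ->
  2 * complex.Re (dot u v) <= t * rnorm u ^+ 2 + rnorm v ^+ 2 / t.
Proof.
move=> t0; have := sqr_ge0 (rnorm (t%:C *: u - v)).
have : (rnorm (t%:C *: u - v) ^+ 2)%:C =
   (t ^+ 2 * rnorm u ^+ 2 + rnorm v ^+ 2 - 2 * t * complex.Re (dot u v))%:C.
  set rhs := (X in _ = X%:C).
  rewrite -dot_rnorm linearBl !linearBr /= !linearZl_LR !linearZr_LR /=.
  rewrite !dot_rnorm (dot_conj v u); case E: (dot u v) => [a b].
  simpc; congr Complex; rewrite /rhs E.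
  by have -> : complex.Re (a +i* b) = a by []; ring.
move=> /complexI -> h.
have tv : t * (rnorm v ^+ 2 / t) = rnorm v ^+ 2.
  by rewrite mulrCA divff ?gt_eqF // mulr1.
by rewrite -(ler_pM2l t0) mulrDr tv; lra.
Qed.

Lemma Re_mul_dot_le u v (g : R[i]) :
  complex.Re (g * dot u v) <= rnorm g * ((rnorm u ^+ 2 + rnorm v ^+ 2) / 2).
Proof.
have [->|g0] := eqVneq g 0; first by rewrite mul0r rnorm0 mul0r.
rewrite -linearZl_LR /=.
have n0 : 0 < rnorm g by rewrite lt_neqAle eq_sym rnorm_eq0 g0 rnorm_ge0.
have /(Re_dot_le (g *: u) v) : 0 < (rnorm g)^-1 by rewrite invr_gt0.
rewrite rnormZ exprMn expr2 invrK !mulrA mulVf ?gt_eqF // mul1r.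
by move: (complex.Re _) => x; lra.
Qed.

Lemma rnorm_sqr_sum (I : finType) (c : I -> R[i]) (V : I -> H) :
  ((rnorm (\sum_k c k *: V k)) ^+ 2)%:C =
  \sum_k \sum_l (c k * (c l)^*%C) * dot (V k) (V l).
Proof.
rewrite -dot_rnorm linear_sumlz; apply: eq_bigr => k _.
rewrite linear_sumr; apply: eq_bigr => l _.
by rewrite linearZl_LR linearZr_LR /= mulrA.
Qed.

(** Each product |V k| |V l| is split equally between |V k|^2 and |V l|^2; the row sums control one
    half and the column sums the other. *)
Lemma schur_test (I : finType) (G : I -> I -> R[i]) (V : I -> H) B :
    (forall k, \sum_l rnorm (G k l) <= B) ->
    (forall l, \sum_k rnorm (G k l) <= B) ->
  complex.Re (\sum_k \sum_l G k l * dot (V k) (V l)) <=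
    B * \sum_k rnorm (V k) ^+ 2.
Proof.
move=> B1 B2.
apply: (@le_trans _ _ (\sum_k \sum_l rnorm (G k l) *
   ((rnorm (V k) ^+ 2 + rnorm (V l) ^+ 2) / 2))).
  rewrite (raddf_sum (@complex.Re R : Rcomplex R -> R)); apply: ler_sum => k _.
  rewrite (raddf_sum (@complex.Re R : Rcomplex R -> R)); apply: ler_sum => l _.
  exact: Re_mul_dot_le.
have -> : \sum_k \sum_l rnorm (G k l) *
   ((rnorm (V k) ^+ 2 + rnorm (V l) ^+ 2) / 2) =
   (\sum_k (\sum_l rnorm (G k l)) * rnorm (V k) ^+ 2 +
    \sum_l (\sum_k rnorm (G k l)) * rnorm (V l) ^+ 2) / 2.
  under [X in _ = (_ + X) / 2]eq_bigr do rewrite mulr_suml.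
  rewrite [X in _ = (_ + X) / 2]exchange_big /= -big_split /= mulr_suml.
  apply: eq_bigr => k _; rewrite mulr_suml -big_split /= mulr_suml.
  by apply: eq_bigr => l _; ring.
rewrite ler_pdivrMr // mulr_natr mulr2n mulr_sumr.
by apply: lerD; apply: ler_sum => k _; rewrite ler_wpM2r ?sqr_ge0.
Qed.

Lemma box_sum_expand (I : finType) (z : I -> R[i]) (V : I -> H) P Q :
  (\sum_(p < P) \sum_(q < Q) rnorm (\sum_k z k ^+ (p + q) *: V k) ^+ 2)%:C =
  \sum_k \sum_l ((\sum_(p < P) (z k * (z l)^*%C) ^+ p) *
     (\sum_(q < Q) (z k * (z l)^*%C) ^+ q)) * dot (V k) (V l).
Proof.
rewrite rmorph_sum /=.
under eq_bigr => p _.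
  rewrite rmorph_sum /=.
  under eq_bigr => q _ do rewrite rnorm_sqr_sum.
  rewrite exchange_big /=.
  under eq_bigr => k _ do rewrite exchange_big /=.
  over.
rewrite exchange_big /=; apply: eq_bigr => k _.
rewrite exchange_big /=; apply: eq_bigr => l _.
rewrite !mulr_suml; apply: eq_bigr => p _.
rewrite mulr_sumr mulr_suml; apply: eq_bigr => q _.
by rewrite rmorphXn -exprMn exprD.
Qed.

(* Every window [q', q' + K) with q' < K is covered by the points p + q,
   p < 2K, q < K; squaring the box sum turns the off-diagonal kernel into a
   product of two Dirichlet kernels, which is summable in the Schur test. *)
Lemma large_sieve (I : finType) (u : I -> R) (V : I -> H) (gam h : R) (K : nat) :
    0 < gam -> 0 < h -> (0 < K)%N ->
    (forall k l, k != l -> gam <= `|u k - u l|) ->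
    (forall k l, h * `|u k - u l| <= pi) ->
  \sum_(m < K) rnorm (\sum_k expi (h * u k) ^+ m *: V k) ^+ 2 <=
    128 * K%:R * (1 + (K%:R * h * gam)^-1) * \sum_k rnorm (V k) ^+ 2.
Proof.
move=> g0 h0 K0 sep hpi; have K0' : 0 < K%:R :> R by rewrite ltr0n.
(* This rotation moves the samples to the exponents m + K - 1. For every q < K the index p = m + K -
   1 - q then lies in [0, 2K), so the box sum contains K copies of the sum to be bounded. *)
pose W k := expi (h * u k) ^- K.-1 *: V k.
have WE k : rnorm (W k) = rnorm (V k).
  by rewrite /W rnormZ rnormV rnormX rnorm_expi expr1n invr1 mul1r.
have XE m : \sum_k expi (h * u k) ^+ m *: V k =
            \sum_k expi (h * u k) ^+ (m + K.-1) *: W k.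
  apply: eq_bigr => k _; rewrite /W scalerA exprD mulfK //.
  by rewrite expf_neq0 // expi_neq0.
under eq_bigr do rewrite XE.
under [X in _ <= _ * X]eq_bigr do rewrite -WE.
rewrite -(ler_pM2l K0').
pose F n := rnorm (\sum_k expi (h * u k) ^+ n *: W k) ^+ 2.
apply: (@le_trans _ _ (\sum_(p < 2 * K) \sum_(q < K) F (p + q)%N)).
  rewrite exchange_big /= mulr_natl -[X in _ *+ X]card_ord -sumr_const.
  apply: ler_sum => q _.
  rewrite -(big_mkord xpredT (fun m => F (m + K.-1)%N)).
  rewrite -(big_mkord xpredT (fun p => F (p + q)%N)).
  have qK : (q <= K.-1)%N by rewrite -ltnS prednK.
  rewrite [leRHS](@big_cat_nat _ _ _ (K.-1 - q)) //=; last first.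
    by lia.
  rewrite [X in _ + X](@big_cat_nat _ _ _ (K.-1 - q + K) (K.-1 - q)) ?leq_addr //=; last first.
    by lia.
  rewrite addrCA -[leLHS]addr0; apply: lerD; last first.
    by rewrite addr_ge0 // sumr_ge0 // => i _; rewrite sqr_ge0.
  have -> // : \sum_(K.-1 - q <= i < K.-1 - q + K) F (i + q)%N =
               \sum_(0 <= i < K) F (i + K.-1)%N.
  rewrite -{1}[(K.-1 - q)%N]add0n big_addn addKn.
  by apply: eq_bigr => i _; congr F; lia.
pose w k l : R[i] := expi (h * u k) * (expi (h * u l))^*%C.
have wE k l : w k l = expi (h * (u k - u l)).
  by rewrite /w -expiN -expiD mulrBr.
have w1 k l : rnorm (w k l) = 1 by rewrite wE rnorm_expi.
pose G k l := (\sum_(p < 2 * K) w k l ^+ p) * (\sum_(q < K) w k l ^+ q).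
(* With x the angle: for K x <= 1 the trivial bound 2K * K suffices. Otherwise each kernel is at
   most 2 over the chord, the chord is at least x / 2, and 1 + K x <= 2 K x; this gives 64 = 16 * 2
   * 2. *)
have GE k l : rnorm (G k l) <= 64 * K%:R ^+ 2 * (1 + `|K%:R * h * (u k - u l)|) ^- 2.
  have hu0 : 0 <= h * `|u k - u l| by rewrite mulr_ge0 // ltW.
  have -> : `|K%:R * h * (u k - u l)| = K%:R * (h * `|u k - u l|).
    by rewrite -mulrA !normrM (gtr0_norm h0) (gtr0_norm K0').
  have xc : h * `|u k - u l| / 2 <= rnorm (w k l - 1).
    have := rnorm_expiB1_ge (t := h * (u k - u l)).
    by rewrite normrM (gtr0_norm h0) -wE; apply; exact: hpi.
  rewrite /G rnormM.
  have DK := rnorm_geom_le (2 * K) (w1 k l).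
  have EK := rnorm_geom_le K (w1 k l).
  have cD := rnorm_geom_mul_le (2 * K) (w1 k l).
  have cE := rnorm_geom_mul_le K (w1 k l).
  have D0 := rnorm_ge0 (\sum_(p < 2 * K) w k l ^+ p).
  have E0 := rnorm_ge0 (\sum_(p < K) w k l ^+ p).
  rewrite natrM in DK.
  move: (h * _) (rnorm (w k l - 1)) (rnorm (\sum_(p < 2 * K) _)) (rnorm (\sum_(p < K) _)) hu0 xc DK EK cD cE D0 E0.
  move=> x c D E x0 xc DK EK cD cE D0 E0.
  have y0 : 0 <= K%:R * x by rewrite mulr_ge0 // ltW.
  have DE0 : 0 <= D * E by rewrite mulr_ge0.
  rewrite ler_pdivlMr ?exprn_gt0 ?ltr_wpDr //.
  have [y1|/ltW y1] := leP (K%:R * x) 1.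
    apply: (@le_trans _ _ ((2 * K%:R * K%:R) * 2 ^+ 2)); last first.
      by have := sqr_ge0 (K%:R : R); rewrite !expr2; lra.
    apply: ler_pM => //; rewrite ?exprn_ge0 ?addr_ge0 //.
      exact: ler_pM.
    by rewrite ler_sqr ?nnegrE ?addr_ge0 // -[leRHS]/(1 + 1) lerD2l.
  apply: (@le_trans _ _ (D * E * (2 * (K%:R * x)) ^+ 2)).
    by rewrite ler_wpM2l // ler_sqr ?nnegrE ?addr_ge0 ?mulr_ge0 //; lra.
  have -> : D * E * (2 * (K%:R * x)) ^+ 2 =
      16 * K%:R ^+ 2 * ((x / 2 * D) * (x / 2 * E)) by field.
  have -> : 64 * K%:R ^+ 2 = 16 * K%:R ^+ 2 * (2 * 2) :> R by ring.
  rewrite ler_wpM2l ?mulr_ge0 ?sqr_ge0 //.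
  have x20 : 0 <= x / 2 by rewrite divr_ge0.
  by apply: ler_pM; rewrite ?mulr_ge0 //;
    [apply: le_trans cD | apply: le_trans cE]; rewrite ler_wpM2r.
pose B := 128 * K%:R ^+ 2 * (1 + (K%:R * h * gam)^-1).
have row (y : R) :
    \sum_l 64 * K%:R ^+ 2 * (1 + `|K%:R * h * (y - u l)|) ^- 2 <= B.
  rewrite -mulr_sumr.
  have -> : B = 64 * K%:R ^+ 2 * (2 * (1 + (K%:R * h * gam)^-1)) by rewrite /B; ring.
  rewrite ler_wpM2l ?mulr_ge0 ?sqr_ge0 //.
  have := @separated_sum_le R I (fun l => K%:R * h * (y - u l)) 1 (K%:R * h * gam) ltr01.
  rewrite expr1n invr1 mulr1; apply; first by rewrite !mulr_gt0.
  move=> i j ij; rewrite -mulrBr normrM gtr0_norm ?mulr_gt0 //.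
  rewrite ler_wpM2l ?mulr_ge0 ?(ltW h0) //.
  have -> : y - u i - (y - u j) = u j - u i by ring.
  by rewrite distrC; apply: sep.
have -> : K%:R * (128 * K%:R * (1 + (K%:R * h * gam)^-1) * \sum_k rnorm (W k) ^+ 2) =
    B * \sum_k rnorm (W k) ^+ 2 by rewrite /B; ring.
have -> : \sum_(p < 2 * K) \sum_(q < K) F (p + q)%N =
    complex.Re (\sum_k \sum_l G k l * dot (W k) (W l)).
  by rewrite /G -box_sum_expand.
apply: schur_test => k.
  by apply: le_trans (row (u k)); apply: ler_sum.
apply: le_trans (row (u k)); apply: ler_sum => l _.
by apply: le_trans (GE _ _) _; rewrite !normrM (distrC (u l)).
Qed.

(** An operator and its adjoint have the same norm. The left side S is the pairing of y with the
    direct operator applied to w; the weighted inequality and the hypothesis at w give 2 S <= B sum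
    |y m|^2 + S. *)
Lemma large_sieve_dual (I : finType) (z : I -> R[i]) K B : 0 < B ->
    (forall V : I -> H, \sum_(m < K) rnorm (\sum_k z k ^+ m *: V k) ^+ 2 <=
      B * \sum_k rnorm (V k) ^+ 2) ->
  forall y : nat -> H,
  \sum_k rnorm (\sum_(m < K) (z k ^+ m)^*%C *: y m) ^+ 2 <=
    B * \sum_(m < K) rnorm (y m) ^+ 2.
Proof.
move=> B0 LS y.
pose w k := \sum_(m < K) (z k ^+ m)^*%C *: y m.
pose S := \sum_k rnorm (w k) ^+ 2.
have SE : S = \sum_(m < K) complex.Re (dot (y m) (\sum_k z k ^+ m *: w k)).
  have -> : S = complex.Re (\sum_k dot (w k) (w k)).
    rewrite (raddf_sum (@complex.Re R : Rcomplex R -> R)).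
    by apply: eq_bigr => k _; rewrite dot_rnorm.
  rewrite -(raddf_sum (@complex.Re R : Rcomplex R -> R)).
  congr complex.Re; under eq_bigr => k _ do rewrite {1}/w linear_sumlz.
  rewrite exchange_big /=; apply: eq_bigr => m _.
  rewrite linear_sumr; apply: eq_bigr => k _.
  by rewrite linearZl_LR linearZr_LR.
have h : 2 * S <= \sum_(m < K) (B * rnorm (y m) ^+ 2 +
    rnorm (\sum_k z k ^+ m *: w k) ^+ 2 / B).
  by rewrite SE mulr_sumr; apply: ler_sum => m _; apply: Re_dot_le.
have h2 : (\sum_(m < K) rnorm (\sum_k z k ^+ m *: w k) ^+ 2) / B <= S.
  by rewrite ler_pdivrMr // mulrC; apply: LS.
move: h; rewrite big_split /= -mulr_sumr -mulr_suml -/(w _) => h.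
rewrite -/S; lra.
Qed.

End Hilbert.

(** * Interpolation at points of the circle *)

Section HalfIntegerRoots.
Variable R : realType.

Lemma expi_neq1 (t : R) : 0 < `|t| < 2 * pi -> expi t != 1.
Proof.
move=> /andP[t0 t2]; rewrite -subr_eq0 -rnorm_eq0 rnorm_expiB1.
rewrite mulf_eq0 negb_or pnatr_eq0 /= normr_eq0.
have : sin (`|t| / 2) != 0.
  by rewrite gt_eqF // sin_gt0_pi //; apply/andP; split; lra.
by case: (ger0P t) => // _; rewrite mulNr sinN oppr_eq0.
Qed.

(** The offset 1/2 makes these the roots of z^J + 1 instead of z^J - 1, so that none of them is the
    point 1, where the polynomials are normalized. *)
Definition half_root (J j : nat) : R[i] := expi (2 * pi / J%:R * (j%:R + 2^-1)).

Lemma rnorm_half_root J j : rnorm (half_root J j) = 1.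
Proof. exact: rnorm_expi. Qed.

Lemma half_rootX J j : (0 < J)%N -> half_root J j ^+ J = -1.
Proof.
move=> J0; have J0' : J%:R != 0 :> R by rewrite pnatr_eq0 -lt0n.
have -> : half_root J j = expi (2 * pi / J%:R) ^+ j * expi (pi / J%:R).
  by rewrite expiX -expiD /half_root; congr expi; field.
rewrite exprMn exprAC !expiX !divfK // expipi -expiX expi2pi expr1n mul1r //.
Qed.

Lemma half_root_inj J : (0 < J)%N ->
  {in gtn J &, injective (half_root J)}.
Proof.
move=> J0; suff H i j : (i < j < J)%N -> half_root J i != half_root J j.
  move=> i j; rewrite !inE => iJ jJ ij; apply/eqP.
  case: (ltngtP i j) => // h.
    by have := H i j; rewrite h jJ ij eqxx => /(_ isT).
  by have := H j i; rewrite h iJ ij eqxx => /(_ isT).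
move=> /andP[ij jJ]; rewrite eq_sym -subr_eq0.
have -> : half_root J j - half_root J i =
    (expi (2 * pi / J%:R * (j%:R - i%:R)) - 1) * half_root J i.
  rewrite mulrBl mul1r /half_root -expiD; congr (expi _ - _).
  by rewrite -mulrDr addrA subrK.
rewrite mulf_neq0 ?expi_neq0 // subr_eq0 expi_neq1 //.
have J0' : 0 < J%:R :> R by rewrite ltr0n.
have p0 : 0 < 2 * pi / J%:R :> R by rewrite divr_gt0 ?mulr_gt0 ?pi_gt0.
have ij0 : 0 < j%:R - i%:R :> R by rewrite subr_gt0 ltr_nat.
have d1 : (j%:R - i%:R) / J%:R < 1 :> R.
  by rewrite ltr_pdivrMr // mul1r ltrBlDr -natrD ltr_nat ltn_addr.
have d0 : 0 < (j%:R - i%:R) / J%:R :> R by rewrite divr_gt0.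
have -> : 2 * pi / J%:R * (j%:R - i%:R) = 2 * pi * ((j%:R - i%:R) / J%:R) :> R.
  by rewrite -[LHS]mulrA [X in _ * X]mulrC.
have pi2 : 0 < 2 * pi :> R by rewrite mulr_gt0 ?pi_gt0.
have x0 := mulr_gt0 pi2 d0; by rewrite (gtr0_norm x0) x0 /= gtr_pMr.
Qed.

Lemma prod_half_root J : (0 < J)%N ->
  'X^J + 1 = \prod_(j < J) ('X - (half_root J j)%:P).
Proof.
move=> J0; pose rs := [seq half_root J (i : 'I_J) | i : 'I_J].
have szp : size ('X^J + 1 : {poly R[i]}) = J.+1.
  by rewrite size_polyDl size_polyXn // size_poly1 ltnS.
have := @all_roots_prod_XsubC _ ('X^J + 1) rs.
rewrite szp size_map size_enum_ord => /(_ erefl).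
rewrite lead_coefDl ?size_polyXn ?size_poly1 ?ltnS // lead_coefXn scale1r.
rewrite big_map big_enum /=; apply.
  apply/allP => z /mapP[i _ ->].
  by rewrite rootE !hornerE half_rootX // addNr.
rewrite uniq_rootsE map_inj_uniq ?enum_uniq // => i j ij; apply: val_inj.
by apply: (half_root_inj J0); rewrite ?inE ?ltn_ord.
Qed.

Lemma prod_dist_half_root1 J : (0 < J)%N ->
  \prod_(j < J) rnorm (1 - half_root J j) = 2.
Proof.
move=> J0; rewrite -rnorm_prod.
have := congr1 (fun p => p.[1]) (prod_half_root J0).
rewrite /= !hornerE horner_prod expr1n.
by under eq_bigr do rewrite !hornerE; move=> <-; rewrite -rnorm_nat.
Qed.

(* Dividing X^J + 1 by one of its linear factors leaves a polynomial with J
   unimodular coefficients. *)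
Lemma prod_dist_half_root_le n (j1 : 'I_n.+1) (z : R[i]) : rnorm z = 1 ->
  \prod_(i < n) rnorm (z - half_root n.+1 (lift j1 i)) <= n.+1%:R.
Proof.
move=> z1; pose J := n.+1; have J0 : (0 < J)%N by [].
rewrite -rnorm_prod.
have E : \prod_(i < n) ('X - (half_root J (lift j1 i))%:P) =
         \sum_(i < J) 'X^(J.-1 - i) * ((half_root J j1) ^+ i)%:P.
  apply: (@mulfI _ ('X - (half_root J j1)%:P)); first by rewrite polyXsubC_eq0.
  have := prod_half_root J0; rewrite (bigD1_ord j1) //= => <-.
  have := subrXX 'X (half_root J j1)%:P J.
  rewrite -rmorphXn half_rootX // rmorphN1 opprK => ->; congr (_ * _).
  by apply: eq_bigr => i _; rewrite -rmorphXn.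
have := congr1 (fun p => p.[z]) E; rewrite /= horner_prod.
under eq_bigr do rewrite !hornerE.
move=> ->; rewrite horner_sum.
apply: le_trans (rnorm_sum _ _ _) _.
rewrite -[leRHS]mulr1 mulr_natl -[X in _ *+ X]card_ord -sumr_const.
apply: ler_sum => i _; rewrite !hornerE rnormM !rnormX z1.
by rewrite rnorm_half_root !expr1n mulr1.
Qed.

End HalfIntegerRoots.

(** * Dependence of a normalized factor |z - z_x| / |1 - z_x| on its node *)

Section SineRatio.
Variable R : realType.
Implicit Types (s x y : R).

(** In cross-multiplied form, sin (s - x) / sin x decreases in x. Its modulus is |e^(2is) - e^(2ix)|
    / |1 - e^(2ix)|, the size at angle 2s of the linear factor with root at angle 2x and value 1 at
    angle 0. *)
Lemma sine_ratio_mono s x y : 0 <= s <= pi -> 0 < x -> x <= y -> y < pi ->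
  sin (s - y) * sin x <= sin (s - x) * sin y.
Proof.
move=> s0 x0 xy yp; rewrite -subr_ge0.
have -> : sin (s - x) * sin y - sin (s - y) * sin x = sin s * sin (y - x).
  rewrite !sinB; have := cos2Dsin2 x; have := cos2Dsin2 y.
  by move: (sin x) (cos x) (sin y) (cos y) (sin s) (cos s) => *; ring.
by rewrite mulr_ge0 ?sin_ge0_pi //; apply/andP; split; lra.
Qed.

Lemma sine_ratio_right s x y : 0 <= s -> s <= x -> 0 < x -> x <= y -> y < pi ->
  `|sin (s - x)| / `|sin x| <= `|sin (s - y)| / `|sin y|.
Proof.
move=> s0 sx x0 xy yp.
have sx0 : 0 < sin x by apply: sin_gt0_pi; apply/andP; split; lra.
have sy0 : 0 < sin y by apply: sin_gt0_pi; apply/andP; split; lra.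
rewrite (gtr0_norm sx0) (gtr0_norm sy0) ler_pdivrMr // mulrAC ler_pdivlMr //.
rewrite -opprB sinN normrN -[s - y]opprB sinN normrN !ger0_norm; last first.
- by apply: sin_ge0_pi; apply/andP; split; lra.
- by apply: sin_ge0_pi; apply/andP; split; lra.
have := @sine_ratio_mono s x y; rewrite -[s - y]opprB -[s - x]opprB !sinN !mulNr lerN2.
by apply => //; apply/andP; split; lra.
Qed.

Lemma sine_ratio_left s x y : s <= pi -> 0 < x -> x <= y -> y <= s -> y < pi ->
  `|sin (s - y)| / `|sin y| <= `|sin (s - x)| / `|sin x|.
Proof.
move=> sp x0 xy ys yp.
have sx0 : 0 < sin x by apply: sin_gt0_pi; apply/andP; split; lra.
have sy0 : 0 < sin y by apply: sin_gt0_pi; apply/andP; split; lra.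
rewrite (gtr0_norm sx0) (gtr0_norm sy0) ler_pdivrMr // mulrAC ler_pdivlMr //.
rewrite !ger0_norm; last first.
- by apply: sin_ge0_pi; apply/andP; split; lra.
- by apply: sin_ge0_pi; apply/andP; split; lra.
by apply: sine_ratio_mono => //; apply/andP; split; lra.
Qed.

(** With A = y - s <= B = s - x, the cross products differ by sin s sin (B - A) + 2 cos s sin A sin
    B, and both terms are nonnegative. *)
Lemma sine_ratio_cross s x y : s <= pi / 2 -> 0 < x -> x < s -> s < y -> y < pi ->
  y - s <= s - x -> `|sin (s - y)| / `|sin y| <= `|sin (s - x)| / `|sin x|.
Proof.
move=> sp x0 xs sy yp d; have pi0 := pi_gt0 R.
have sx0 : 0 < sin x by apply: sin_gt0_pi; apply/andP; split; lra.
have sy0 : 0 < sin y by apply: sin_gt0_pi; apply/andP; split; lra.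
rewrite (gtr0_norm sx0) (gtr0_norm sy0) ler_pdivrMr // mulrAC ler_pdivlMr //.
rewrite -opprB sinN normrN !ger0_norm; last first.
- by apply: sin_ge0_pi; apply/andP; split; lra.
- by apply: sin_ge0_pi; apply/andP; split; lra.
have -> : sin x = sin (s - (s - x)) by congr sin; ring.
have -> : sin y = sin (s + (y - s)) by congr sin; ring.
have a0 : 0 <= sin (y - s) by apply: sin_ge0_pi; apply/andP; split; lra.
have b0 : 0 <= sin (s - x) by apply: sin_ge0_pi; apply/andP; split; lra.
have c0 : 0 <= cos s by apply: cos_ge0_pihalf; apply/andP; split; lra.
have s0 : 0 <= sin s by apply: sin_ge0_pi; apply/andP; split; lra.
have : 0 <= sin ((s - x) - (y - s)) by apply: sin_ge0_pi; apply/andP; split; lra.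
rewrite (sinB s (s - x)) (sinD s (y - s)) (sinB (s - x)).
move: (sin (y - s)) (cos (y - s)) (sin (s - x)) (cos (s - x)) a0 b0 => sa ca sb cb.
move=> a0 b0 h; have := mulr_ge0 s0 h; have := mulr_ge0 c0 (mulr_ge0 a0 b0).
by move: (sin s) (cos s) => ss cs; nra.
Qed.

(** For a node on the left of s that must be compared with a grid point on the right, against the
    monotonicity. The factor 6 is 3 * 2, from sin y <= y <= 3 x and x <= 2 sin x. *)
Lemma sine_ratio_near s x y : s <= pi / 2 -> 0 < x -> x < s -> s < y -> y < pi -> y <= 3 * x ->
  s - x <= y - s -> y - s <= pi / 2 ->
  `|sin (s - x)| / `|sin x| <= 6 * (`|sin (s - y)| / `|sin y|).
Proof.
move=> sp x0 xs sy yp y3 d dp; have pi0 := pi_gt0 R.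
have sx0 : 0 < sin x by apply: sin_gt0_pi; apply/andP; split; lra.
have sy0 : 0 < sin y by apply: sin_gt0_pi; apply/andP; split; lra.
have h1 : sin (s - x) <= sin (y - s).
  move: d; rewrite le_eqVlt => /orP[/eqP->//|d].
  by apply: ltW; rewrite ltr_sin // in_itv /=; apply/andP; split; lra.
have h0 : 0 <= sin (s - x) by apply: sin_ge0_pi; apply/andP; split; lra.
rewrite (gtr0_norm sx0) (gtr0_norm sy0) -[s - y]opprB sinN normrN.
rewrite (ger0_norm h0) (ger0_norm (le_trans h0 h1)).
have h2 : sin y <= 6 * sin x.
  have hx : 0 <= x <= pi / 2 by apply/andP; split; lra.
  have hy : 0 <= y by lra.
  by have := sin_ge_half hx; have := sin_le hy; lra.
rewrite ler_pdivrMr // mulrA mulrAC ler_pdivlMr //.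
rewrite mulrAC mulrC; apply: ler_pM => //; exact: ltW.
Qed.

End SineRatio.

Section BlockProduct.
Variables (R : realType) (n : nat).
Let J := n.+1.
Hypothesis n1 : (1 < n)%N.

(** Half the central angle of an arc of length x on a circle of circumference N, so that chords are
    twice its sine. *)
Definition chord_angle (N : nat) (x : R) : R := pi / N%:R * x.
Local Notation ang := (chord_angle J).

Lemma chord_angle_lt x y : x < y -> ang x < ang y.
Proof. by move=> xy; rewrite ltr_pM2l // divr_gt0 ?pi_gt0. Qed.

Lemma chord_angle_le x y : x <= y -> ang x <= ang y.
Proof. by move=> xy; rewrite ler_wpM2l // divr_ge0 ?pi_ge0. Qed.

Lemma chord_angleB x y : ang (x - y) = ang x - ang y.
Proof. exact: mulrBr. Qed.

Lemma chord_angleN N : N%:R != 0 :> R -> chord_angle N N%:R = pi.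
Proof. by move=> N0; rewrite /chord_angle divfK. Qed.

Lemma chord_angle_half N : N%:R != 0 :> R -> chord_angle N (N%:R / 2) = pi / 2.
Proof. by move=> N0; rewrite /chord_angle mulrA divfK. Qed.

(* One node near each of 1, ..., n is compared with the half-integer grid from
   which the point next to s has been deleted by [bump]. *)
Lemma block_ratio_le (s : R) (lam : nat -> R) (i : nat) :
    0 <= s <= J%:R / 2 -> (i < n)%N ->
    i%:R + 2^-1 <= lam i <= i%:R + 3 / 2 ->
  `|sin (ang s - ang (lam i))| / `|sin (ang (lam i))| <=
  (if i == Num.truncn s then 6 else 1) *
  (`|sin (ang s - ang ((bump (Num.truncn s) i)%:R + 2^-1))| /
   `|sin (ang ((bump (Num.truncn s) i)%:R + 2^-1))|).
Proof.
move=> /andP[s0 sJ] iN /andP[l1 l2].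
have J0 : J%:R != 0 :> R by rewrite pnatr_eq0.
have a0 : ang 0 = 0 by rewrite /chord_angle mulr0.
have as0 : 0 <= ang s by rewrite -a0 chord_angle_le.
have asp : ang s <= pi / 2 by rewrite -(chord_angle_half J0) chord_angle_le.
have pi0 := pi_gt0 R.
have i0 : 0 <= i%:R :> R by [].
have iJ : i%:R + 3 / 2 < J%:R :> R.
  have : i.+1%:R <= n%:R :> R by rewrite ler_nat.
  by rewrite /J -(natr1 n) -(natr1 i); lra.
have alp : ang (lam i) < pi by rewrite -(chord_angleN J0) chord_angle_lt //; lra.
have al0 : 0 < ang (lam i) by rewrite -a0 chord_angle_lt //; lra.
have /andP[j1 j2] := truncn_itv s0; set j := Num.truncn s in j1 j2 *.
rewrite -(natr1 j) in j2.
(* Each node is compared with the end of its block farther from s: the left end for i < j, the right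
   end for i >= j. The grid point j + 1/2, within 1/2 of s, is thus left out. Only for i = j and a
   node before s is the factor 6 needed. *)
have [ij|ji|ij] := ltngtP i j.
- rewrite mul1r /bump leqNgt ij add0n.
  have ij' : i%:R + 1 <= j%:R :> R by rewrite natr1 ler_nat.
  have ah0 : 0 < ang (i%:R + 2^-1) by rewrite -a0 chord_angle_lt //; lra.
  have [ls|ls] := leP (lam i) s.
    apply: sine_ratio_left => //; rewrite ?chord_angle_le //; lra.
  apply: sine_ratio_cross => //; rewrite ?chord_angle_lt //; first by lra.
  by rewrite -!chord_angleB chord_angle_le //; lra.
- rewrite mul1r /bump (ltnW ji) add1n -(natr1 i).
  have ij' : j%:R + 1 <= i%:R :> R by rewrite natr1 ler_nat.
  apply: sine_ratio_right => //; rewrite ?chord_angle_le //; try lra.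
  by rewrite -(chord_angleN J0) chord_angle_lt //; lra.
rewrite /bump ij leqnn add1n -ij -(natr1 i).
rewrite -ij in j1 j2.
have ahp : ang (i%:R + 1 + 2^-1) < pi.
  by rewrite -(chord_angleN J0) chord_angle_lt //; lra.
have [ls|ls] := leP s (lam i).
  apply: le_trans (@sine_ratio_right _ _ _ (ang (i%:R + 1 + 2^-1)) _ _ _ _ _) _ => //.
  - by rewrite chord_angle_le.
  - by rewrite chord_angle_le //; lra.
  by rewrite ler_peMl ?divr_ge0 // ler1n.
apply: sine_ratio_near => //; rewrite ?chord_angle_lt //; try lra.
- have -> : 3 * ang (lam i) = ang (3 * lam i) by rewrite /chord_angle; ring.
  by rewrite chord_angle_le //; lra.
- by rewrite -!chord_angleB chord_angle_le //; lra.
rewrite -!chord_angleB -(chord_angle_half J0) chord_angle_le //.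
have : 3 <= J%:R :> R by rewrite ler_nat /J ltnS.
lra.
Qed.

Lemma rnorm_expi_chord (N : nat) (x y : R) :
  rnorm (expi (2 * pi / N%:R * x) - expi (2 * pi / N%:R * y)) =
  2 * `|sin (chord_angle N x - chord_angle N y)|.
Proof.
rewrite rnorm_expiB rnorm_expiB1 /chord_angle; congr (_ * `|sin _|).
by move: (N%:R^-1) => c; field.
Qed.

(** After comparison with the roots of z^J + 1 other than the deleted root z_j, the numerators
    multiply to at most J and the denominators to 2 / |1 - z_j|. As |1 - z_j| <= 2 pi (1 + s) / J,
    the quotient is at most pi (1 + s); the factor 6 is lost at most once. *)
Lemma block_product_le_half (s : R) (lam : nat -> R) :
    0 <= s <= J%:R / 2 ->
    (forall i, (i < n)%N -> i%:R + 2^-1 <= lam i <= i%:R + 3 / 2) ->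
  \prod_(i < n) (rnorm (expi (2 * pi / J%:R * s) - expi (2 * pi / J%:R * lam i)) /
                 rnorm (1 - expi (2 * pi / J%:R * lam i))) <= 6 * pi * (1 + s).
Proof.
move=> sJ lamP; case/andP: (sJ) => s0 sJ2.
have pi0 := pi_gt0 R.
have e1 : 1 = expi (2 * pi / J%:R * 0) :> R[i] by rewrite mulr0 expi0.
have phiE x : rnorm (expi (2 * pi / J%:R * s) - expi (2 * pi / J%:R * x)) /
    rnorm (1 - expi (2 * pi / J%:R * x)) =
    `|sin (ang s - ang x)| / `|sin (ang x)|.
  rewrite e1 !rnorm_expi_chord {3}/chord_angle mulr0 sub0r sinN normrN.
  by rewrite invfM mulrACA divff ?mul1r // pnatr_eq0.
have jJ : (Num.truncn s < J)%N.
  rewrite truncn_lt_nat //; apply: le_lt_trans sJ2 _.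
  by rewrite ltr_pdivrMr // ltr_pMr ?ltr1n ?ltr0n.
pose j1 := Ordinal jJ.
pose phi x := `|sin (ang s - ang x)| / `|sin (ang x)|.
have phi0 x : 0 <= phi x by rewrite divr_ge0.
apply: (@le_trans _ _ (\prod_(i < n) ((if i == Num.truncn s :> nat then 6 else 1) *
    phi ((lift j1 i)%:R + 2^-1)))).
  apply: ler_prod => i _; rewrite phiE phi0 /=.
  exact: block_ratio_le (lamP _ (ltn_ord i)).
rewrite big_split /=.
have P6 : \prod_(i < n) (if i == Num.truncn s :> nat then 6 else 1) <= 6 :> R.
  have [jn|jn] := ltnP (Num.truncn s) n.
    rewrite (bigD1 (Ordinal jn)) //= eqxx big1 ?mulr1 // => i.
    by rewrite -val_eqE /= => /negbTE ->.
  rewrite big1 ?ler1n // => i _; case: eqP => // iE.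
  by have := ltn_ord i; rewrite iE ltnNge jn.
have PL : \prod_(i < n) phi ((lift j1 i)%:R + 2^-1) <= pi * (1 + s).
  have hr0 j : 0 < rnorm (1 - half_root R J j).
    rewrite lt_neqAle rnorm_ge0 andbT eq_sym rnorm_eq0 subr_eq0 eq_sym.
    apply/eqP => h; have := half_rootX R j (ltn0Sn n); rewrite h expr1n => /eqP.
    by rewrite -subr_eq0 opprK -(natrD _ 1 1) pnatr_eq0.
  have := @prod_dist_half_root1 R J isT; rewrite (bigD1_ord j1) //= => E.
  have G := prod_dist_half_root_le j1 (rnorm_expi (2 * pi / J%:R * s)).
  under eq_bigr do rewrite /phi -phiE.
  have P0 : 0 < \prod_(i < n) rnorm (1 - half_root R J (lift j1 i)).
    by apply: prodr_gt0.
  rewrite prodf_div ler_pdivrMr //; apply: le_trans G _.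
  have Fle : rnorm (1 - half_root R J j1) <= 2 * (pi * (1 + s)) / J%:R.
    rewrite rnormB_sym; apply: le_trans (rnorm_expiB1_le _) _.
    rewrite ger0_norm; last first.
      by rewrite mulr_ge0 ?divr_ge0 ?mulr_ge0 ?pi_ge0 ?addr_ge0 ?invr_ge0.
    have -> : 2 * (pi * (1 + s)) / J%:R = 2 * pi / J%:R * (1 + s) by ring.
    rewrite ler_wpM2l ?divr_ge0 ?mulr_ge0 ?pi_ge0 //.
    by have /andP[+ _] := truncn_itv s0; rewrite /=; lra.
  have := ler_wpM2r (ltW P0) Fle; rewrite E.
  move: (\prod_(i < n) _) => P h.
  have J0 : 0 < J%:R :> R by rewrite ltr0n.
  rewrite -(ler_pM2r (_ : 0 < 2)) //.
  move: h; rewrite -(ler_pM2l J0) => h; apply: (@le_trans _ _ (J%:R * 2)) => //.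
  apply: le_trans h _; rewrite le_eqVlt; apply/orP; left; apply/eqP.
  by field; rewrite gt_eqF.
rewrite -mulrA; apply: ler_pM => //; rewrite prodr_ge0 // => i _.
by case: ifP.
Qed.

End BlockProduct.

Section Circle.
Variable R : realType.
Implicit Types (s x y : R).

(** The point at position x on a circle of circumference N; in these units the blocks have length 1
    and [circ_dist] is the shorter arc back to position 0. *)
Definition circ (N : nat) x : R[i] := expi (2 * pi / N%:R * x).

Definition circ_dist (N : nat) s : R := Num.min s (N%:R - s).

Lemma rnorm_circ N x : rnorm (circ N x) = 1.
Proof. exact: rnorm_expi. Qed.

Lemma circ0 N : circ N 0 = 1.
Proof. by rewrite /circ mulr0 expi0. Qed.

Lemma circB N x y : circ N (x - y) = circ N x * (circ N y)^*%C.
Proof. by rewrite /circ mulrBr expiD expiN. Qed.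

Lemma circ_refl N x : (0 < N)%N -> circ N (N%:R - x) = (circ N x)^*%C.
Proof.
move=> N0; rewrite circB /circ divfK ?pnatr_eq0 -?lt0n // expi2pi mul1r //.
Qed.

Lemma rnorm_circ_conj N x y :
  rnorm ((circ N x)^*%C - (circ N y)^*%C) = rnorm (circ N x - circ N y).
Proof. by rewrite -(rmorphB (@conjc R)) rnorm_conj. Qed.

Lemma rnorm_conjB1 (z : R[i]) : rnorm (z^*%C - 1) = rnorm (z - 1).
Proof.
have -> : z^*%C - 1 = (z - 1)^*%C by rewrite (rmorphB (@conjc R)) rmorph1.
exact: rnorm_conj.
Qed.

Lemma rnorm_circB1 N s : (0 < N)%N -> 0 <= s <= N%:R ->
  pi / N%:R * circ_dist N s <= rnorm (circ N s - 1) <= 2 * pi / N%:R * circ_dist N s.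
Proof.
move=> N0; have N0' : 0 < N%:R :> R by rewrite ltr0n.
have pi0 := pi_gt0 R.
suff H x : 0 <= x -> x <= N%:R / 2 ->
    pi / N%:R * x <= rnorm (circ N x - 1) <= 2 * pi / N%:R * x.
  move=> /andP[s0 sN]; have [h|h] := leP s (N%:R / 2).
    by rewrite /circ_dist min_l; [apply: H | lra].
  rewrite /circ_dist min_r; last lra.
  by have := H (N%:R - s); rewrite circ_refl // rnorm_conjB1; apply; lra.
move=> x0 xN; have c0 : 0 <= 2 * pi / N%:R * x.
  by rewrite mulr_ge0 // divr_ge0 // ltW // mulr_gt0.
apply/andP; split; last by have := rnorm_expiB1_le (2 * pi / N%:R * x); rewrite (ger0_norm c0).
have := @rnorm_expiB1_ge _ (2 * pi / N%:R * x); rewrite (ger0_norm c0).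
have -> : 2 * pi / N%:R * x / 2 = pi / N%:R * x.
  by move: (N%:R^-1) => c; field.
apply; have -> : 2 * pi / N%:R * x = pi * (2 * x / N%:R).
  by move: (N%:R^-1) => c; ring.
by rewrite ler_piMr ?ler_pdivrMr ?(ltW pi0) //; lra.
Qed.

(** Conjugation sends position x to n + 1 - x and block i to block n - 1 - i, which reduces the far
    half of the circle to the near one. *)
Lemma block_product_le (n : nat) s (lam : nat -> R) : (1 < n)%N ->
    0 <= s <= n.+1%:R ->
    (forall i, (i < n)%N -> i%:R + 2^-1 <= lam i <= i%:R + 3 / 2) ->
  \prod_(i < n) (rnorm (circ n.+1 s - circ n.+1 (lam i)) /
                 rnorm (1 - circ n.+1 (lam i))) <= 6 * pi * (1 + circ_dist n.+1 s).
Proof.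
move=> n1 /andP[s0 sJ] lamP; have [h|h] := leP s (n.+1%:R / 2).
  rewrite /circ_dist min_l; last by lra.
  by apply: block_product_le_half => //; rewrite s0.
rewrite /circ_dist min_r; last by lra.
have := @block_product_le_half R n n1 (n.+1%:R - s)
   (fun i => n.+1%:R - lam (n.-1 - i)%N).
rewrite (reindex_inj rev_ord_inj) /= => H.
apply: le_trans (H _ _).
- rewrite le_eqVlt; apply/orP; left; apply/eqP; apply: eq_bigr => i _.
  have -> : (n.-1 - (n - i.+1))%N = i by have := ltn_ord i; lia.
  rewrite -!/(circ _ _) !circ_refl // rnorm_circ_conj; congr (_ / _).
  by rewrite rnormB_sym -rnorm_conjB1 rnormB_sym.
- by apply/andP; split; lra.
- move=> i ni; have /lamP : (n.-1 - i < n)%N by lia.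
  have -> : (n.-1 - i)%:R = n%:R - 1 - i%:R :> R.
    by rewrite natrB; [rewrite -subn1 natrB //; lia | lia].
  by rewrite -(natr1 n); lra.
Qed.

(** Meant for nodes close to position 0, which lie in no block: passing through 1 on the way to the
    node gives linear growth in the distance, at the price of 1 / g. *)
Lemma near_factor_le N s x g : (0 < N)%N -> 0 < g ->
    0 <= s <= N%:R -> g <= x <= N%:R - g ->
  rnorm (circ N s - circ N x) / rnorm (1 - circ N x) <= 1 + 2 * circ_dist N s / g.
Proof.
move=> N0 g0 sN /andP[gx xg]; have pi0 := pi_gt0 R.
have N0' : 0 < N%:R :> R by rewrite ltr0n.
have xN : 0 <= x <= N%:R by apply/andP; split; lra.
have /andP[_ S2] := rnorm_circB1 N0 sN; have /andP[X1 _] := rnorm_circB1 N0 xN.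
have pN : 0 < pi / N%:R :> R by rewrite divr_gt0.
have gd : g <= circ_dist N x by rewrite /circ_dist le_min; apply/andP; split; lra.
have X2 : pi / N%:R * g <= rnorm (circ N x - 1) by apply: le_trans X1; rewrite ler_pM2l.
have c0 : 0 < rnorm (circ N x - 1) by apply: lt_le_trans X2; rewrite mulr_gt0.
have s0 : 0 <= circ_dist N s by rewrite /circ_dist le_min; apply/andP; split; lra.
rewrite [rnorm (1 - _)]rnormB_sym ler_pdivrMr // mulrDl mul1r.
have -> : circ N s - circ N x = (1 - circ N x) + (circ N s - 1) by ring.
apply: le_trans (rnormD _ _) _; rewrite rnormB_sym lerD2l.
apply: le_trans S2 _; apply: (@le_trans _ _ (2 * circ_dist N s / g * (pi / N%:R * g))).
  by rewrite le_eqVlt; apply/orP; left; apply/eqP; field; rewrite !gt_eqF.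
by rewrite ler_wpM2l ?divr_ge0 ?mulr_ge0 ?(ltW g0) // rnormB_sym.
Qed.

(** The mean of K powers is concentrated on an arc of length about E K / K = E, and beyond it decays
    like E over the distance. *)
Lemma circ_geom_le (E K : nat) s : (0 < E)%N -> (0 < K)%N -> 0 <= s <= (E * K)%:R ->
  rnorm (K%:R^-1 * \sum_(m < K) circ (E * K) s ^+ m) <=
    2 * E%:R / (1 + circ_dist (E * K) s).
Proof.
move=> E0 K0 sN; have N0 : (0 < E * K)%N by rewrite muln_gt0 E0.
have N0' : 0 < (E * K)%:R :> R by rewrite ltr0n.
have K0' : 0 < K%:R :> R by rewrite ltr0n.
have E1 : 1 <= E%:R :> R by rewrite ler1n.
have pi2 := pi_ge2 R.
have /andP[S1 _] := rnorm_circB1 N0 sN.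
have s0 : 0 <= circ_dist (E * K) s by case/andP: sN => *; rewrite /circ_dist le_min; apply/andP; split; lra.
have := rnorm_geom_le K (rnorm_circ (E * K) s).
have := rnorm_geom_mul_le K (rnorm_circ (E * K) s).
rewrite rnormM rnormV rnorm_nat.
have D0 := rnorm_ge0 (\sum_(i < K) circ (E * K) s ^+ i).
move: S1 s0; move: (circ_dist _ _) (rnorm (_ - 1)) (rnorm _) D0.
move=> d c D D0 S1 d0 cD DK; rewrite ler_pdivlMr ?ltr_wpDr // -mulrA.
rewrite ler_pdivrMl //.
have [d1|/ltW d1] := leP d 1.
  apply: (@le_trans _ _ (K%:R * 2)).
    by apply: ler_pM => //; lra.
  by rewrite ler_pM2l //; lra.
apply: (@le_trans _ _ (D * (2 * d))); first by rewrite ler_wpM2l //; lra.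
have h : d * D <= (E * K)%:R.
  have : pi / (E * K)%:R * d * D <= 2 by apply: le_trans cD; rewrite ler_wpM2r.
  have -> : pi / (E * K)%:R * d * D = pi * (d * D) / (E * K)%:R by ring.
  rewrite ler_pdivrMr // => h.
  have : 2 * (d * D) <= pi * (d * D) by rewrite ler_wpM2r // mulr_ge0.
  by lra.
by rewrite natrM in h; lra.
Qed.

End Circle.

Section SizeBounds.
Variable K : idomainType.
Implicit Types p q : {poly K}.

Lemma size_mul_leS p q a b :
  (size p <= a.+1)%N -> (size q <= b.+1)%N -> (size (p * q)%R <= (a + b).+1)%N.
Proof. by move=> ha hb; have := size_polyMleq p q; lia. Qed.

Lemma size_prod_leS (n d : nat) (F : nat -> {poly K}) :
  (forall i, (size (F i) <= d.+1)%N) -> (size (\prod_(i < n) F i)%R <= (n * d).+1)%N.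
Proof.
move=> hF; elim: n => [|n IH]; first by rewrite big_ord0 size_poly1.
by rewrite big_ord_recr /= mulSn addnC size_mul_leS.
Qed.

Lemma size_exp_leS p n d :
  (size p <= d.+1)%N -> (size (p ^+ n)%R <= (n * d).+1)%N.
Proof.
move=> hp; elim: n => [|n IH]; first by rewrite expr0 size_poly1.
by rewrite exprS mulSn size_mul_leS.
Qed.

End SizeBounds.

Lemma map_enum_filterP (I : finType) (T : eqType) (f : I -> T) (P : pred I) x :
  reflect (exists2 i, P i & x = f i) (x \in [seq f i | i <- enum I & P i]).
Proof.
apply: (iffP mapP) => [[k]|[k]]; rewrite ?mem_filter.
  by move=> /andP[Pk _] ->; exists k.
by move=> Pk ->; exists k; rewrite // mem_filter Pk mem_enum.
Qed.

Section Interpolation.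
Variable R : realType.

Definition node_factor (N : nat) (x : R) : {poly R[i]} :=
  (1 - circ N x)^-1 *: ('X - (circ N x)%:P).

Lemma size_node_factor N x : (size (node_factor N x) <= 2)%N.
Proof. by rewrite (leq_trans (size_scale_leq _ _)) // size_XsubC. Qed.

Lemma rnorm_node_factor N x z :
  rnorm (node_factor N x).[z] = rnorm (z - circ N x) / rnorm (1 - circ N x).
Proof. by rewrite !hornerE rnormM rnormV mulrC. Qed.

Lemma node_factor_root N x : (node_factor N x).[circ N x] = 0.
Proof. by rewrite !hornerE subrr mulr0. Qed.

Lemma circ_neq1 (N : nat) (x g : R) : (0 < N)%N -> 0 < g -> g <= x <= N%:R - g -> circ N x != 1.
Proof.
move=> N0 g0 /andP[gx xg]; have N0' : 0 < N%:R :> R by rewrite ltr0n.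
rewrite -subr_eq0 -rnorm_eq0 gt_eqF //.
have xN : 0 <= x <= N%:R by apply/andP; split; lra.
have /andP[X1 _] := rnorm_circB1 N0 xN; apply: lt_le_trans X1.
have pN : 0 < pi / N%:R :> R by rewrite divr_gt0 // pi_gt0.
by rewrite mulr_gt0 // /circ_dist lt_min; apply/andP; split; lra.
Qed.

Lemma node_factor1 (N : nat) (x g : R) : (0 < N)%N -> 0 < g -> g <= x <= N%:R - g ->
  (node_factor N x).[1] = 1.
Proof.
move=> N0 g0 hx; rewrite !hornerE mulVf // subr_eq0 eq_sym.
exact: circ_neq1 hx.
Qed.

(* The nodes are spread over M families, each with at most one node per unit
   block; missing nodes are replaced by block centres. Each family contributes
   a factor growing like the square of the distance to 1, and the geometric
   mean of order 2M + 2 compensates all of them with two powers to spare. *)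
Lemma interpolation_poly (M E : nat) (g : R) : (0 < E)%N -> 0 < g <= 2^-1 ->
  exists2 C : R, 0 <= C & forall (K n : nat) (I : finType) (lam : I -> R),
    (1 < n)%N -> n.+1 = (E * K)%N ->
    (forall i, g <= lam i <= n.+1%:R - g) ->
    (#|[pred i | ~~ (2^-1 <= lam i < n%:R + 2^-1)%R]| <= M)%N ->
    (forall b : nat, (#|[pred i | (b%:R + 2^-1 <= lam i < b%:R + 3 / 2)%R]| <= M)%N) ->
  exists Q : {poly R[i]}, [/\ (size Q <= (M * n.+1 + (2 * M + 2) * K).+1)%N, Q.[1] = 1,
    forall i, Q.[circ n.+1 (lam i)] = 0 &
    forall s, 0 <= s <= n.+1%:R -> rnorm Q.[circ n.+1 s] <= C / (1 + circ_dist n.+1 s) ^+ 2].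
Proof.
move=> E0 /andP[g0 g2]; have pi0 := pi_gt0 R.
pose C1 : R := 6 * pi * (1 + 2 / g); pose C2 : R := 2 * E%:R.
have g20 : 0 <= 2 / g by rewrite divr_ge0 // ltW.
have C10 : 0 <= C1 by apply: mulr_ge0; lra.
exists (C1 ^+ M * C2 ^+ (2 * M + 2)).
  by rewrite mulr_ge0 ?exprn_ge0 // mulr_ge0.
move=> K n I lam n1 nE lamP near far; pose J := n.+1.
have K0 : (0 < K)%N by case: (K) nE => //; rewrite muln0.
have J3 : 3 <= J%:R :> R by rewrite ler_nat.
have nJ : n%:R = J%:R - 1 :> R by rewrite /J -(natr1 n) addrK.
pose sel (P : pred I) := [seq lam i | i <- enum I & P i].
have selP P x : x \in sel P -> exists2 i, P i & x = lam i.
  exact: (elimT (@map_enum_filterP I R lam P x)).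
have sel_size P : size (sel P) = #|P|.
  by rewrite /sel size_map cardE [enum P]/enum_mem enumT.
pose P0 i := ~~ (2^-1 <= lam i < n%:R + 2^-1).
pose P b i := b%:R + 2^-1 <= lam i < b%:R + 3 / 2.
(* [P0] collects the nodes within 1/2 of position 0, [P b] those of block b. The fillers 1/2 and b +
   1 obey the same constraints as true nodes, since g <= 1/2. Each family thus has 1 + n = J
   factors. *)
pose pt0 i := nth 2^-1 (sel P0) i.
pose pt b i := nth (b%:R + 1) (sel (P b)) i.
have pt0P i : g <= pt0 i <= J%:R - g.
  rewrite /pt0; have [h|h] := ltnP i (size (sel P0)); last first.
    by rewrite nth_default //; apply/andP; split; lra.
  by have /selP[k _ ->] := mem_nth 2^-1 h.
have ptP i b : b%:R + 2^-1 <= pt b i <= b%:R + 3 / 2.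
  rewrite /pt; have [h|h] := ltnP i (size (sel (P b))); last first.
    by rewrite nth_default //; apply/andP; split; lra.
  by have /selP[k /andP[h1 /ltW h2] ->] := mem_nth (b%:R + 1) h; rewrite h1.
have ptg i b : (b < n)%N -> g <= pt b i <= J%:R - g.
  move=> bn; case/andP: (ptP i b) => h1 h2.
  have : b.+1%:R <= n%:R :> R by rewrite ler_nat.
  have b0 : 0 <= b%:R :> R by [].
  by rewrite -(natr1 b) nJ => h3; apply/andP; split; lra.
pose blocks i := \prod_(b < n) node_factor J (pt b i).
pose geo : {poly R[i]} := K%:R^-1 *: \sum_(m < K) 'X^m.
pose Q := (\prod_(i < M) (node_factor J (pt0 i) * blocks i)) * geo ^+ (2 * M + 2).
have QE z : Q.[z] = (\prod_(i < M) ((node_factor J (pt0 i)).[z] *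
    \prod_(b < n) (node_factor J (pt b i)).[z])) *
    (K%:R^-1 * \sum_(m < K) z ^+ m) ^+ (2 * M + 2).
  rewrite /Q hornerM horner_prod horner_exp /geo hornerZ horner_sum.
  congr (_ * (_ * _) ^+ _); last by apply: eq_bigr => m _; rewrite hornerXn.
  by apply: eq_bigr => i _; rewrite hornerM horner_prod.
exists Q; split.
- apply: size_mul_leS.
    apply: (@size_prod_leS _ M J (fun i => node_factor J (pt0 i) * blocks i)) => i.
    rewrite /J -[n.+1]add1n; apply: size_mul_leS; first exact: size_node_factor.
    have := @size_prod_leS _ n 1 (fun b => node_factor J (pt b i)).
    by rewrite muln1; apply => b; exact: size_node_factor.
  apply: size_exp_leS; rewrite (leq_trans (size_scale_leq _ _)) //.
  apply: (leq_trans (size_sum _ _ _)); apply/bigmax_leqP => m _.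
  by rewrite size_polyXn ltnS ltnW.
- rewrite QE.
  have -> : \sum_(m < K) 1 ^+ m = K%:R :> R[i].
    by under eq_bigr do rewrite expr1n; rewrite sumr_const card_ord.
  rewrite mulVf ?pnatr_eq0 -?lt0n // expr1n mulr1 big1 // => i _.
  rewrite (node_factor1 _ g0) // mul1r big1 // => b _.
  by rewrite (node_factor1 _ g0) // ptg.
- move=> i; rewrite QE.
  have mem (P' : pred I) : P' i -> (#|P'| <= M)%N ->
      exists2 k : 'I_M, (k < size (sel P'))%N & forall d, nth d (sel P') k = lam i.
    move=> Pi cM; have iS : lam i \in sel P'.
      by apply: (introT (@map_enum_filterP I R lam P' _)); exists i.
    have kS : (index (lam i) (sel P') < size (sel P'))%N by rewrite index_mem.
    have kM : (index (lam i) (sel P') < M)%N by apply: leq_trans kS _; rewrite sel_size.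
    by exists (Ordinal kM) => //= d; rewrite nth_index.
  have [Pi|/negPn Pi] := boolP (P0 i).
    have [k _ kE] := mem P0 Pi near.
    by rewrite (bigD1 k) //= /pt0 kE node_factor_root !mul0r.
  case/andP: Pi => Pi1 Pi2.
  have i0 : 0 <= lam i - 2^-1 by lra.
  have /andP[b1 b2] := truncn_itv i0; set b := Num.truncn _ in b1 b2.
  rewrite -(natr1 b) in b2.
  have bn : (b < n)%N by rewrite -(ltr_nat R); lra.
  have Pb : P b i by rewrite /P; apply/andP; split; lra.
  have [k _ kE] := mem (P b) Pb (far b).
  rewrite (bigD1 k) //= (bigD1 (Ordinal bn)) //= /pt kE node_factor_root.
  by rewrite mul0r mulr0 !mul0r.
move=> s sJ; have s0 : 0 <= circ_dist J s.
  by case/andP: sJ => *; rewrite /circ_dist le_min; apply/andP; split; rewrite /J; lra.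
rewrite -/J QE rnormM rnormX rnorm_prod.
have d0 : 0 < 1 + circ_dist J s by rewrite ltr_wpDr.
have B1 : \prod_(i < M) rnorm ((node_factor J (pt0 i)).[circ J s] *
     \prod_(b < n) (node_factor J (pt b i)).[circ J s]) <=
     (C1 * (1 + circ_dist J s) ^+ 2) ^+ M.
  rewrite -[X in _ ^+ X]card_ord -prodr_const; apply: ler_prod => i _.
  rewrite rnorm_ge0 /= rnormM rnorm_prod rnorm_node_factor.
  under eq_bigr do rewrite rnorm_node_factor.
  have n1' := near_factor_le (ltn0Sn n) g0 sJ (pt0P i).
  have b1 := block_product_le n1 sJ (fun b _ => ptP i b).
  have -> : C1 * (1 + circ_dist J s) ^+ 2 =
    ((1 + 2 / g) * (1 + circ_dist J s)) * (6 * pi * (1 + circ_dist J s)).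
    by rewrite /C1; ring.
  apply: ler_pM => //; first by rewrite divr_ge0 ?rnorm_ge0.
    by rewrite prodr_ge0 // => b _; rewrite divr_ge0 ?rnorm_ge0.
  apply: le_trans n1' _; rewrite mulrAC.
  have : 0 <= 2 / g by rewrite divr_ge0 // ltW.
  by move: (2 / g) s0 => y; rewrite /J; nra.
have B2 : rnorm (K%:R^-1 * \sum_(m < K) circ J s ^+ m) ^+ (2 * M + 2) <=
    (C2 / (1 + circ_dist J s)) ^+ (2 * M + 2).
  rewrite lerXn2r ?nnegrE ?rnorm_ge0 ?divr_ge0 ?mulr_ge0 ?(ltW d0) //.
  by rewrite /J nE; apply: circ_geom_le => //; rewrite -nE.
apply: le_trans (ler_pM _ _ B1 B2) _.
- by rewrite prodr_ge0 // => i _; rewrite rnorm_ge0.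
- by rewrite exprn_ge0 // rnorm_ge0.
rewrite le_eqVlt; apply/orP; left; apply/eqP.
move: (1 + circ_dist J s) d0 => e e0.
have ee : e ^+ (2 * M + 2) = (e ^+ 2) ^+ M * e ^+ 2 by rewrite exprD exprM.
rewrite expr_div_n exprMn ee; have : (e ^+ 2) ^+ M != 0 by rewrite !expf_neq0 ?gt_eqF.
move: ((e ^+ 2) ^+ M) (C2 ^+ _) (C1 ^+ _) => x y z x0; field.
by rewrite gt_eqF.
Qed.

End Interpolation.

(** * Size of the coefficients of a polynomial that is small away from 1 *)

Section Fourier.
Variable R : realType.

Lemma circM N (x : R) n : circ N x ^+ n = circ N (x * n%:R).
Proof. by rewrite /circ expiX mulrA. Qed.

Lemma dft_orth N (j m : nat) : (j < N)%N -> (m < N)%N ->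
  \sum_(n < N) circ N n%:R ^+ j * (circ N n%:R ^+ m)^*%C = (N *+ (j == m))%:R :> R[i].
Proof.
move=> jN mN; have N0 : (0 < N)%N by apply: leq_ltn_trans mN.
pose x := circ N (j%:R - m%:R : R).
have xE (n : nat) : circ N n%:R ^+ j * (circ N n%:R ^+ m)^*%C = x ^+ n.
  rewrite /x !circM -circB; congr circ; ring.
under eq_bigr do rewrite xE.
have [jm|jm] := eqVneq j m.
  under eq_bigr do rewrite /x jm subrr circ0 expr1n.
  by rewrite sumr_const card_ord.
have N0' : N%:R != 0 :> R by rewrite pnatr_eq0 -lt0n.
have xN : x ^+ N = 1.
  rewrite /x circM mulrBl /circ mulrBr expiB.
  have E (k : nat) : expi (2 * pi / N%:R * (k%:R * N%:R)) = 1 :> R[i].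
    have -> : 2 * pi / N%:R * (k%:R * N%:R) = 2 * pi * k%:R :> R by field.
    by rewrite -expiX expi2pi expr1n.
  by rewrite !E divr1.
have x1 : x != 1.
  apply: expi_neq1; have N1 : 0 < N%:R :> R by rewrite ltr0n.
  have pi2 : 0 < 2 * pi :> R by rewrite mulr_gt0 ?pi_gt0.
  have -> : 2 * pi / N%:R * (j%:R - m%:R) = 2 * pi * ((j%:R - m%:R) / N%:R) :> R.
    by move: (N%:R^-1) => c; ring.
  rewrite normrM (gtr0_norm pi2) normf_div (gtr0_norm N1) -{1}(mulr0 (2 * pi)) -[X in _ && (_ < X)]mulr1.
  rewrite !ltr_pM2l // divr_gt0 ?normr_gt0 ?subr_eq0 ?eqr_nat //=.
  rewrite ltr_pdivrMr // mul1r ltr_norml.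
  have : j%:R < N%:R :> R by rewrite ltr_nat.
  have : m%:R < N%:R :> R by rewrite ltr_nat.
  have : 0 <= j%:R :> R by []. have : 0 <= m%:R :> R by [].
  by move=> *; apply/andP; split; lra.
have := subrX1 x N; rewrite xN subrr => /esym/eqP.
by rewrite mulf_eq0 subr_eq0 (negbTE x1) /= => /eqP ->.
Qed.

Lemma coef_dft (Q : {poly R[i]}) N m : (size Q <= N)%N -> (m < N)%N ->
  \sum_(n < N) Q.[circ N n%:R] * (circ N n%:R ^+ m)^*%C = N%:R * Q`_m.
Proof.
move=> QN mN.
under eq_bigr do rewrite (horner_coef_wide _ QN) mulr_suml.
rewrite exchange_big /=.
under eq_bigr => j _.
  under eq_bigr do rewrite -mulrA.
  rewrite -mulr_sumr dft_orth //.
  over.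
rewrite (bigD1 (Ordinal mN)) //= eqxx mulr1n mulrC big1 ?addr0 // => j.
by rewrite -val_eqE /= => /negbTE ->; rewrite mulr0n mulr0.
Qed.

(** Fourier inversion on the T J-th roots of unity. By the quadratic decay the moduli of the values
    add up to at most 2 C (1 + T), and division by T J leaves 4 C / J because T >= 1. *)
Lemma coef_le (Q : {poly R[i]}) (T J m : nat) (C : R) : 0 <= C ->
    (0 < T)%N -> (0 < J)%N -> (size Q <= T * J)%N ->
    (forall s, 0 <= s <= J%:R -> rnorm Q.[circ J s] <= C / (1 + circ_dist J s) ^+ 2) ->
  rnorm Q`_m <= 4 * C / J%:R.
Proof.
move=> C0 T0 J0 QN QC; have J0' : 0 < J%:R :> R by rewrite ltr0n.
have T0' : 0 < T%:R :> R by rewrite ltr0n.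
have T1 : 1 <= T%:R :> R by rewrite ler1n.
have [mN|mN] := ltnP m (T * J); last first.
  by rewrite nth_default ?(leq_trans QN) // rnorm0 divr_ge0 ?mulr_ge0.
have N0 : 0 < (T * J)%:R :> R by rewrite ltr0n muln_gt0 T0.
have : rnorm ((T * J)%:R * Q`_m) <= 4 * C * T%:R.
  rewrite -coef_dft //; apply: le_trans (rnorm_sum _ _ _) _.
  under eq_bigr do rewrite rnormM rnorm_conj rnormX rnorm_circ expr1n mulr1.
  pose b (n : nat) := (1 + T%:R^-1 * n%:R) ^- 2 : R.
  have b0 n : 0 <= b n by rewrite invr_ge0 exprn_ge0 // addr_ge0 // mulr_ge0 // invr_ge0.
  apply: (@le_trans _ _ (\sum_(n < T * J) C * (b n + b (T * J - n.+1)%N))).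
    apply: ler_sum => n _.
    have -> : circ (T * J) n%:R = circ J (T%:R^-1 * n%:R) :> R[i].
      by rewrite /circ natrM; congr expi; field; rewrite !gt_eqF.
    have nJ : T%:R^-1 * n%:R <= J%:R :> R.
      by rewrite ler_pdivrMl // -natrM ler_nat ltnW.
    have n0 : 0 <= T%:R^-1 * n%:R :> R by rewrite mulr_ge0 // invr_ge0.
    apply: le_trans (QC _ _) _; first by rewrite n0.
    rewrite ler_wpM2l // /circ_dist.
    have [h|h] := leP (T%:R^-1 * n%:R) (J%:R - T%:R^-1 * n%:R : R).
      by rewrite lerDl.
    (* The index T J - n - 1 instead of T J - n makes the reversal a permutation of the range; [b]
       being decreasing, this only enlarges the bound. *)
    apply: (@le_trans _ _ (b (T * J - n.+1)%N)); last by rewrite lerDr.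
    have d0 : 0 <= T%:R^-1 * (T * J - n.+1)%:R :> R by rewrite mulr_ge0 // invr_ge0.
    have le1 : 1 + T%:R^-1 * (T * J - n.+1)%:R <= 1 + (J%:R - T%:R^-1 * n%:R) :> R.
      rewrite natrB // natrM -(natr1 n).
      have -> : T%:R^-1 * (T%:R * J%:R - (n%:R + 1)) =
          J%:R - T%:R^-1 * n%:R - T%:R^-1 :> R by field; rewrite gt_eqF.
      by rewrite lerD2l gerBl invr_ge0.
    have lt1 : 0 < 1 + T%:R^-1 * (T * J - n.+1)%:R :> R by rewrite ltr_wpDr.
    have lt2 := lt_le_trans lt1 le1.
    by rewrite /b lef_pV2 ?posrE ?exprn_gt0 // lerXn2r // nnegrE ltW.
  rewrite -mulr_sumr big_split /=.
  have S1 : \sum_(n < T * J) b n <= 1 + T%:R.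
    have := @arith_sum_le R 1 T%:R^-1 (T * J) ltr01.
    by rewrite expr1n invr1 mulr1 invrK; apply; rewrite invr_gt0.
  have -> : \sum_(n < T * J) b (T * J - n.+1)%N = \sum_(n < T * J) b n.
    by rewrite [RHS](reindex_inj rev_ord_inj).
  by move: S1; move: (\sum_(n < _) _) => S S1; rewrite mulrAC mulrC ler_wpM2r //; lra.
rewrite rnormM rnorm_nat -ler_pdivlMl // => h; apply: le_trans h _.
rewrite natrM le_eqVlt; apply/orP; left; apply/eqP.
by field; rewrite !gt_eqF.
Qed.

End Fourier.

(** * Lower bound for samples on a grid *)

Section DiscreteLower.
Variables (R : realType) (H : normedModType R[i]) (dot : {dot H for Num.conj}).
Hypothesis hdot : forall v : H, dot v v = `|v| ^+ 2.

Lemma sum_shift_le (F : nat -> R) (q K N : nat) : (forall n, 0 <= F n) ->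
  (q <= K)%N -> \sum_(m < N) F (m + q)%N <= \sum_(m < N + K) F m.
Proof.
move=> F0 qK; rewrite -(big_mkord xpredT (fun m => F (m + q)%N)).
rewrite -(big_mkord xpredT F) [leRHS](@big_cat_nat _ _ _ q) //=; last by lia.
rewrite [X in _ + X](@big_cat_nat _ _ _ (N + q) q) /=; [|lia|lia].
rewrite -{3}[q]add0n big_addn addnK addrCA -[leLHS]addr0 lerD2l.
by rewrite addr_ge0 // sumr_ge0.
Qed.

(** Lagrange's identity: twice the difference of the two sides is the sum of g i g j (y i - y
    j)^2. *)
Lemma weighted_sqr_le (I : finType) (g y : I -> R) : (forall k, 0 <= g k) ->
  (\sum_k g k * y k) ^+ 2 <= (\sum_k g k) * \sum_k g k * y k ^+ 2.
Proof.
move=> g0; have : 0 <= \sum_i \sum_j g i * g j * (y i - y j) ^+ 2.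
  by apply: sumr_ge0 => i _; apply: sumr_ge0 => j _; rewrite mulr_ge0 ?sqr_ge0 // mulr_ge0.
have -> : \sum_i \sum_j g i * g j * (y i - y j) ^+ 2 =
    2 * ((\sum_k g k) * \sum_k g k * y k ^+ 2) - 2 * (\sum_k g k * y k) ^+ 2.
  have E i : \sum_j g i * g j * (y i - y j) ^+ 2 =
      g i * y i ^+ 2 * (\sum_j g j) - 2 * (g i * y i * \sum_j g j * y j) +
      g i * \sum_j g j * y j ^+ 2.
    by rewrite !mulr_sumr -sumrB -big_split /=; apply: eq_bigr => j _; ring.
  under eq_bigr do rewrite E.
  rewrite big_split /= sumrB -mulr_sumr -!mulr_suml; ring.
lra.
Qed.

Lemma sqr_sum_le (n : nat) (x : nat -> R) :
  (\sum_(m < n) x m) ^+ 2 <= n%:R * \sum_(m < n) x m ^+ 2.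
Proof.
have := weighted_sqr_le (fun m : 'I_n => x m) (fun=> ler01).
by rewrite sumr_const card_ord; under eq_bigr do rewrite mul1r; under [X in _ * X]eq_bigr do rewrite mul1r.
Qed.

(** Coefficient extraction by an interpolating polynomial: at most (3 M + 3) J samples enter, each
    with weight at most 4 C / J, and the Cauchy-Schwarz inequality gives the constant. *)
Lemma coefficient_bound (M E : nat) (gam r : R) : (0 < E)%N -> 0 < gam -> 0 < r ->
  exists2 C : R, 0 <= C & forall (K J : nat) (I : finType) (u : I -> R) (V : I -> H),
    J = (E * K)%N -> (2 < J)%N ->
    (forall k l, k != l -> gam <= `|u k - u l|) ->
    (forall x, (#|[pred l | (x <= u l < x + r)%R]| <= M)%N) ->
    (forall k l, `|u k - u l| <= r * (J%:R / 2 - 2)) ->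
  forall k, rnorm (V k) ^+ 2 <= C / J%:R * \sum_(m < (M * J + (2 * M + 2) * K).+1)
     rnorm (\sum_l expi (2 * pi / (J%:R * r) * u l) ^+ m *: V l) ^+ 2.
Proof.
move=> E0 g0 r0; pose g : R := Num.min 2^-1 (gam / r).
have gg : 0 < g <= 2^-1 by rewrite lt_min ge_min lexx /= divr_gt0 // invr_gt0 ltr0n.
have [C C0 HC] := @interpolation_poly R M E g E0 gg.
exists ((3 * M + 3)%:R * (4 * C) ^+ 2); first by rewrite mulr_ge0 ?sqr_ge0.
move=> K J I u V JE J2 sep dens spread k.
case: J JE J2 spread => // n JE J2 spread; pose J := n.+1.
have J3 : 3 <= J%:R :> R by rewrite ler_nat.
have J0 : 0 < J%:R :> R by rewrite ltr0n.
have K0 : (0 < K)%N by case: (K) JE => //; rewrite muln0.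
have KJ : (K <= J)%N by rewrite /J JE leq_pmull.
have nJ : n%:R = J%:R - 1 :> R by rewrite /J -(natr1 n) addrK.
(* Frequencies are measured from u k in units of r. Negative values are wrapped by J, and as |v| <=
   J/2 - 2 the wrapped positions stay at distance at least 2 from the antipode J/2. *)
pose v l := (u l - u k) / r.
have uv l : u l = u k + r * v l by rewrite /v mulrC divfK ?gt_eqF // addrC subrK.
have vJ l : - (J%:R / 2 - 2) <= v l <= J%:R / 2 - 2.
  by rewrite -ler_norml /v normf_div (gtr0_norm r0) ler_pdivrMr // mulrC spread.
pose lam (l : {l | l != k}) : R := if 0 <= v (val l) then v (val l) else v (val l) + J%:R.
have lamP l : g <= lam l <= J%:R - g.
  have := vJ (val l); have /sep := valP l.
  rewrite uv addrAC subrr add0r normrM (gtr0_norm r0) -ler_pdivrMl // mulrC => h.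
  have {}h : g <= `|v (val l)| by rewrite /g ge_min h orbT.
  have g12 : g <= 2^-1 by rewrite /g ge_min lexx.
  by rewrite /lam; move: h; case: ger0P => ? ? /andP[? ?]; apply/andP; split; lra.
have cardle (P : pred {l | l != k}) x : (forall l, P l -> x <= u (val l) < x + r) ->
    (#|P| <= M)%N.
  move=> h; apply: leq_trans (dens x).
  rewrite -(fintype.card_image val_inj); apply: subset_leq_card; apply/fintype.subsetP => l.
  by move=> /fintype.imageP[l' Pl' ->]; rewrite inE; apply: h.
have near : (#|[pred l | ~~ (2^-1 <= lam l < n%:R + 2^-1)%R]| <= M)%N.
  apply: (cardle _ (u k - r / 2)) => l /=; rewrite negb_and -ltNge -leNgt nJ (uv (val l)).
  have := vJ (val l); rewrite /lam; case: ifPn; rewrite -?ltNge => v0 /andP[v1 v2] /orP[h|h].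
  - by apply/andP; split; nra.
  - by exfalso; lra.
  - by exfalso; lra.
  - by apply/andP; split; nra.
(* A block cannot contain nodes from both sides of the antipode, so it unwraps to one half-open
   frequency interval of length r. *)
have far (b : nat) : (#|[pred l | (b%:R + 2^-1 <= lam l < b%:R + 3 / 2)%R]| <= M)%N.
  have [bJ|bJ] := leP (b%:R + 2^-1) (J%:R / 2 : R).
    apply: (cardle _ (u k + (b%:R + 2^-1) * r)) => l /=; rewrite (uv (val l)).
    have := vJ (val l); rewrite /lam; case: ifPn; rewrite -?ltNge => v0 /andP[v1 v2] /andP[h1 h2].
      by apply/andP; split; nra.
    by exfalso; lra.
  apply: (cardle _ (u k + (b%:R + 2^-1 - J%:R) * r)) => l /=; rewrite (uv (val l)).
  have := vJ (val l); rewrite /lam; case: ifPn; rewrite -?ltNge => v0 /andP[v1 v2] /andP[h1 h2].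
    by exfalso; lra.
  by apply/andP; split; nra.
have [Q [Qsz Q1 Q0 QC]] := HC K n _ lam J2 JE lamP near far.
have zE l : l != k -> Q.[expi (2 * pi / (J%:R * r) * (u l - u k))] = 0.
  move=> lk; rewrite -[RHS](Q0 (Sub l lk)); congr (Q.[_]).
  have E1 : expi (2 * pi / (J%:R * r) * (u l - u k)) = circ J (v l).
    by rewrite /circ /v; congr expi; field; rewrite !gt_eqF.
  rewrite E1 /lam /=; case: ifP => // _; rewrite /circ.
  have -> : 2 * pi / n.+1%:R * (v l + J%:R) = 2 * pi / n.+1%:R * v l + 2 * pi.
    by rewrite /J; field; rewrite gt_eqF.
  by rewrite expiD expi2pi mulr1.
set N1 := (M * J + (2 * M + 2) * K).+1; set h := 2 * pi / (J%:R * r).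
pose X m := \sum_l expi (h * u l) ^+ m *: V l.
have N1le : (N1 <= (3 * M + 3) * J)%N.
  have -> : ((3 * M + 3) * J = M * J + ((2 * M + 2) * J + J))%N by ring.
  by rewrite /N1 -addnS leq_add2l -addn1 leq_add // leq_mul2l KJ orbT.
(* The right side is the sum over l of Q(z_l / z_k) V l, and Q(z_l / z_k) is 1 for l = k and 0
   otherwise. *)
have VE : V k = \sum_(m < N1) (Q`_m * expi (h * u k) ^- m) *: X m.
  under eq_bigr do rewrite /X scaler_sumr.
  rewrite exchange_big /= (bigD1 k) //= [X in _ + X]big1 ?addr0 => [|l lk].
    under eq_bigr => m _ do rewrite scalerA mulfVK ?expf_neq0 ?expi_neq0 //.
    rewrite -scaler_suml; have := horner_coef_wide 1 Qsz; rewrite Q1.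
    by under eq_bigr do rewrite expr1n mulr1; move=> <-; rewrite scale1r.
  under eq_bigr => m _.
    rewrite scalerA -mulrA -exprVn -exprMn -expiNV -expiD -mulrN -mulrDr addrC.
    over.
  by rewrite -scaler_suml -(horner_coef_wide _ Qsz) zE // scale0r.
have Qc m : rnorm Q`_m <= 4 * C / J%:R.
  apply: (@coef_le R Q (3 * M + 3) J m C) => //; first by lia.
  exact: leq_trans Qsz N1le.
apply: (@le_trans _ _ ((4 * C / J%:R * \sum_(m < N1) rnorm (X m)) ^+ 2)).
  rewrite lerXn2r ?nnegrE ?rnorm_ge0 ?mulr_ge0 ?invr_ge0 ?sumr_ge0 // => [m _|].
    exact: rnorm_ge0.
  rewrite VE mulr_sumr; apply: le_trans (rnorm_sum _ _ _) _.
  apply: ler_sum => m _; rewrite rnormZ rnormM rnormV rnormX rnorm_expi expr1n invr1 mulr1.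
  by rewrite ler_wpM2r ?rnorm_ge0.
rewrite exprMn; apply: (@le_trans _ _ ((4 * C / J%:R) ^+ 2 *
   (N1%:R * \sum_(m < N1) rnorm (X m) ^+ 2))).
  by rewrite ler_wpM2l ?sqr_ge0 // (sqr_sum_le N1 (fun m => rnorm (X m))).
rewrite mulrA ler_wpM2r ?sumr_ge0 // => [m _|]; first exact: sqr_ge0.
rewrite ler_pdivlMr //.
have : N1%:R <= (3 * M + 3)%:R * J%:R :> R by rewrite -natrM ler_nat.
have -> : (4 * C / J%:R) ^+ 2 * N1%:R * J%:R = (4 * C) ^+ 2 * (N1%:R / J%:R).
  by field; rewrite gt_eqF.
by rewrite -ler_pdivrMr // => h1; rewrite mulrC ler_wpM2r ?sqr_ge0.
Qed.

(* Replacing X m by the sum over q < K of conj(z_k)^q X(m + q) multiplies the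
   k-th coefficient by K; the dual large sieve then lets one sum over k. *)
Lemma discrete_lower_bound (M E : nat) (gam r : R) : (0 < E)%N -> 0 < gam -> 0 < r ->
  exists2 C : R, 0 <= C & forall (K J : nat) (I : finType) (u : I -> R) (V : I -> H),
    J = (E * K)%N -> (2 < J)%N ->
    (forall k l, k != l -> gam <= `|u k - u l|) ->
    (forall x, (#|[pred l | (x <= u l < x + r)%R]| <= M)%N) ->
    (forall k l, `|u k - u l| <= r * (J%:R / 2 - 2)) ->
  \sum_k rnorm (V k) ^+ 2 <= C / J%:R * \sum_(m < (M * J + (2 * M + 3) * K).+1)
     rnorm (\sum_l expi (2 * pi / (J%:R * r) * u l) ^+ m *: V l) ^+ 2.
Proof.
move=> E0 g0 r0; have [C C0 HC] := @coefficient_bound M E gam r E0 g0 r0.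
have pi0 := pi_gt0 R; have E0' : 0 < E%:R :> R by rewrite ltr0n.
(* K h = 2 pi / (E r) does not depend on K, so the large sieve over K samples has constant D K. *)
pose D := 128 * (1 + (2 * pi / (E%:R * r) * gam)^-1).
have D0 : 0 < D.
  by rewrite mulr_gt0 // ltr_wpDr // invr_ge0 ltW // mulr_gt0 // divr_gt0 // mulr_gt0.
exists (C * D); first by rewrite mulr_ge0 // ltW.
move=> K J I u V JE J2 sep dens spread.
have K0 : (0 < K)%N by case: (K) JE J2 => //; rewrite muln0 => ->.
have K0' : 0 < K%:R :> R by rewrite ltr0n.
have J0 : 0 < J%:R :> R by rewrite ltr0n; lia.
set h := 2 * pi / (J%:R * r); have h0 : 0 < h by rewrite divr_gt0 ?mulr_gt0.
have hpi k l : h * `|u k - u l| <= pi.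
  have hs : `|u k - u l| <= r * J%:R / 2 by have := spread k l; lra.
  apply: le_trans (ler_wpM2l (ltW h0) hs) _; rewrite /h le_eqVlt; apply/orP; left.
  by apply/eqP; field; rewrite !gt_eqF.
pose z k := expi (h * u k).
have z1 k : rnorm (z k) = 1 by rewrite rnorm_expi.
pose X m := \sum_l z l ^+ m *: V l.
pose B := D * K%:R; have B0 : 0 < B by rewrite mulr_gt0.
have LS (W : I -> H) :
    \sum_(m < K) rnorm (\sum_k z k ^+ m *: W k) ^+ 2 <= B * \sum_k rnorm (W k) ^+ 2.
  apply: le_trans (large_sieve hdot W g0 h0 K0 sep hpi) _.
  rewrite le_eqVlt; apply/orP; left; apply/eqP; congr (_ * _).
  rewrite /B /D -mulrA [K%:R * (1 + _)]mulrC mulrA; congr (_ * (1 + _^-1) * _).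
  by rewrite /h JE natrM; field; rewrite !gt_eqF.
have dual := large_sieve_dual hdot B0 LS.
set N1 := (M * J + (2 * M + 2) * K).+1.
have W k : K%:R ^+ 2 * rnorm (V k) ^+ 2 <= C / J%:R * \sum_(m < N1)
    rnorm (\sum_(q < K) (z k ^+ q)^*%C *: X (m + q)%N) ^+ 2.
  pose V' l := (\sum_(q < K) (z l * (z k)^*%C) ^+ q) *: V l.
  have := HC K J I u V' JE J2 sep dens spread k.
  have -> : rnorm (V' k) ^+ 2 = K%:R ^+ 2 * rnorm (V k) ^+ 2.
    rewrite /V' rnormZ; under eq_bigr do rewrite rnorm1_conj // expr1n.
    by rewrite sumr_const card_ord rnorm_nat exprMn.
  move=> h1; apply: le_trans h1 _; rewrite -/h -/N1 le_eqVlt; apply/orP; left; apply/eqP.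
  congr (_ * _); apply: eq_bigr => m _; congr (rnorm _ ^+ 2).
  under [RHS]eq_bigr do rewrite /X scaler_sumr.
  rewrite exchange_big /=; apply: eq_bigr => l _.
  rewrite /V' scalerA mulr_sumr scaler_suml; apply: eq_bigr => q _.
  rewrite scalerA; congr (_ *: _).
  by rewrite (rmorphXn (@conjc R)) -/(z l) exprMn exprD; ring.
rewrite -(ler_pM2l (_ : 0 < K%:R ^+ 2)) ?exprn_gt0 // mulr_sumr.
apply: le_trans (ler_sum _ (fun k _ => W k)) _.
rewrite -mulr_sumr exchange_big /=.
pose S := \sum_(m < (M * J + (2 * M + 3) * K).+1) rnorm (X m) ^+ 2.
have H1 : \sum_(m < N1) \sum_k rnorm (\sum_(q < K) (z k ^+ q)^*%C *: X (m + q)%N) ^+ 2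
    <= B * (K%:R * S).
  apply: (@le_trans _ _ (\sum_(m < N1) B * \sum_(q < K) rnorm (X (m + q)%N) ^+ 2)).
    by apply: ler_sum => m _; exact: (dual (fun q => X (m + q)%N)).
  rewrite -mulr_sumr ler_wpM2l ?(ltW B0) // exchange_big /=.
  rewrite -[K in K%:R]card_ord -[_%:R]sumr_const mulr_suml; apply: ler_sum => q _.
  (* The shifts by q < K lengthen the range of samples by K, hence 2 M + 3 in place of 2 M + 2. *)
  have NE : (M * J + (2 * M + 3) * K).+1 = (N1 + K)%N.
    rewrite /N1 addSn -addnA -mulSnr; congr (_ + _ * _).+1.
    by rewrite -addnS.
  rewrite mul1r /S NE; apply: (sum_shift_le (F := fun m => rnorm (X m) ^+ 2)).
    by move=> n; rewrite sqr_ge0.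
  exact: ltnW.
apply: le_trans (ler_wpM2l _ H1) _; first by rewrite divr_ge0.
rewrite /B le_eqVlt; apply/orP; left; apply/eqP.
by rewrite -/S; field; rewrite gt_eqF.
Qed.

End DiscreteLower.

(** * From samples to integrals *)

Section SquareIntegrals.
Variables (R : realType) (V : normedModType R[i]).
Implicit Types (D : set R) (f g h : R -> V) (L : R).

(** Stated for the scalar integrand of [L2_normsq], so that no sigma-algebra on V is involved. *)
Definition measurable_sq D f := measurable_fun D (fun t : R => rnorm (f t) ^+ 2).

Lemma measurable_sq_EFin D f : measurable_sq D f ->
  measurable_fun D (fun t : R => (rnorm (f t) ^+ 2)%:E).
Proof. by move=> mf; exact: measurableT_comp. Qed.

Lemma L2_normsq_ge0 D f : (0 <= L2_normsq D f)%E.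
Proof. by apply: integral_ge0 => t _; rewrite lee_fin sqr_ge0. Qed.

Lemma L2_normsq_le2 D f g h : measurable D ->
    measurable_sq D f -> measurable_sq D g -> measurable_sq D h ->
    (forall t, D t -> rnorm (f t) ^+ 2 <= 2 * rnorm (g t) ^+ 2 + 2 * rnorm (h t) ^+ 2) ->
  (L2_normsq D f <= 2%:E * L2_normsq D g + 2%:E * L2_normsq D h)%E.
Proof.
move=> mD mf mg mh le2.
have m2 (k : R -> V) : measurable_sq D k ->
    measurable_fun D (fun t : R => (2%:E * (rnorm (k t) ^+ 2)%:E)%E).
  by move=> mk; apply: measurable_funeM; exact: (measurable_sq_EFin mk).
have p2 (k : R -> V) t : D t -> (0 <= 2%:E * (rnorm (k t) ^+ 2)%:E)%E.
  by move=> _; rewrite -EFinM lee_fin mulr_ge0 ?sqr_ge0.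
have p1 (k : R -> V) t : D t -> (0 <= (rnorm (k t) ^+ 2)%:E)%E.
  by move=> _; rewrite lee_fin sqr_ge0.
rewrite /L2_normsq -!ge0_integralZl_EFin //;
  try exact: (measurable_sq_EFin mg); try exact: (measurable_sq_EFin mh);
  try exact: p1.
rewrite -ge0_integralD //; try exact: m2; try exact: p2.
apply: ge0_le_integral => //.
- exact: p1.
- exact: (measurable_sq_EFin mf).
- by apply: emeasurable_funD; exact: m2.
Qed.

Definition lipschitz_fun f L := forall s t, rnorm (f s - f t) <= L * `|s - t|.

Lemma lipschitz_funB f L (v : V) : lipschitz_fun f L -> lipschitz_fun (fun t => f t - v) L.
Proof. by move=> fL s t; rewrite opprB addrA subrK fL. Qed.

Lemma lipschitz_measurable f L : lipschitz_fun f L ->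
  measurable_fun [set: R] (fun t : R => rnorm (f t)).
Proof.
move=> fL; apply: continuous_measurable_fun => t.
apply/cvgrPdist_le => /= e e0.
have L1 : 0 < `|L| + 1 by rewrite ltr_wpDl.
near=> s.
apply: le_trans (ler_dist_rnorm _ _) _; apply: le_trans (fL _ _) _.
apply: (@le_trans _ _ ((`|L| + 1) * `|t - s|)).
  by rewrite ler_wpM2r // (le_trans (ler_norm L)) // lerDl.
rewrite mulrC -ler_pdivlMr //; near: s.
by apply: cvgr_dist_le => //; rewrite divr_gt0.
Unshelve. all: by end_near.
Qed.

Lemma lipschitz_measurable_sq f L D : lipschitz_fun f L -> measurable_sq D f.
Proof.
move=> fL; apply: measurable_funTS; apply: measurable_funX.
exact: lipschitz_measurable fL.
Qed.

Lemma L2_normsq_itv f (l r : bool) (a b : R) : measurable_sq setT f ->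
  L2_normsq (bounded_itv l r a b) f = L2_normsq `[a, b[ f.
Proof.
move=> mf; rewrite /L2_normsq /bounded_itv.
have mf' (D : set R) : measurable_fun D (fun t => (rnorm (f t) ^+ 2)%:E).
  by apply: measurable_sq_EFin; exact: measurable_funTS.
by rewrite (@integral_itv_bndoo _ a b _ l r (mf' _)) -(@integral_itv_bndoo _ a b _ true true (mf' _)).
Qed.

Lemma L2_normsq_cst (v : V) (a b : R) : a <= b ->
  L2_normsq `[a, b[ (fun=> v) = ((b - a) * rnorm v ^+ 2)%:E.
Proof.
move=> ab; rewrite /L2_normsq integral_cst //= lebesgue_measure_itv /= lte_fin.
case: ltgtP ab => // [ab _|-> _]; first by rewrite -EFinB -EFinM mulrC.
by rewrite mule0 subrr mul0r.
Qed.

Lemma L2_normsq_split f (a b c : R) : measurable_sq setT f -> a <= b -> b <= c ->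
  L2_normsq `[a, c[ f = (L2_normsq `[a, b[ f + L2_normsq `[b, c[ f)%E.
Proof.
move=> mf ab bc.
have E : `[a, c[%classic = `[a, b[%classic `|` `[b, c[%classic :> set R.
  rewrite eqEsubset; split=> x /=; rewrite !in_itv /=.
    by move=> /andP[ax xc]; have [xb|xb] := ltP x b; [left|right]; rewrite ?ax ?xb ?xc.
  by case=> /andP[h1 h2]; apply/andP; split; lra.
rewrite /L2_normsq E ge0_integral_setU //.
- by apply: measurable_sq_EFin; exact: measurable_funTS.
- by move=> x _; rewrite lee_fin sqr_ge0.
apply/disj_setPS => x /=; rewrite !in_itv /= => -[/andP[_ h1] /andP[h2 _]]; lra.
Qed.

Lemma L2_normsq_subset f D E : measurable D -> measurable E -> measurable_sq setT f ->
  D `<=` E -> (L2_normsq D f <= L2_normsq E f)%E.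
Proof.
move=> mD mE mf DE; apply: ge0_subset_integral => //.
  by apply: measurable_sq_EFin; exact: measurable_funTS.
by move=> x _; rewrite lee_fin sqr_ge0.
Qed.

(** On a cell of length h, f stays within L h of its value at the left end. Both comparisons lose a
    factor 2, which is harmless since constants are not sought sharp. *)
Lemma lipschitz_step f L (c h : R) : 0 <= L -> 0 <= h -> lipschitz_fun f L ->
  (L2_normsq `[c, (c + h)%R[ f <= (2 * h * rnorm (f c) ^+ 2 + 2 * h * (L * h) ^+ 2)%:E)%E /\
  ((h * rnorm (f c) ^+ 2)%:E <= 2%:E * L2_normsq `[c, (c + h)%R[ f +
     (2 * h * (L * h) ^+ 2)%:E)%E.
Proof.
move=> L0 h0 fL; have ch : c <= c + h by rewrite lerDl.
have mc (v : V) D : measurable_sq D (fun=> v) by apply: measurable_cst.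
have mf D := @lipschitz_measurable_sq f L D fL.
have cst (v : V) : L2_normsq `[c, (c + h)%R[ (fun=> v) = (h * rnorm v ^+ 2)%:E.
  by rewrite L2_normsq_cst // addrC addKr.
have d t : t \in `[c, c + h[ -> rnorm (f t - f c) ^+ 2 <= (L * h) ^+ 2.
  rewrite in_itv /= => /andP[ct th].
  rewrite lerXn2r ?nnegrE ?rnorm_ge0 ?mulr_ge0 //; apply: le_trans (fL _ _) _.
  by rewrite ler_wpM2l // ger0_norm; lra.
pose df t := f t - f c.
have dE : (L2_normsq `[c, (c + h)%R[ df <= (h * (L * h) ^+ 2)%:E)%E.
  have -> : (h * (L * h) ^+ 2)%:E = (\int[lebesgue_measure]_(t in `[c, (c + h)%R[) ((L * h) ^+ 2)%:E)%E.
    rewrite integral_cst //= lebesgue_measure_itv /= lte_fin.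
    move: ch; rewrite le_eqVlt => /orP[/eqP E|->]; last by rewrite -EFinB -EFinM addrC addKr mulrC.
    have -> : h = 0 by lra.
    by rewrite addr0 ltxx mule0 mul0r.
  apply: ge0_le_integral => //.
  - by move=> t _; rewrite lee_fin sqr_ge0.
  - exact: measurable_sq_EFin (lipschitz_measurable_sq (lipschitz_funB (f c) fL)).
split.
  apply: le_trans (@L2_normsq_le2 _ f (fun=> f c) df _ _ _ _ _) _ => //.
  - exact: (lipschitz_measurable_sq (lipschitz_funB (f c) fL)).
  - by move=> t _; rewrite -{1}[f t](subrK (f c)) addrC rnormD_sqr.
  have -> : (2 * h * rnorm (f c) ^+ 2 + 2 * h * (L * h) ^+ 2)%:E =
      (2%:E * (h * rnorm (f c) ^+ 2)%:E + 2%:E * (h * (L * h) ^+ 2)%:E)%E.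
    by rewrite -!EFinM -EFinD; congr (_%:E); ring.
  by rewrite cst leeD2l // lee_wpmul2l.
rewrite -cst; apply: le_trans (@L2_normsq_le2 _ _ f df _ _ _ _ _) _ => //.
- exact: (lipschitz_measurable_sq (lipschitz_funB (f c) fL)).
- move=> t _; rewrite [rnorm (f t - f c)]rnormB_sym -{1}[f c](subrK (f t)) addrC.
  by rewrite rnormD_sqr.
by rewrite leeD2l // -mulrA EFinM lee_wpmul2l.
Qed.

Lemma lipschitz_riemann f L (a h : R) (n : nat) : 0 <= L -> 0 <= h -> lipschitz_fun f L ->
  (L2_normsq `[a, (a + h * n%:R)%R[ f <= (2 * h * \sum_(m < n) rnorm (f (a + h * m%:R)) ^+ 2 +
     2 * (h * n%:R) * (L * h) ^+ 2)%:E)%E /\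
  ((h * \sum_(m < n) rnorm (f (a + h * m%:R)) ^+ 2)%:E <=
     2%:E * L2_normsq `[a, (a + h * n%:R)%R[ f + (2 * (h * n%:R) * (L * h) ^+ 2)%:E)%E.
Proof.
move=> L0 h0 fL; elim: n => [|n [IH1 IH2]].
  have E0 : L2_normsq `[a, (a + h * 0%:R)%R[ f = 0%E.
    by rewrite mulr0 addr0 set_itvE /L2_normsq integral_set0.
  by rewrite E0 big_ord0 mulr0 !mulr0 mul0r addr0 mule0 adde0.
have step := @lipschitz_step f L (a + h * n%:R) h L0 h0 fL.
have hE : a + h * n.+1%:R = a + h * n%:R + h by rewrite -(natr1 n); ring.
have mf := @lipschitz_measurable_sq f L setT fL.
have -> : L2_normsq `[a, (a + h * n.+1%:R)%R[ f =
   (L2_normsq `[a, (a + h * n%:R)%R[ f + L2_normsq `[(a + h * n%:R)%R, (a + h * n%:R + h)%R[ f)%E.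
  by rewrite -L2_normsq_split // ?hE // lerDl // mulr_ge0.
rewrite big_ord_recr /=; case: step => s1 s2; split.
  apply: le_trans (leeD IH1 s1) _; rewrite -EFinD lee_fin -(natr1 n).
  by rewrite le_eqVlt; apply/orP; left; apply/eqP; ring.
rewrite mulrDr EFinD; apply: le_trans (leeD IH2 s2) _.
have := L2_normsq_ge0 `[a, (a + h * n%:R)%R[ f.
have := L2_normsq_ge0 `[(a + h * n%:R)%R, (a + h * n%:R + h)%R[ f.
move: (L2_normsq _ f) (L2_normsq _ f) => A B B0 A0.
rewrite addeACA; apply: leeD; first by rewrite ge0_muleDr.
rewrite -EFinD lee_fin -(natr1 n).
by rewrite le_eqVlt; apply/orP; left; apply/eqP; ring.
Qed.

End SquareIntegrals.

Lemma succ_le_mulS (m q k : nat) : (0 < k)%N -> ((m + q * k).+1 <= m + q.+1 * k)%N.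
Proof. by move=> k0; rewrite mulSn addnCA -add1n leq_add2r. Qed.

Section TrigSums.
Variables (R : realType) (H : normedModType R[i]).

Definition trig_sum (I : finType) (u : I -> R) (V : I -> H) (t : R) : H :=
  \sum_k expi (u k * t) *: V k.

Lemma trig_sum_lipschitz_fun (I : finType) (u : I -> R) (V : I -> H) :
  lipschitz_fun (trig_sum u V) (\sum_k `|u k| * rnorm (V k)).
Proof.
move=> s t; rewrite /trig_sum -sumrB mulr_suml.
apply: le_trans (rnorm_sum _ _ _) _; apply: ler_sum => k _.
rewrite -scalerBl rnormZ mulrAC ler_wpM2r ?rnorm_ge0 //.
by apply: le_trans (rnorm_expi_dist _ _) _; rewrite -mulrBr normrM.
Qed.

Lemma trig_sum_lipschitz (I : finType) (u : I -> R) (V : I -> H) :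
  exists2 L : R, 0 <= L & lipschitz_fun (trig_sum u V) L.
Proof.
exists (\sum_k `|u k| * rnorm (V k)); last exact: trig_sum_lipschitz_fun.
by apply: sumr_ge0 => k _; rewrite mulr_ge0 ?rnorm_ge0.
Qed.

Lemma trig_sum_grid (I : finType) (u : I -> R) (V : I -> H) (a h : R) m :
  trig_sum u V (a + h * m%:R) =
  \sum_k expi (h * u k) ^+ m *: (expi (u k * a) *: V k).
Proof.
apply: eq_bigr => k _; rewrite scalerA expiX -expiD; congr (expi _ *: _); ring.
Qed.

Lemma rnorm_expiZ (x : R) (v : H) : rnorm (expi x *: v) = rnorm v.
Proof. by rewrite rnormZ rnorm_expi mul1r. Qed.

Lemma natr_ge_all (x : R) : \forall n \near \oo, x <= n%:R :> R.
Proof.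
exists (Num.truncn `|x|).+1 => // n /= hn.
apply: le_trans (ler_norm x) _; apply: ltW.
by apply: lt_le_trans (truncnS_gt _) _; rewrite ler_nat.
Qed.

Lemma fin_spread (I : finType) (u : I -> R) :
  exists2 B : R, 0 <= B & forall k l, `|u k - u l| <= B.
Proof.
exists (2 * \sum_k `|u k|); first by rewrite mulr_ge0 // sumr_ge0.
have h k : `|u k| <= \sum_k `|u k|.
  by rewrite (bigD1 k) //= lerDl sumr_ge0.
move=> k l; apply: le_trans (ler_normB _ _) _.
by have := h k; have := h l; lra.
Qed.

Variable dot : {dot H for Num.conj}.
Hypothesis hdot : forall v : H, dot v v = `|v| ^+ 2.

(** With h K = b - a, the sieve constant times 2 h is 256 (b - a) (1 + ((b - a) gam)^-1),
    independent of K. So K may be chosen after the sum, large enough for the frequency spread and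
    for the Riemann error. *)
Lemma trig_sum_upper (a b gam : R) : a < b -> 0 < gam ->
  exists2 C : R, 0 < C & forall (I : finType) (u : I -> R) (V : I -> H),
    (forall k l, k != l -> gam <= `|u k - u l|) ->
  (L2_normsq `[a, b[ (trig_sum u V) <= (C * \sum_k rnorm (V k) ^+ 2)%:E)%E.
Proof.
move=> ab g0; have l0 : 0 < b - a by rewrite subr_gt0.
have pi0 := pi_gt0 R.
exists (256 * (b - a) * (1 + ((b - a) * gam)^-1)).
  have m0 : 0 < (b - a) * gam by rewrite mulr_gt0.
  by apply: mulr_gt0; [lra | rewrite ltr_wpDr // invr_ge0 ltW].
move=> I u V sep; apply/lee_addgt0Pr => e e0.
have [L L0 SL] := trig_sum_lipschitz u V; have [B B0 uB] := fin_spread u.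
have [K [K1 K2 K3]] : exists K : nat, [/\ 1 <= K%:R :> R, (b - a) * B / pi <= K%:R &
    2 * (b - a) * (L * (b - a)) ^+ 2 / e <= K%:R].
  have : \forall n \near \oo, [/\ 1 <= n%:R :> R, (b - a) * B / pi <= n%:R &
    2 * (b - a) * (L * (b - a)) ^+ 2 / e <= n%:R].
    near=> n; split; near: n; exact: natr_ge_all.
  by case=> N _ /(_ N (leqnn N)); exists N.
have K0 : 0 < K%:R :> R by lra.
have K0' : (0 < K)%N by rewrite -(ltr_nat R).
pose h := (b - a) / K%:R; have h0 : 0 < h by rewrite divr_gt0.
have hK : h * K%:R = b - a by rewrite /h divfK // gt_eqF.
have [s1 _] := @lipschitz_riemann R H _ L a h K L0 (ltW h0) SL.
rewrite hK addrC subrK in s1; apply: le_trans s1 _.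
rewrite -EFinD lee_fin; apply: lerD.
  under eq_bigr do rewrite trig_sum_grid.
  have hpi k l : h * `|u k - u l| <= pi.
    rewrite /h mulrAC ler_pdivrMr // -ler_pdivrMl // mulrC; apply: le_trans K2.
    by rewrite ler_wpM2r ?invr_ge0 ?(ltW pi0) // ler_wpM2l // ltW.
  have := large_sieve hdot (fun k => expi (u k * a) *: V k) g0 h0 K0' sep hpi.
  under [X in _ <= _ * X]eq_bigr do rewrite rnorm_expiZ.
  rewrite [K%:R * h]mulrC hK => LS.
  apply: le_trans (ler_wpM2l _ LS) _; first by rewrite mulr_ge0 // ltW.
  rewrite le_eqVlt; apply/orP; left; apply/eqP; rewrite mulrA; congr (_ * _).
  by rewrite -hK; ring.
rewrite /h; apply: (@le_trans _ _ (2 * (b - a) * (L * (b - a)) ^+ 2 / K%:R)).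
  rewrite [L * _]mulrA expr_div_n mulrA ler_wpM2l //.
    by rewrite mulr_ge0 ?sqr_ge0 // mulr_ge0 // ltW.
  by rewrite lef_pV2 ?posrE ?exprn_gt0 // expr2 ler_peMl // ltW.
by rewrite ler_pdivrMr // -ler_pdivrMl // [leLHS]mulrC.
Unshelve. all: by end_near.
Qed.

Lemma trig_sum_lower (a b gam r : R) (M : nat) : a < b -> 0 < gam -> 0 < r ->
    2 * pi * M%:R / r < b - a ->
  exists2 C : R, 0 < C & forall (I : finType) (u : I -> R) (V : I -> H),
    (forall k l, k != l -> gam <= `|u k - u l|) ->
    (forall x, (#|[pred l | (x <= u l < x + r)%R]| <= M)%N) ->
  ((\sum_k rnorm (V k) ^+ 2)%:E <= C%:E * L2_normsq `[a, b[ (trig_sum u V))%E.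
Proof.
move=> ab g0 r0 Mr; have l0 : 0 < b - a by rewrite subr_gt0.
have pi0 := pi_gt0 R.
pose d := b - a - 2 * pi * M%:R / r; have d0 : 0 < d by rewrite subr_gt0.
(* The samples beyond M J number at most (2 M + 4) K and cover a length 2 pi (2 M + 4) / (E r); this
   E makes it at most the slack d. *)
pose E := (Num.truncn (2 * pi * (2 * M + 4)%:R / (r * d))).+1.
have Er : 2 * pi * (2 * M + 4)%:R / (E%:R * r) <= d.
  have := ltW (truncnS_gt (2 * pi * (2 * M + 4)%:R / (r * d))); rewrite -/E.
  have E0 : 0 < E%:R :> R by rewrite ltr0n.
  by rewrite !ler_pdivrMr ?mulr_gt0 // => h; apply: le_trans h _; rewrite le_eqVlt;
    apply/orP; left; apply/eqP; ring.
have [C C0 HC] := @discrete_lower_bound R H dot hdot M E gam r isT g0 r0.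
(* As h = 2 pi / (J r), the discrete factor C / J equals c h, the weight of a Riemann sum. *)
pose c := C * r / (2 * pi).
have c0 : 0 <= c by rewrite divr_ge0 ?mulr_ge0 // ltW.
exists (2 * c + 1); first by rewrite ltr_wpDl // mulr_ge0.
move=> I u V sep dens.
have [L L0 SL] := trig_sum_lipschitz u V; have [B B0 uB] := fin_spread u.
have mS : measurable_sq setT (trig_sum u V) by exact: lipschitz_measurable_sq SL.
set X := L2_normsq _ _; have X0 : (0 <= X)%E by exact: L2_normsq_ge0.
apply: (@le_trans _ _ ((2 * c)%:E * X)%E); last first.
  by apply: lee_wpmul2r => //; rewrite lee_fin lerDl.
apply/lee_addgt0Pr => e e0.
pose y : R := 2 * (b - a) * c * (L * (2 * pi / r)) ^+ 2.
have y0 : 0 <= y by rewrite mulr_ge0 ?sqr_ge0 // mulr_ge0 // mulr_ge0 // ltW.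
have [K [K1 K2 K3]] : exists K : nat, [/\ 3 <= K%:R :> R, 2 * (B / r + 2) <= K%:R &
    y / e <= K%:R].
  have : \forall n \near \oo, [/\ 3 <= n%:R :> R, 2 * (B / r + 2) <= n%:R & y / e <= n%:R].
    near=> n; split; near: n; exact: natr_ge_all.
  by case=> N _ /(_ N (leqnn N)); exists N.
pose J := (E * K)%N.
have KJ : (K <= J)%N by rewrite /J leq_pmull.
have KJ' : K%:R <= J%:R :> R by rewrite ler_nat.
have K0 : 0 < K%:R :> R by lra.
have J0 : 0 < J%:R :> R by lra.
have J2 : (2 < J)%N by rewrite -(ltr_nat R); lra.
have spread k l : `|u k - u l| <= r * (J%:R / 2 - 2).
  apply: le_trans (uB k l) _; rewrite -ler_pdivrMl // mulrC; lra.
pose h := 2 * pi / (J%:R * r); have h0 : 0 < h by rewrite divr_gt0 ?mulr_gt0.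
pose n := (M * J + (2 * M + 3) * K).+1.
have hn : h * n%:R <= b - a.
  have nle : n%:R <= (M * J + (2 * M + 4) * K)%:R :> R.
    have : (1 <= K)%N by rewrite -(ltr_nat R).
    by move=> K1'; rewrite ler_nat [(2 * M + 4)%N]addnS; exact: succ_le_mulS.
  apply: le_trans (ler_wpM2l (ltW h0) nle) _.
  have -> : (M * J + (2 * M + 4) * K)%:R = M%:R * J%:R + (2 * M + 4)%:R * K%:R :> R.
    by rewrite natrD (natrM _ M) (natrM _ (2 * M + 4)%N).
  rewrite mulrDr.
  have -> : h * (M%:R * J%:R) = 2 * pi * M%:R / r by rewrite /h; field; rewrite !gt_eqF.
  have -> : h * ((2 * M + 4)%:R * K%:R) = 2 * pi * (2 * M + 4)%:R / (E%:R * r).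
    have E0 : 0 < E%:R :> R by rewrite ltr0n.
    by rewrite /h /J natrM; field; rewrite !gt_eqF.
  by move: Er; rewrite /d; lra.
have := HC K J I u (fun k => expi (u k * a) *: V k) erefl J2 sep dens spread.
under eq_bigr do rewrite rnorm_expiZ.
under [X in _ <= _ * X]eq_bigr do rewrite -trig_sum_grid.
rewrite -/h -/n => HC'.
have [_ s2] := @lipschitz_riemann R H _ L a h n L0 (ltW h0) SL.
have XE : (L2_normsq `[a, (a + h * n%:R)%R[ (trig_sum u V) <= X)%E.
  apply: L2_normsq_subset => // x /=; rewrite !in_itv /= => /andP[-> /= h1]; lra.
apply: (@le_trans _ _ (c * (h * \sum_(m < n) rnorm (trig_sum u V (a + h * m%:R)) ^+ 2))%:E).
  rewrite lee_fin; apply: le_trans HC' _; rewrite le_eqVlt; apply/orP; left; apply/eqP.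
  rewrite [RHS]mulrA; congr (_ * _); rewrite /c /h; move: (pi) pi0 => p p0.
  by field; rewrite !gt_eqF.
rewrite EFinM; apply: le_trans (lee_wpmul2l _ s2) _; first by rewrite lee_fin.
apply: (@le_trans _ _ (c%:E * (2%:E * X + (2 * (h * n%:R) * (L * h) ^+ 2)%:E))%E).
  by apply: lee_wpmul2l; [rewrite lee_fin | apply: leeD => //; apply: lee_wpmul2l].
rewrite ge0_muleDr; [|by rewrite mule_ge0|by rewrite lee_fin mulr_ge0 ?sqr_ge0 // mulr_ge0 // mulr_ge0 // ltW].
rewrite muleA -EFinM [c * 2]mulrC; apply: leeD => //.
rewrite -EFinM lee_fin.
have -> : L * h = L * (2 * pi / r) / J%:R by rewrite /h; field; rewrite !gt_eqF.
apply: (@le_trans _ _ (y / J%:R)).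
  apply: (@le_trans _ _ (y / J%:R ^+ 2)).
    have -> : y / J%:R ^+ 2 = c * (2 * (b - a) * (L * (2 * pi / r) / J%:R) ^+ 2).
      by rewrite /y expr_div_n; ring.
    by rewrite ler_wpM2l // ler_wpM2r ?sqr_ge0 // ler_wpM2l.
  rewrite ler_wpM2l // lef_pV2 ?posrE ?exprn_gt0 // expr2 ler_peMl ?(ltW J0) //; lra.
by rewrite ler_pdivrMr // -ler_pdivrMl // mulrC; apply: le_trans KJ'.
Unshelve. all: by end_near.
Qed.

End TrigSums.

(** * From finite sums to square summable families *)

Section StrongMeasurability.
Variables (R : realType) (V : normedModType R[i]).
Implicit Types (D : set R) (f g : R -> V).

Lemma cvg_rnormP (u : nat -> V) (l : V) :
  u n @[n --> \oo] --> l <->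
  (forall e : R, 0 < e -> \forall n \near \oo, rnorm (l - u n) < e).
Proof.
split=> [/cvgrPdist_lt h e e0|h].
  have /h : 0 < e%:C by rewrite ltcR.
  by apply: filterS => n; rewrite normC_rnorm ltcR.
apply/cvgrPdist_lt => e e0.
have eE : e = (complex.Re e)%:C by rewrite RRe_real // gtr0_real.
have e0' : 0 < complex.Re e by rewrite -ltcR -eE.
by have := h _ e0'; apply: filterS => n; rewrite normC_rnorm eE ltcR.
Qed.

Lemma cvg_rnorm (u : nat -> V) (l : V) :
  u n @[n --> \oo] --> l -> rnorm (u n) @[n --> \oo] --> rnorm l.
Proof.
move=> /cvg_rnormP h; apply/cvgrPdist_lt => e e0; have := h e e0.
by apply: filterS => n; apply: le_lt_trans; apply: ler_dist_rnorm.
Qed.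

Lemma simple_measurable_sq (s g : R -> V) L : simple_vfun s -> lipschitz_fun g L ->
  measurable_sq setT (fun t => s t - g t).
Proof.
move=> [fs ms] gL; rewrite /measurable_sq => _ Y mY; rewrite setTI.
have -> : (fun t => rnorm (s t - g t) ^+ 2) @^-1` Y =
    \bigcup_(v in range s) (s @^-1` [set v] `&` (fun t => rnorm (g t - v) ^+ 2) @^-1` Y).
  rewrite eqEsubset; split=> t /=.
    by move=> Yt; exists (s t); [exists t | split=> //=; rewrite rnormB_sym].
  by move=> [w _ [/= -> ]]; rewrite rnormB_sym.
apply: fin_bigcup_measurable => // v _; apply: measurableI; first exact: ms.
have := @lipschitz_measurable_sq R V _ L setT (lipschitz_funB v gL) measurableT Y mY.
by rewrite setTI.
Qed.

Lemma strongly_measurable_sq D f g L : strongly_measurable D f -> lipschitz_fun g L ->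
  measurable_sq D (fun t => f t - g t).
Proof.
move=> [s ss sf] gL.
apply: (measurable_fun_cvg (h := fun n t => rnorm (s n t - g t) ^+ 2)).
  by move=> n; apply: measurable_funTS; exact: simple_measurable_sq (ss n) gL.
move=> t Dt; rewrite expr2; under eq_fun do rewrite expr2.
have h : rnorm (s n t - g t) @[n --> \oo] --> rnorm (f t - g t).
  apply: cvg_rnorm; apply/cvg_rnormP => e e0.
  have /cvg_rnormP/(_ e e0) := sf t Dt; apply: filterS => n.
  by rewrite opprB addrA subrK.
exact: cvgM.
Qed.

Lemma simple_of_index (idx : R -> nat) (val : nat -> V) N :
    (forall t, (idx t <= N)%N) ->
    (forall i, measurable (idx @^-1` [set i] : set (measurableTypeR R))) ->
  simple_vfun (fun t => val (idx t)).
Proof.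
move=> idxN midx; split.
  apply: (@sub_finite_set _ _ (val @` `I_N.+1)).
    by move=> _ [t _ <-] /=; exists (idx t) => //=; rewrite ltnS.
  exact: finite_image.
move=> v; have -> : (fun t => val (idx t)) @^-1` [set v] =
    \bigcup_(i in [set i | val i = v]) (idx @^-1` [set i]).
  rewrite eqEsubset; split=> t /=; first by move=> h; exists (idx t).
  by move=> [i /= <- ->].
exact: bigcup_measurable.
Qed.

(* s takes the values of g on a grid of step at most e / L. *)
Lemma lipschitz_grid (E : set R) (a b : R) g L (e : R) : 0 < e -> 0 <= L -> lipschitz_fun g L ->
    measurable (E : set (measurableTypeR R)) -> E `<=` `[a, b] ->
  exists2 s : R -> V, simple_vfun s &
    (forall t, E t -> rnorm (g t - s t) <= e) /\ (forall t, ~ E t -> s t = 0).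
Proof.
move=> e0 L0 gL mE Eab.
pose M := (Num.truncn (L / e)).+1.
have M0 : 0 < M%:R :> R by rewrite ltr0n.
have Me : L / M%:R <= e.
  rewrite ler_pdivrMr // mulrC -ler_pdivrMr //; apply: ltW; exact: truncnS_gt.
(* Index 0 is reserved for the complement of E, where the value is 0; the cell number j is coded as
   j + 1. *)
pose idx t : nat := if `[< E t >] then (Num.truncn ((t - a) * M%:R)).+1 else 0%N.
pose val i : V := if i is j.+1 then g (a + j%:R / M%:R) else 0.
have Et t : E t -> (Num.truncn ((t - a) * M%:R))%:R <= (t - a) * M%:R <
    (Num.truncn ((t - a) * M%:R)).+1%:R.
  move=> /Eab /=; rewrite in_itv /= => /andP[at_ _]; apply: truncn_itv.
  by rewrite mulr_ge0 ?subr_ge0 // ltW.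
exists (fun t => val (idx t)); last first.
  split=> t h; rewrite /idx; last by rewrite asboolF.
  rewrite asboolT //=; apply: le_trans (gL _ _) _; apply: le_trans Me.
  rewrite ler_wpM2l //; have /andP[h1 h2] := Et t h.
  move: (Num.truncn _) h1 h2 => j; rewrite -(natr1 j) => h1 h2.
  have -> : t - (a + j%:R / M%:R) = ((t - a) * M%:R - j%:R) / M%:R.
    by field; rewrite gt_eqF.
  rewrite normf_div (gtr0_norm M0) ler_pdivrMr // mulVf ?gt_eqF // ger0_norm; lra.
apply: (@simple_of_index _ _ (Num.truncn ((b - a) * M%:R)).+2) => [t|i].
  rewrite /idx; case: asboolP => // h; rewrite ltnS leqW //; apply: le_truncn.
  by have /= := Eab t h; rewrite in_itv /= ler_pM2r // lerD2r => /andP[].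
case: i => [|j].
  have -> : idx @^-1` [set 0%N] = ~` E.
    by rewrite eqEsubset /idx; split=> t /=; case: asboolP.
  exact: measurableC.
have -> : idx @^-1` [set j.+1] =
    E `&` `[(a + j%:R / M%:R)%R, (a + j.+1%:R / M%:R)%R[%classic.
  rewrite eqEsubset /idx; split=> t /=; case: asboolP => // h.
    move=> [jE]; split=> //; have := Et t h; rewrite jE in_itv /=.
    rewrite -ler_pdivrMr // -ltr_pdivlMr // => /andP[h1 h2].
    by apply/andP; split; lra.
  move=> [_]; rewrite in_itv /= => /andP[h1 h2]; congr _.+1; apply: truncn_def.
    by rewrite -ler_pdivrMr // -ltr_pdivlMr //; apply/andP; split; lra.
  by move=> [].
by apply: measurableI => //; exact: measurable_itv.
Qed.

End StrongMeasurability.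

Section PartialSums.
Variables (R : realType).
Implicit Types (a : int -> R) (F G : {fset int}).

Lemma sum_fset_le_esum a F : (forall k, 0 <= a k) ->
  ((\sum_(k <- F) a k)%:E <= \esum_(k in [set: int]) (a k)%:E)%E.
Proof.
move=> a0; apply: esum_ge; exists [set` F].
  by split=> //; exact: finite_fset.
by rewrite -fsbig_seq ?fset_uniq // sumEFin.
Qed.

Lemma esum_le_fset a (x : \bar R) :
  (forall F, ((\sum_(k <- F) a k)%:E <= x)%E) -> (\esum_(k in [set: int]) (a k)%:E <= x)%E.
Proof.
move=> h; apply: ub_ereal_sup => _ [A [/finite_fsetP [F ->] _] <-].
by rewrite -fsbig_seq ?fset_uniq // sumEFin.
Qed.

Lemma esum_tail a (e : R) : (forall k, 0 <= a k) -> 0 < e ->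
    (\esum_(k in [set: int]) (a k)%:E < +oo)%E ->
  exists G, forall F, [disjoint F & G]%fset -> \sum_(k <- F) a k <= e.
Proof.
move=> a0 e0 fin.
have s0 : (0 <= \esum_(k in [set: int]) (a k)%:E)%E.
  by have := sum_fset_le_esum fset0 a0; rewrite big_nil.
have sE : (\esum_(k in [set: int]) (a k)%:E)%E \is a fin_num by rewrite ge0_fin_numE.
have [G Gs] : exists G, (\esum_(k in [set: int]) (a k)%:E - e%:E < (\sum_(k <- G) a k)%:E)%E.
  apply: contrapT => /forallNP h.
  have : (\esum_(k in [set: int]) (a k)%:E <= \esum_(k in [set: int]) (a k)%:E - e%:E)%E.
    by apply: esum_le_fset => F; have /negP := h F; rewrite -leNgt.
  by rewrite -(fineK sE) -EFinB lee_fin; lra.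
exists G => F FG; have := sum_fset_le_esum (F `|` G)%fset a0.
have -> : \sum_(k <- (F `|` G)%fset) a k = \sum_(k <- F) a k + \sum_(k <- G) a k.
  rewrite -big_cat /=; apply: perm_big; apply: uniq_perm.
  - exact: fset_uniq.
  - rewrite cat_uniq !fset_uniq andbT /=; apply/hasPn => k kG.
    by apply/negP => kF; have /fdisjointP/(_ k kF) := FG; rewrite kG.
  - by move=> k; rewrite mem_cat in_fsetU.
by move: Gs; rewrite -(fineK sE) -EFinB lte_fin lee_fin; lra.
Qed.

End PartialSums.

Section ExtendedLimits.
Variable R : realType.

Lemma ecvg0P (T : Type) (F : set_system T) (FF : Filter F) (u : T -> \bar R) :
  (forall x, (0 <= u x)%E) ->
  u x @[x --> F] --> 0%E <->
  (forall e : R, 0 < e -> \forall x \near F, (u x <= e%:E)%E).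
Proof.
move=> u0; split=> [/fine_cvgP[ufin /cvgrPdist_le h] e e0|h].
  have := h e e0; apply: filterS2 ufin => x ufx /=.
  by rewrite sub0r normrN ger0_norm ?fine_ge0 // -lee_fin fineK.
have fin (e : R) x : (u x <= e%:E)%E -> u x \is a fin_num.
  by move=> h1; rewrite ge0_fin_numE //; apply: le_lt_trans h1 _; rewrite ltry.
apply/fine_cvgP; split; first by apply: filterS (h 1 ltr01) => x /fin.
apply/cvgrPdist_le => e e0; apply: filterS (h e e0) => x ux /=.
by rewrite sub0r normrN ger0_norm ?fine_ge0 // -lee_fin fineK // (fin _ _ ux).
Qed.

End ExtendedLimits.

(** * Passage to the limit from uniform estimates on finite sums *)

Section Assembly.
Variables (R : realType) (H : completeNormedModType R[i]).
Variables (omega : int -> R) (U : int -> H).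

Definition partial_sum (x : int -> R[i]) (F : {fset int}) (t : R) : H :=
  \sum_(k <- F) (x k * expi (omega k * t)) *: U k.

Lemma partial_sum_trig x F :
  partial_sum x F = trig_sum (fun k : F => omega (val k)) (fun k : F => x (val k) *: U (val k)).
Proof.
apply/funext => t; rewrite /partial_sum big_seq_fsetE /=.
by apply: eq_bigr => k _; rewrite scalerA mulrC.
Qed.

Lemma partial_sum_lipschitz x F :
  exists2 L : R, 0 <= L & lipschitz_fun (partial_sum x F) L.
Proof. by rewrite partial_sum_trig; exact: trig_sum_lipschitz. Qed.

Lemma partial_sumB x F G : (G `<=` F)%fset ->
  forall t, partial_sum x F t - partial_sum x G t = partial_sum x (F `\` G)%fset t.
Proof.
move=> GF t; rewrite /partial_sum (big_fsetID _ (mem G)) /=.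
have -> : [fset k in F | k \in G]%fset = G.
  by apply/fsetP => k; rewrite !inE /= andbC; case: (boolP (k \in G)) => // /(fsubsetP GF) ->.
have -> : [fset k in F | k \notin G]%fset = (F `\` G)%fset.
  by apply/fsetP => k; rewrite !inE /= andbC.
by rewrite addrAC subrr add0r.
Qed.

Variables (l r : bool) (a b : R).
Let D := bounded_itv l r a b.
Variables (C1 C2 : R).
Hypotheses (C10 : 0 < C1) (C20 : 0 < C2).
Hypothesis upper : forall (x : int -> R[i]) (F : {fset int}),
  (L2_normsq D (partial_sum x F) <= (C1 * \sum_(k <- F) rnorm (x k) ^+ 2)%:E)%E.
Hypothesis lower : forall (x : int -> R[i]) (F : {fset int}),
  ((\sum_(k <- F) rnorm (x k) ^+ 2)%:E <= C2%:E * L2_normsq D (partial_sum x F))%E.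

Lemma bounded_itv_measurable : measurable (D : set (measurableTypeR R)).
Proof. exact: measurable_itv. Qed.

(** The rate 8^-j leaves room for a weight 4^j on the squared increments. The bound covers every
    finite set containing F j, as convergence along finite sets requires. *)
Lemma partial_sum_exhaustion (x : int -> R[i]) : (l2_normsq x < +oo)%E ->
  exists F : nat -> {fset int},
    (forall j, (F j `<=` F j.+1)%fset) /\
    forall j G, (F j `<=` G)%fset ->
      (L2_normsq D (fun t => (partial_sum x G t - partial_sum x (F j) t)%R) <= (C1 * 8%:R ^- j)%:E)%E.
Proof.
move=> xfin; have x0 k : 0 <= rnorm (x k) ^+ 2 by rewrite sqr_ge0.
have /choice[G HG] (j : nat) : exists G : {fset int}, forall F : {fset int},
    [disjoint F & G]%fset -> \sum_(k <- F) rnorm (x k) ^+ 2 <= 8%:R ^- j.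
  by apply: esum_tail => //; rewrite invr_gt0 exprn_gt0.
pose F := fix F j := if j is j'.+1 then (F j' `|` G j)%fset else G 0%N.
exists F; split=> [j|j F' FF']; first by rewrite /= fsubsetUl.
have -> : (fun t => partial_sum x F' t - partial_sum x (F j) t) = partial_sum x (F' `\` F j)%fset.
  by apply/funext => t; rewrite partial_sumB.
apply: le_trans (upper _ _) _; rewrite lee_fin ler_pM2l //; apply: HG.
have GF : (G j `<=` F j)%fset by case: (j) => [|j'] /=; rewrite ?fsubsetUr.
apply: fdisjointWr GF _.
by have := fsubset_refl (F' `\` F j)%fset; rewrite fsubsetD => /andP[].
Qed.

Lemma limn_einf_le (u : (\bar R)^nat) (x : \bar R) :
  (forall n, (u n <= x)%E) -> (limn_einf u <= x)%E.
Proof.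
move=> ux; rewrite limn_einf_lim; apply: lime_le; first exact: is_cvg_einfs.
by near=> n; apply: ge_ereal_inf; exists (u n) => //=; exists n => //=.
Unshelve. all: by end_near.
Qed.

Lemma cauchy_geometric (u : nat -> H) (c : R) :
    (forall j, rnorm (u j.+1 - u j) <= c * 2^-1 ^+ j) -> cvgn u.
Proof.
move=> uc; have c0 : 0 <= c.
  by have := uc 0%N; rewrite expr0 mulr1; apply: le_trans; exact: rnorm_ge0.
have tail j n : rnorm (u (j + n)%N - u j) <= 2 * c * 2^-1 ^+ j - 2 * c * 2^-1 ^+ (j + n).
  elim: n => [|n IH]; first by rewrite addn0 !subrr rnorm0.
  rewrite addnS -(subrKA (u (j + n)%N)); apply: le_trans (rnormD _ _) _.
  by have := uc (j + n)%N; rewrite exprS; lra.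
apply/cauchy_cvgP/cauchy_exP => e e0.
have eE : e = (complex.Re e)%:C by rewrite RRe_real // gtr0_real.
have e0' : 0 < complex.Re e by rewrite -ltcR -eE.
have [j jP] : exists j, 2 * c * 2^-1 ^+ j < complex.Re e.
  have h : 2 * c * 2^-1 ^+ j @[j --> \oo] --> (2 * c * 0 : R).
    by apply: cvgMl_tmp; apply: cvg_expr; rewrite ger0_norm ?invr_ge0 // invf_lt1 // ltr1n.
  rewrite mulr0 in h; have /cvgrPdist_lt/(_ _ e0')[j _ /(_ j (leqnn j))] := h.
  by rewrite sub0r normrN => h1; exists j; apply: le_lt_trans h1; exact: ler_norm.
exists (u j); exists j => // n /= jn.
rewrite -ball_normE /= normC_rnorm eE ltcR rnormB_sym.
have := tail j (n - j)%N; rewrite subnKC // => h; apply: le_lt_trans h _.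
have : 0 <= 2 * c * 2^-1 ^+ n by rewrite mulr_ge0 ?exprn_ge0 ?invr_ge0 // mulr_ge0.
lra.
Qed.

Lemma sum_half_le n : \sum_(j < n) 2^-1 ^+ j <= 2 :> R.
Proof.
suff -> : \sum_(j < n) 2^-1 ^+ j = 2 - 2 * 2^-1 ^+ n :> R.
  by rewrite lerBlDr lerDl mulr_ge0 // exprn_ge0 // invr_ge0.
elim: n => [|n IH]; first by rewrite big_ord0 expr0 mulr1 subrr.
by rewrite big_ord_recr /= IH exprS; field.
Qed.

(** A Riesz-Fischer argument. As [in_L2] asks for strong measurability at every point of D, f is
    built pointwise: the limit of the S j off a null set, and 0 elsewhere. The constants double
    through |u + v|^2 <= 2 |u|^2 + 2 |v|^2. *)
Lemma estimates_intro : estimates omega U D.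
Proof.
have mD := bounded_itv_measurable.
exists (2 * C1)^-1, (2 * C2).
have C10' : 0 < (2 * C1)^-1 by rewrite invr_gt0 mulr_gt0.
have C20' : 0 < 2 * C2 by rewrite mulr_gt0.
split=> //.
move=> x xfin; have [F [Finc Ftail]] := partial_sum_exhaustion xfin.
have Fmono i j : (i <= j)%N -> (F i `<=` F j)%fset.
  elim: j => [|j IH]; first by rewrite leqn0 => /eqP ->.
  by rewrite leq_eqVlt => /orP[/eqP -> //|/IH h]; apply: fsubset_trans h (Finc j).
pose S j := partial_sum x (F j).
pose dS j t := S j.+1 t - S j t.
have mdS j E : measurable_sq E (dS j).
  have -> : dS j = partial_sum x (F j.+1 `\` F j)%fset by apply/funext => t; exact: partial_sumB.
  by have [L _ SL] := partial_sum_lipschitz x (F j.+1 `\` F j)%fset; exact: lipschitz_measurable_sq SL.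
(* Where the sum over j is finite, |dS j t| is at most a constant times 2^-j, so S j t converges.
   The integrals are of order 4^j 8^-j = 2^-j, hence the sum is finite almost everywhere. *)
pose g j t := (4%:R ^+ j * rnorm (dS j t) ^+ 2)%:E.
have g0 j t : D t -> (0 <= g j t)%E by move=> _; rewrite /g lee_fin mulr_ge0 ?sqr_ge0 ?exprn_ge0.
have mg j : measurable_fun D (g j).
  apply: measurableT_comp => //; apply: measurable_funM; first exact: measurable_cst.
  exact: mdS.
have gint j : (\int[lebesgue_measure]_(t in D) g j t <= (C1 * 2^-1 ^+ j)%:E)%E.
  rewrite /g; under eq_integral do rewrite EFinM.
  rewrite ge0_integralZl_EFin ?exprn_ge0 //;
    [|by move=> t _; rewrite lee_fin sqr_ge0|exact: measurable_sq_EFin (mdS j D)].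
  apply: le_trans (lee_wpmul2l _ (Ftail j _ (Finc j))) _; first by rewrite lee_fin exprn_ge0.
  rewrite -EFinM lee_fin le_eqVlt; apply/orP; left; apply/eqP.
  have -> : 8%:R = 4%:R * 2 :> R by rewrite -natrM.
  by rewrite exprMn exprVn; field; rewrite !expf_neq0.
pose G t := (\sum_(j <oo) g j t)%E.
have G0 t : D t -> (0 <= G t)%E by move=> Dt; apply: nneseries_ge0 => j _ _; exact: g0.
have mG : measurable_fun D G.
  by apply: ge0_emeasurable_sum => // j t Dt _; exact: g0.
have Gint : (\int[lebesgue_measure]_(t in D) G t <= (C1 * 2)%:E)%E.
  rewrite integral_nneseries //; apply: lime_le.
    by apply: is_cvg_nneseries => n _ _; apply: integral_ge0; exact: g0.
  near=> n; apply: (@le_trans _ _ (\sum_(0 <= j < n) (C1 * 2^-1 ^+ j)%:E)%E).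
    by apply: lee_sum => j _; exact: gint.
  by rewrite sumEFin lee_fin -mulr_sumr big_mkord ler_pM2l // sum_half_le.
have [N [mN N0 NP]] : {ae lebesgue_measure, forall t, D t -> G t \is a fin_num}.
  apply: integrable_ae => //; apply/integrableP; split=> //.
  have -> : (\int[lebesgue_measure]_(t in D) `|G t| = \int[lebesgue_measure]_(t in D) G t)%E.
    by apply: eq_integral => t; rewrite inE => Dt; rewrite gee0_abs // G0.
  by apply: le_lt_trans Gint _; rewrite ltry.
pose E := D `\` N.
have mE : measurable (E : set (measurableTypeR R)) by exact: measurableD.
have Scvg t : E t -> cvgn (S ^~ t).
  move=> [Dt Nt]; have Gfin : G t \is a fin_num.
    by apply: contrapT => h; apply: Nt; apply: NP => /(_ Dt).
  have Gt0 : 0 <= fine (G t) by rewrite fine_ge0 // G0.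
  apply: (@cauchy_geometric _ (Num.sqrt (fine (G t)))) => j.
  rewrite -/(dS j t) -(@ler_pXn2r _ 2%N) ?nnegrE ?rnorm_ge0 ?mulr_ge0 ?sqrtr_ge0 ?exprn_ge0 ?invr_ge0 //.
  have -> : (Num.sqrt (fine (G t)) * 2^-1 ^+ j) ^+ 2 = fine (G t) / 4%:R ^+ j.
    have q : 2^-1 ^+ 2 = 4%:R^-1 :> R by rewrite exprVn -natrX.
    by rewrite exprMn sqr_sqrtr // exprAC q exprVn.
  rewrite ler_pdivlMr ?exprn_gt0 // ?exprn_gt0 // mulrC.
  rewrite -lee_fin fineK //; apply: (@le_trans _ _ (\sum_(0 <= i < j.+1) g i t)%E).
    rewrite big_nat_recr //=; apply: leeDr.
    by apply: sume_ge0 => i _; exact: g0.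
  by apply: nneseries_lim_ge => i _ _; exact: g0.
pose f t : H := if `[< E t >] then lim (S j t @[j --> \oo]) else 0.
have fE t : E t -> S j t @[j --> \oo] --> f t.
  by move=> Et; rewrite /f asboolT //; exact: Scvg.
have f0 t : ~ E t -> f t = 0 by move=> h; rewrite /f asboolF.
have Eab : E `<=` `[a, b].
  move=> t [+ _]; rewrite /D /bounded_itv /= !itv_boundlr /= => /andP[h1 h2].
  by apply/andP; split; [case: (l) h1 | case: (r) h2] => //= /ltW.
have sf : strongly_measurable D f.
  (* Diagonal choice: s n follows S n within 1 / (n + 1) on E and vanishes off E, so it converges to
     f everywhere. *)
  have /choice[s sP] (n : nat) : exists s : R -> H, simple_vfun s /\
     ((forall t, E t -> rnorm (S n t - s t) <= n.+1%:R^-1) /\ (forall t, ~ E t -> s t = 0)).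
    have [L L0 SL] := partial_sum_lipschitz x (F n).
    have e0 : 0 < n.+1%:R^-1 :> R by rewrite invr_gt0 ltr0n.
    by have [s s1 s2] := lipschitz_grid e0 L0 SL mE Eab; exists s.
  exists s; first by move=> n; case: (sP n).
  move=> t _; have [Et|Et] := pselect (E t); last first.
    rewrite f0 //; have -> : s ^~ t = fun=> 0 by apply/funext => n; apply: (sP n).2.2.
    exact: cvg_cst.
  apply/cvg_rnormP => e e0; have e20 : 0 < e / 2 by rewrite divr_gt0.
  have /cvg_rnormP/(_ _ e20) := fE t Et; apply: filterS2 (natr_ge_all (e / 2)^-1) => n h1 h2.
  rewrite -(subrKA (S n t)); apply: le_lt_trans (rnormD _ _) _.
  have := (sP n).2.1 t Et => h3.
  have h4 : n.+1%:R^-1 <= e / 2.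
    by rewrite invf_ple ?posrE ?ltr0n //; apply: le_trans h1 _; rewrite ler_nat.
  rewrite [ltRHS]splitr; apply: ltr_leD => //; exact: le_trans h4.
have mfS K : measurable_sq D (fun t => f t - partial_sum x K t).
  by have [L _ SL] := partial_sum_lipschitz x K; exact: strongly_measurable_sq SL.
have mf : measurable_sq D f.
  have := mfS fset0; congr (measurable_sq D _); apply/funext => t.
  by rewrite /partial_sum big_nil subr0.
have mS K E' : measurable_sq E' (partial_sum x K).
  by have [L _ SL] := partial_sum_lipschitz x K; exact: lipschitz_measurable_sq SL.
have mSS K K' : measurable_sq D (fun t => partial_sum x K t - partial_sum x K' t).
  have [L1 L10 SL1] := partial_sum_lipschitz x K.
  have [L2 L20 SL2] := partial_sum_lipschitz x K'.
  have SL : lipschitz_fun (fun t => partial_sum x K t - partial_sum x K' t) (L1 + L2).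
    move=> u v; rewrite opprD addrACA mulrDl; apply: le_trans (rnormD _ _) _.
    by apply: lerD; [exact: SL1 | rewrite -opprD rnormN; exact: SL2].
  exact: lipschitz_measurable_sq SL.
(* Fatou's lemma along S (i + n) transfers the tail bound to f. The factor 4 arises from comparing
   both S (i + n) and the sum over K with the sum over F i. *)
have approx i K : (F i `<=` K)%fset ->
    (L2_normsq D (fun t => (f t - partial_sum x K t)%R) <= (4 * C1 * 8%:R ^- i)%:E)%E.
  move=> FK; pose u n t : \bar R := (rnorm (S (i + n)%N t - partial_sum x K t) ^+ 2)%:E.
  have uE t : E t -> limn_einf (u ^~ t) = (rnorm (f t - partial_sum x K t) ^+ 2)%:E.
    move=> Et; apply: (cvg_limn_einf_sup _).1.
    apply: cvg_EFin; first by near=> n.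
    rewrite expr2; under eq_fun do rewrite /u /= expr2.
    have h : rnorm (S (i + n)%N t - partial_sum x K t) @[n --> \oo] -->
        rnorm (f t - partial_sum x K t).
      apply: cvg_rnorm; apply/cvg_rnormP => e e0.
      have /cvg_rnormP/(_ _ e0)[m _ hm] := fE t Et; exists m => // n /= mn.
      by rewrite opprB addrA subrK; apply: hm => /=; rewrite (leq_trans mn) // leq_addl.
    exact: cvgM.
  have mu n : measurable_fun D (u n) by exact: measurable_sq_EFin (mSS (F (i + n)%N) K).
  have mfK := measurable_sq_EFin (mfS K).
  rewrite /L2_normsq (ge0_negligible_integral mN mD mfK) //; last first.
    by move=> t _; rewrite lee_fin sqr_ge0.
  have -> : (\int[lebesgue_measure]_(t in D `\` N) (rnorm (f t - partial_sum x K t)%R ^+ 2)%:E =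
      \int[lebesgue_measure]_(t in E) limn_einf (u ^~ t))%E.
    by apply: eq_integral => t; rewrite inE => /uE ->.
  apply: le_trans (fatou _ mE _ _) _.
  - by move=> n; apply: measurable_funS (mu n) => // t [].
  - by move=> n t _; rewrite lee_fin sqr_ge0.
  apply: limn_einf_le => n.
  apply: (@le_trans _ _ (L2_normsq D (fun t => (S (i + n)%N t - partial_sum x K t)%R))).
    apply: ge0_subset_integral => //; first exact: mu.
      by move=> t _; rewrite lee_fin sqr_ge0.
    by move=> t [].
  have T1 := Ftail i _ (Fmono i (i + n)%N (leq_addr n i)); have T2 := Ftail i K FK.
  apply: (le_trans (y := (2%:E * L2_normsq D (fun t => (S (i + n)%N t - partial_sum x (F i) t)%R) +
      2%:E * L2_normsq D (fun t => (partial_sum x K t - partial_sum x (F i) t)%R))%E)).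
    apply: L2_normsq_le2 => //; try exact: mSS.
    move=> t _; rewrite -(subrKA (partial_sum x (F i) t)) [rnorm (partial_sum x K t - _)]rnormB_sym.
    exact: rnormD_sqr.
  apply: le_trans (leeD (lee_wpmul2l _ T1) (lee_wpmul2l _ T2)) _ => //.
  by rewrite -!EFinM -EFinD lee_fin le_eqVlt; apply/orP; left; apply/eqP; ring.
have small (e : R) : 0 < e -> exists i : nat, 4 * C1 * 8%:R ^- i < e.
  move=> e0; have h : 4 * C1 * (8%:R^-1) ^+ i @[i --> \oo] --> (4 * C1 * 0 : R).
    by apply: cvgMl_tmp; apply: cvg_expr; rewrite ger0_norm ?invr_ge0 // invf_lt1 // ltr1n.
  rewrite mulr0 in h; have /cvgrPdist_lt/(_ _ e0)[j _ /(_ j (leqnn j))] := h.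
  rewrite sub0r normrN exprVn => h1; exists j; apply: le_lt_trans h1; exact: ler_norm.
have fle K : (L2_normsq D f <= 2%:E * L2_normsq D (fun t => (f t - partial_sum x K t)%R) +
    2%:E * L2_normsq D (partial_sum x K))%E.
  apply: L2_normsq_le2 => // t _; rewrite -{1}[f t](subrK (partial_sum x K t)).
  exact: rnormD_sqr.
have Sle K : (L2_normsq D (partial_sum x K) <= 2%:E * L2_normsq D f +
    2%:E * L2_normsq D (fun t => (f t - partial_sum x K t)%R))%E.
  apply: L2_normsq_le2 => // t _; rewrite [rnorm (f t - _)]rnormB_sym.
  rewrite -{1}[partial_sum x K t](subrK (f t)) addrC; exact: rnormD_sqr.
have xE : (l2_normsq x) \is a fin_num.
  rewrite ge0_fin_numE //; have := @sum_fset_le_esum R (fun k => rnorm (x k) ^+ 2) fset0.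
  by rewrite big_nil; apply => k; exact: sqr_ge0.
have Fx (K : {fset int}) : ((\sum_(k <- K) rnorm (x k) ^+ 2)%:E <= l2_normsq x)%E.
  exact: (@sum_fset_le_esum R (fun k => rnorm (x k) ^+ 2) K (fun k => sqr_ge0 _)).
have upf : (L2_normsq D f <= (2 * C1)%:E * l2_normsq x)%E.
  apply/lee_addgt0Pr => e e0; have e20 : 0 < e / 2 by rewrite divr_gt0.
  have [i ie] := small _ e20.
  apply: le_trans (fle (F i)) _; rewrite addeC; apply: leeD.
    rewrite EFinM -muleA; apply: lee_wpmul2l => //.
    apply: le_trans (upper _ _) _; rewrite EFinM; apply: lee_wpmul2l => //.
    by rewrite lee_fin ltW.
  apply: le_trans (lee_wpmul2l _ (approx i _ (fsubset_refl _))) _ => //.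
  by rewrite -EFinM lee_fin; lra.
exists f; split.
- split.
    split=> //; apply: le_lt_trans upf _; rewrite -(fineK xE) -EFinM; exact: ltry.
  have FT : Filter (@summability.totally int).
    by case: (@summability.totally_filter int).
  apply: (ecvg0P FT _).2 => [K|e e0]; first exact: L2_normsq_ge0.
  have [i ie] := small _ e0; exists (F i) => // K /= FK.
  by apply: le_trans (approx i K FK) _; rewrite lee_fin ltW.
- rewrite muleC lee_pdivrMr ?mulr_gt0 // muleC.
  exact: upf.
apply: esum_le_fset => K; apply/lee_addgt0Pr => e e0.
have d0 : 0 < e / (2 * C2) by rewrite divr_gt0 // mulr_gt0.
have [i ie] := small _ d0.
apply: (@le_trans _ _ (\sum_(k <- (K `|` F i)%fset) rnorm (x k) ^+ 2)%:E).
  rewrite lee_fin [leRHS](big_fsetID _ (mem K)) /=.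
  have -> : [fset k in (K `|` F i)%fset | k \in K]%fset = K.
    by apply/fsetP => k; rewrite !inE /= andbC; case: (k \in K).
  by rewrite lerDl sumr_ge0 // => k _; rewrite sqr_ge0.
apply: le_trans (lower _ _) _.
apply: le_trans (lee_wpmul2l _ (Sle _)) _; first by rewrite lee_fin ltW.
rewrite ge0_muleDr; [|by rewrite mule_ge0 ?L2_normsq_ge0|by rewrite mule_ge0 ?L2_normsq_ge0].
rewrite !muleA -!EFinM [C2 * 2]mulrC; apply: leeD => //.
apply: le_trans (lee_wpmul2l _ (approx i _ (fsubsetUr _ _))) _.
  by rewrite lee_fin mulr_ge0 // ltW.
move: ie; rewrite ltr_pdivlMr ?mulr_gt0 // -EFinM lee_fin [leLHS]mulrC => /ltW.
Unshelve. all: by end_near.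
Qed.

End Assembly.

(** * Density *)

Section Counting.
Variable R : realType.

Lemma counting_le (S : set int) (n : nat) :
  (forall F : {fset int}, [set` F] `<=` S -> (#|` F| <= n)%N) ->
  (counting S <= n%:R%:E :> \bar R)%E.
Proof.
move=> h; rewrite /counting; case: asboolP => [fS|iS].
  by rewrite lee_fin ler_nat; apply: h; rewrite fset_setK.
have [F FS Fn] := infinite_set_fset n.+1 iS.
by have := leq_trans Fn (h F FS); rewrite ltnn.
Qed.

Lemma card_le_counting (S : set int) (F : {fset int}) :
  [set` F] `<=` S -> ((#|` F|)%:R%:E <= counting S :> \bar R)%E.
Proof.
move=> FS; rewrite /counting; case: asboolP => [fS|_]; last by rewrite leey.
rewrite lee_fin ler_nat; apply: fsubset_leq_card; apply/fsubsetP => k kF.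
by rewrite in_fset_set // inE; exact: FS.
Qed.

End Counting.

Section Density.
Variables (R : realType) (omega : int -> R).

(** Half-open intervals tile, so these bounds add up without counting endpoints twice. *)
Definition half_open_bound (s : R) (M : nat) := forall (F : {fset int}) (c : R),
  (forall k, k \in F -> c <= omega k < c + s) -> (#|` F| <= M)%N.

Lemma half_open_bound_mul r M n : 0 <= r -> half_open_bound r M ->
  half_open_bound (n%:R * r) (n * M).
Proof.
move=> r0 hM; elim: n => [|n IH] F c Fc.
  have [->|[k kF]] := fset_0Vmem F; first by rewrite cardfs0.
  by have := Fc k kF; rewrite mul0r addr0 => /andP[h1 h2]; lra.
pose B := [fset k in F | (omega k < c + n%:R * r)%R]%fset.
rewrite -(cardfsID B) mulSn addnC; apply: leq_add.
  apply: (hM _ (c + n%:R * r)) => k; rewrite !inE /= => /andP[+ kF].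
  rewrite kF /= -leNgt => ->; have := Fc k kF.
  by rewrite -(natr1 n) mulrDl mul1r addrA => /andP[].
apply: (IH _ c) => k; rewrite !inE /= => /andP[kF /andP[_ ->]].
by have /andP[-> _] := Fc k kF.
Qed.

(** A closed interval of length s fits into floor(s / r) + 1 consecutive half-open ones of length r,
    even when s is a multiple of r. *)
Lemma closed_count r s M (F : {fset int}) c : 0 < r -> 0 <= s -> half_open_bound r M ->
    (forall k, k \in F -> c <= omega k <= c + s) ->
  (#|` F| <= (Num.truncn (s / r)).+1 * M)%N.
Proof.
move=> r0 s0 hM Fc; apply: (half_open_bound_mul (ltW r0) hM (c := c)) => k /Fc /andP[-> h] /=.
apply: le_lt_trans h _; rewrite ltrD2l -ltr_pdivrMr //; exact: truncnS_gt.
Qed.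

Lemma max_terms_le (r : R) (n : nat) :
    (forall (F : {fset int}) c, (forall k, k \in F -> c <= omega k <= c + r) -> (#|` F| <= n)%N) ->
  (max_terms omega r <= n%:R%:E)%E.
Proof.
move=> h; apply: ub_ereal_sup => _ [b1 [b2 [c ->]]]; apply: counting_le => F FS.
apply: (h F c) => k kF; have := FS k kF; rewrite /bounded_itv /= itv_boundlr /=.
move=> /andP[h1 h2]; apply/andP; split.
  by case: (b1) h1 => //= /ltW.
by case: (b2) h2 => //= /ltW.
Qed.

Lemma card_le_max_terms (r : R) (F : {fset int}) c :
  (forall k, k \in F -> c <= omega k < c + r) -> ((#|` F|)%:R%:E <= max_terms omega r)%E.
Proof.
move=> Fc; apply: le_trans (ereal_sup_ubound _); last by exists true, true, c.
by apply: card_le_counting => k kF; rewrite /bounded_itv /= in_itv /=; exact: Fc.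
Qed.

Hypothesis hgap : gap_condition omega.

Lemma gap_separated : exists2 gam : R, 0 < gam &
  forall k l, k != l -> gam <= `|omega k - omega l|.
Proof.
exists (inf [set `|omega p.1 - omega p.2| | p in [set p : int * int | p.1 != p.2]]) => //.
move=> k l kl; apply: ge_inf; first by exists 0 => _ [p _ <-].
by exists (k, l).
Qed.

Lemma max_terms_fin (r : R) : 0 < r ->
  (0 <= max_terms omega r)%E /\ max_terms omega r \is a fin_num.
Proof.
move=> r0; have p0 : (0 <= max_terms omega r)%E.
  by have := @card_le_max_terms r fset0 0; rewrite cardfs0; apply.
split=> //; rewrite ge0_fin_numE //.
have [gam g0 sep] := gap_separated.
have h1 : half_open_bound gam 1.
  move=> F c Fc; have [->|[k kF]] := fset_0Vmem F; first by rewrite cardfs0.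
  suff -> : F = [fset k]%fset by rewrite cardfs1.
  apply/fsetP => l; rewrite inE; apply/idP/eqP => [lF|->//].
  apply/eqP/negPn/negP => /sep; apply/negP; rewrite -ltNge ltr_norml.
  by have := Fc k kF; have := Fc l lF => /andP[? ?] /andP[? ?]; apply/andP; split; lra.
apply: le_lt_trans (@max_terms_le r ((Num.truncn (r / gam)).+1 * 1) _) _; last by rewrite ltry.
by move=> F c Fc; apply: (closed_count g0 (ltW r0) h1 Fc).
Qed.

(** Under the gap condition the supremum is finite for r > 0, so that [fine] loses nothing there. *)
Definition count_max (r : R) : R := fine (max_terms omega r).

Lemma max_termsE r : 0 < r -> max_terms omega r = (count_max r)%:E.
Proof. by move=> r0; rewrite fineK //; case: (max_terms_fin r0). Qed.

Lemma count_max_ge0 r : 0 < r -> 0 <= count_max r.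
Proof. by move=> r0; rewrite fine_ge0 //; case: (max_terms_fin r0). Qed.

Lemma count_max_bound r : 0 < r -> half_open_bound r (Num.truncn (count_max r)).
Proof.
move=> r0 F c /card_le_max_terms; rewrite max_termsE // lee_fin => h.
by rewrite truncn_ge_nat ?count_max_ge0.
Qed.

Lemma count_max_le r s : 0 < r -> 0 < s -> count_max s <= (s / r + 1) * count_max r.
Proof.
move=> r0 s0.
apply: (@le_trans _ _ ((Num.truncn (s / r)).+1 * Num.truncn (count_max r))%:R).
  rewrite -lee_fin -max_termsE //; apply: max_terms_le => F c Fc.
  exact: closed_count r0 (ltW s0) (count_max_bound r0) Fc.
have sr : 0 <= s / r by rewrite divr_ge0 // ltW.
rewrite natrM; apply: ler_pM => //.
  by rewrite -natr1 lerD2r; case/andP: (truncn_itv sr).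
by case/andP: (truncn_itv (count_max_ge0 r0)).
Qed.

(** A Fekete argument: dividing [count_max_le] by s shows that the limit exists and is the infimum
    of count_max r / r. Part (a) uses that the infimum is approached at a finite r, part (b) that it
    bounds every ratio from below. *)
Lemma polya_densityP : exists d : R, [/\ polya_upper_density omega = d%:E,
  forall r, 0 < r -> d <= count_max r / r &
  forall e, 0 < e -> exists2 r, 0 < r & count_max r / r < d + e].
Proof.
pose A := [set count_max r / r | r in [set r : R | 0 < r]].
have A0 : has_inf A.
  split; first by exists (count_max 1 / 1), 1 => //=.
  by exists 0 => _ [r /= r0 <-]; rewrite divr_ge0 ?count_max_ge0 // ltW.
have dle r : 0 < r -> inf A <= count_max r / r.
  by move=> r0; apply: ge_inf; [exact: A0.2 | exists r].
have adh e : 0 < e -> exists2 r, 0 < r & count_max r / r < inf A + e.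
  by move=> e0; have [_ [r /= r0 <-] h] := inf_adherent e0 A0; exists r.
exists (inf A); split=> //.
apply: cvg_lim => //; apply/fine_cvgP; split.
  near=> r; have r0 : 0 < r by near: r; exact: nbhs_pinfty_gt.
  by rewrite max_termsE.
apply/cvgrPdist_le => e e0; have e20 : 0 < e / 2 by rewrite divr_gt0.
have [r0 r00 hr0] := adh _ e20; have c0 := count_max_ge0 r00.
near=> r.
have r_gt0 : 0 < r by near: r; exact: nbhs_pinfty_gt.
have rbig : 2 * count_max r0 / e <= r by near: r; apply: nbhs_pinfty_ge; rewrite num_real.
rewrite /= max_termsE // -EFinM /= mulrC distrC ger0_norm ?subr_ge0 ?dle // lerBlDl.
apply: (@le_trans _ _ ((r / r0 + 1) * count_max r0 / r)).
  by rewrite ler_wpM2r ?invr_ge0 ?(ltW r_gt0) // count_max_le.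
have -> : (r / r0 + 1) * count_max r0 / r = count_max r0 / r0 + count_max r0 / r.
  by field; rewrite !gt_eqF.
have : count_max r0 / r <= e / 2.
  rewrite ler_pdivrMr //; move: rbig; rewrite ler_pdivrMr //; lra.
by lra.
Unshelve. all: by end_near.
Qed.

End Density.

(** * Part (a): intervals longer than 2 pi times the density *)

Section Sufficiency.
Variables (R : realType) (H : completeNormedModType R[i]) (dot : {dot H for Num.conj}).
Hypothesis hdot : forall v : H, dot v v = `|v| ^+ 2.
Variables (omega : int -> R) (hgap : gap_condition omega).
Variables (U : int -> H) (hU : forall k, `|U k| = 1).

Lemma rnorm_unit k : rnorm (U k) = 1.
Proof. by rewrite /rnorm hU. Qed.

Lemma sum_unit_coefficients (x : int -> R[i]) (F : {fset int}) :
  \sum_(k : F) rnorm (x (val k) *: U (val k)) ^+ 2 = \sum_(k <- F) rnorm (x k) ^+ 2.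
Proof.
rewrite big_seq_fsetE /=; apply: eq_bigr => k _.
by rewrite rnormZ rnorm_unit mulr1.
Qed.

Lemma card_fset_sub (F : {fset int}) (P : pred int) (M : nat) :
  (forall G : {fset int}, (forall k, k \in G -> P k) -> (#|` G| <= M)%N) ->
  (#|[pred k : F | P (val k)]| <= M)%N.
Proof.
move=> h; apply: leq_trans (h [fset k in F | P k]%fset _); last first.
  by move=> k; rewrite !inE /= => /andP[].
rewrite cardE -(size_map val); apply: uniq_leq_size.
  by rewrite map_inj_uniq ?enum_uniq //; exact: val_inj.
move=> k /mapP[k' + ->]; rewrite mem_enum inE => Pk.
by rewrite !inE /= Pk andbT; exact: valP.
Qed.

Lemma sufficiency (a b : R) (l r : bool) : a < b ->
  ((2 * pi)%:E * polya_upper_density omega < (b - a)%:E)%E ->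
  estimates omega U (bounded_itv l r a b).
Proof.
move=> ab; have pi0 := pi_gt0 R; have pi20 : 0 < 2 * pi :> R by rewrite mulr_gt0.
have [d [-> _ dP]] := polya_densityP hgap.
rewrite -EFinM lte_fin => dl.
(* The strict inequality is witnessed at one finite length s, which provides the pair s, M for the
   lower estimate. *)
have e0 : 0 < (b - a) / (2 * pi) - d by rewrite subr_gt0 ltr_pdivlMr // mulrC.
have [s s0 sd] := dP _ e0; rewrite addrC subrK in sd.
have [gam g0 sep] := gap_separated hgap.
pose M := Num.truncn (count_max omega s).
have Ms : 2 * pi * M%:R / s < b - a.
  have := truncn_itv (count_max_ge0 hgap s0); rewrite -/M => /andP[Mc _].
  rewrite -mulrA -ltr_pdivlMl // [ltRHS]mulrC; apply: le_lt_trans sd.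
  by rewrite ler_wpM2r // invr_ge0 ltW.
have [C1 C10 up] := trig_sum_upper hdot ab g0.
have [C2 C20 low] := trig_sum_lower hdot ab g0 s0 Ms.
have sepF (F : {fset int}) (k l' : F) : k != l' -> gam <= `|omega (val k) - omega (val l')|.
  by move=> kl; apply: sep; rewrite (inj_eq val_inj).
have itvE (x : int -> R[i]) F : L2_normsq (bounded_itv l r a b) (partial_sum omega U x F) =
    L2_normsq `[a, b[ (partial_sum omega U x F).
  apply: L2_normsq_itv; have [L _ SL] := partial_sum_lipschitz omega U x F.
  exact: lipschitz_measurable_sq SL.
apply: (estimates_intro C10 C20) => x F; rewrite itvE partial_sum_trig -sum_unit_coefficients.
  by apply: up => k l'; exact: sepF.
apply: low => [k l'|y]; first exact: sepF.
apply: (@card_fset_sub F (fun k => y <= omega k < y + s)) => G hG.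
exact: (count_max_bound hgap s0 hG).
Qed.

End Sufficiency.

(** * Finite dimension *)

Lemma exists_kernel (K : fieldType) (I J : finType) (A : I -> J -> K) : (#|J| < #|I|)%N ->
  exists x : I -> K, (exists i, x i != 0) /\ forall j, \sum_i x i * A i j = 0.
Proof.
move=> JI; pose M := \matrix_(i < #|I|, j < #|J|) A (enum_val i) (enum_val j).
have : kermx M != 0.
  rewrite -mxrank_eq0 mxrank_ker subn_eq0 -ltnNge.
  exact: leq_ltn_trans (rank_leq_col M) JI.
rewrite -nz_row_eq0 => v0; pose v := nz_row (kermx M).
have vM : v *m M = 0 by apply/sub_kermxP; exact: nz_row_sub.
exists (fun i => v 0 (enum_rank i)); split.
  have /rV0Pn[i vi] := v0; exists (enum_val i); by rewrite enum_valK.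
move=> j; have /matrixP/(_ 0 (enum_rank j)) := vM; rewrite !mxE; apply: etrans.
rewrite (reindex (@enum_val I I)) /=; last by apply: onW_bij; exact: enum_val_bij.
by apply: eq_bigr => i _; rewrite !mxE enum_valK enum_rankK.
Qed.

Section BoxWindow.
Variables (R : realType) (H : normedModType R[i]) (dot : {dot H for Num.conj}).
Hypothesis hdot : forall v : H, dot v v = `|v| ^+ 2.

(** The convolution of the indicators of [0, P) and [0, Q): a trapezoidal window, whose plateau is
    used below. *)
Definition box_count (P Q m : nat) : nat := (\sum_(p < P) \sum_(q < Q) (p + q == m))%N.

Lemma box_count_ge P Q m : (Q.-1 <= m < P)%N -> (Q <= box_count P Q m)%N.
Proof.
move=> /andP[Qm mP]; rewrite /box_count exchange_big /= -[X in (X <= _)%N]card_ord -sum1_card.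
apply: leq_sum => q _; have qm : (q <= m)%N.
  by apply: leq_trans Qm; rewrite -ltnS prednK //; apply: leq_ltn_trans (ltn_ord q).
have mqP : (m - q < P)%N by apply: leq_ltn_trans mP; exact: leq_subr.
by rewrite (bigD1 (Ordinal mqP)) //= subnK // eqxx.
Qed.

Lemma box_sum_count (W : lmodType R[i]) P Q N (F : nat -> W) : (P + Q <= N)%N ->
  \sum_(p < P) \sum_(q < Q) F (p + q)%N = \sum_(m < N) (box_count P Q m)%:R *: F m.
Proof.
move=> PQN.
under [RHS]eq_bigr => m _.
  rewrite /box_count natr_sum scaler_suml.
  under eq_bigr do rewrite natr_sum scaler_suml.
  over.
rewrite [RHS]exchange_big /=; apply: eq_bigr => p _.
rewrite [RHS]exchange_big /=; apply: eq_bigr => q _.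
have pqN : (p + q < N)%N by apply: leq_trans PQN; rewrite -addSn leq_add // ltnW.
rewrite (bigD1 (Ordinal pqN)) //= eqxx scale1r big1 ?addr0 // => m.
by rewrite -val_eqE /= eq_sym => /negbTE ->; rewrite scale0r.
Qed.

Lemma parseval N (y : nat -> H) :
  \sum_(j < N) rnorm (\sum_(m < N) (circ N j%:R ^+ m)^*%C *: y m) ^+ 2 =
  N%:R * \sum_(m < N) rnorm (y m) ^+ 2.
Proof.
apply: (@complexI R); rewrite rmorph_sum rmorphM rmorph_sum rmorph_nat /=.
under eq_bigr => j _.
  rewrite (rnorm_sqr_sum hdot (fun m : 'I_N => (circ N j%:R ^+ m)^*%C) (fun m : 'I_N => y m)).
  over.
rewrite exchange_big mulr_sumr /=; apply: eq_bigr => m _.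
rewrite exchange_big /=.
have E (m' : 'I_N) : \sum_(j < N) (circ N j%:R ^+ m)^*%C * ((circ N j%:R ^+ m')^*)^*%C *
    dot (y m) (y m') = (N *+ (m' == m))%:R * dot (y m) (y m').
  by rewrite -mulr_suml; under eq_bigr do rewrite conjcK mulrC; rewrite dft_orth.
under eq_bigr do rewrite E.
rewrite (bigD1 m) //= eqxx mulr1n big1 ?addr0 -?(dot_rnorm hdot) // => m'.
by rewrite -val_eqE /= => /negbTE ->; rewrite mulr0n mul0r.
Qed.

(** The two terms stand for the two nearest multiples of 2 pi; keeping both avoids deciding which
    one is closer when the bound is summed. *)
Lemma rnorm_expiB1_ge2 (t : R) : 0 < t < 2 * pi ->
  rnorm (expi t - 1) ^- 2 <= 4 * (t ^- 2 + (2 * pi - t) ^- 2).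
Proof.
move=> /andP[t0 t2].
suff h (x : R) : 0 < x -> x <= pi -> rnorm (expi x - 1) ^- 2 <= 4 * x ^- 2.
  have [tp|tp] := leP t pi.
    by apply: le_trans (h t t0 tp) _; rewrite ler_wpM2l // lerDl invr_ge0 sqr_ge0.
  have -> : rnorm (expi t - 1) = rnorm (expi (2 * pi - t) - 1).
    by rewrite expiB expi2pi div1r -expiNV expiN rnorm_conjB1.
  have x0 : 0 < 2 * pi - t by lra.
  have xp : 2 * pi - t <= pi by lra.
  by apply: le_trans (h _ x0 xp) _; rewrite ler_wpM2l // lerDr invr_ge0 sqr_ge0.
move=> x0 xp; have := @rnorm_expiB1_ge R x; rewrite gtr0_norm // => /(_ xp) hx.
have x20 : 0 < x / 2 by rewrite divr_gt0.
have c0 := lt_le_trans x20 hx.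
have -> : 4 * x ^- 2 = (x / 2) ^- 2 :> R by field; rewrite gt_eqF.
by rewrite lef_pV2 ?posrE ?exprn_gt0 // lerXn2r // nnegrE ltW.
Qed.

Lemma box_kernel_le (P Q : nat) (t : R) : 0 < t < 2 * pi ->
  rnorm ((\sum_(p < P) expi t ^+ p) * (\sum_(q < Q) expi t ^+ q)) <=
  16 * (t ^- 2 + (2 * pi - t) ^- 2).
Proof.
move=> tp; have c0 : 0 < rnorm (expi t - 1).
  rewrite lt_neqAle rnorm_ge0 andbT eq_sym rnorm_eq0 subr_eq0 expi_neq1 //.
  by case/andP: tp => t0 t2; rewrite gtr0_norm // t0.
have h1 := rnorm_geom_mul_le P (rnorm_expi t); have h2 := rnorm_geom_mul_le Q (rnorm_expi t).
have h3 := rnorm_expiB1_ge2 tp.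
rewrite rnormM; have := rnorm_ge0 (\sum_(p < P) expi t ^+ p); have := rnorm_ge0 (\sum_(p < Q) expi t ^+ p).
move: (rnorm (expi t - 1)) (rnorm (\sum_(p < P) _)) (rnorm (\sum_(p < Q) _)) c0 h1 h2 h3.
move=> c D D' c0 h1 h2 h3 D'0 D0.
apply: (@le_trans _ _ (4 * c ^- 2)); last by lra.
rewrite ler_pdivlMr ?exprn_gt0 //.
have -> : D * D' * c ^+ 2 = (c * D) * (c * D') by ring.
have -> : 4 = 2 * 2 :> R by ring.
by apply: ler_pM; rewrite ?mulr_ge0 // ltW.
Qed.

End BoxWindow.

Lemma natr_dist_ge1 (R : realType) (i j : nat) : i != j -> 1 <= `|i%:R - j%:R| :> R.
Proof.
wlog ij : i j / (i < j)%N.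
  move=> h; rewrite neq_ltn => /orP[l|l]; first by apply: h; rewrite ?ltn_eqF.
  by rewrite distrC; apply: h; rewrite ?ltn_eqF.
by move=> _; rewrite distrC -natrB 1?ltnW // normr_nat ler1n subn_gt0.
Qed.

Section WindowEnergy.
Variables (R : realType) (H : normedModType R[i]) (dot : {dot H for Num.conj}).
Hypothesis hdot : forall v : H, dot v v = `|v| ^+ 2.

(** The discrete Fourier transform at j of the windowed sequence m -> [box_count P Q m] e^(i m x),
    in factored form. *)
Definition box_kernel (P Q N : nat) (x : R) (j : nat) : R[i] :=
  (\sum_(p < P) expi (x - 2 * pi / N%:R * j%:R) ^+ p) *
  (\sum_(q < Q) expi (x - 2 * pi / N%:R * j%:R) ^+ q).

(** As v >= h B, v is at least the mean of v and h B; this brings the kernel bound into the form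
    summed by [separated_sum_le]. *)
Lemma inv_sqr_shift_le (B v h : R) : 0 < B -> 0 < h -> h * B <= v ->
  v ^- 2 <= 4 / h ^+ 2 * (B + `|v / h|) ^- 2.
Proof.
move=> B0 h0 hv; have v0 : 0 < v by apply: lt_le_trans hv; rewrite mulr_gt0.
have vB : B <= v / h by rewrite ler_pdivlMr // mulrC.
have vh0 : 0 < v / h by rewrite divr_gt0.
rewrite (gtr0_norm vh0); have Bv : 0 < B + v / h by rewrite addr_gt0.
have -> : 4 / h ^+ 2 * (B + v / h) ^- 2 = (h / 2 * (B + v / h)) ^- 2.
  by move: (v / h) Bv => x Bx; field; rewrite !gt_eqF.
have e : h / 2 * (B + v / h) = (h * B + v) / 2 by field; rewrite gt_eqF.
have hB0 : 0 < h * B by rewrite mulr_gt0.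
rewrite e lef_pV2 ?posrE ?exprn_gt0 //; last by lra.
rewrite lerXn2r ?nnegrE //; lra.
Qed.

(* By Parseval on Z/N the energy of the smoothed samples is that of their
   transform, which vanishes for j < w; for the other j the frequencies are at
   distance at least B, and the kernel decays quadratically. *)
Lemma window_energy (I : finType) (u : I -> R) (V : I -> H) (gam B h : R) (P Q N w : nat) :
    0 < gam -> 0 < B -> 0 < h -> (0 < N)%N -> (P + Q <= N)%N ->
    (forall k l, k != l -> gam <= `|u k - u l|) ->
    (forall k, B <= u k) -> (forall k, h * (u k + B) <= 2 * pi / N%:R * w%:R) ->
    (forall j, (j < w)%N -> \sum_k box_kernel P Q N (h * u k) j *: V k = 0) ->
  Q%:R ^+ 2 * \sum_(Q.-1 <= m < P) rnorm (\sum_k expi (h * u k) ^+ m *: V k) ^+ 2 <=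
    (256%:R / h ^+ 2) ^+ 2 * (B ^- 2 + (gam * B)^-1) *
    (B ^- 2 + (2 * pi / (N%:R * h) * B)^-1) / N%:R * \sum_k rnorm (V k) ^+ 2.
Proof.
move=> g0 B0 h0 N0 PQN sep uB uw ker.
have pi0 := pi_gt0 R; have N0' : 0 < N%:R :> R by rewrite ltr0n.
(* The spacing of the transform points, in the units of the frequencies u. *)
pose D := 2 * pi / (N%:R * h); have D0 : 0 < D by rewrite divr_gt0 ?mulr_gt0.
have hD : h * D = 2 * pi / N%:R by rewrite /D; move: (pi) => p; field; rewrite !gt_eqF.
have hDN : h * D * N%:R = 2 * pi by rewrite hD divfK // gt_eqF.
pose X m := \sum_k expi (h * u k) ^+ m *: V k.
pose c : R := 64%:R / h ^+ 2; have c0 : 0 < c by rewrite divr_gt0 ?exprn_gt0.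
pose be (v : R) := (B + `|v|) ^- 2.
have be0 v : 0 <= be v by rewrite invr_ge0 exprn_ge0 // addr_ge0 // ltW.
pose K k j := rnorm (box_kernel P Q N (h * u k) j).
(* For j >= w the frequency u k lies at least B below the point D j, by the choice of w, and at
   least B above its translate D j - D N, because u k >= B: the distance is large both ways round
   the circle. *)
have KB k (j : nat) : (w <= j)%N -> (j < N)%N ->
    K k j <= c * (be (D * j%:R - u k) + be (D * N%:R - (D * j%:R - u k))).
  move=> wj jN; pose t := 2 * pi / N%:R * j%:R - h * u k.
  have wj' : w%:R <= j%:R :> R by rewrite ler_nat.
  have jN' : j%:R <= N%:R :> R by rewrite ler_nat ltnW.
  have pN : 0 < 2 * pi / N%:R :> R by rewrite divr_gt0 ?mulr_gt0.
  have t1 : h * B <= t.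
    by have := uw k; have := ler_wpM2l (ltW pN) wj'; rewrite /t; lra.
  have t2 : h * B <= 2 * pi - t.
    have := ler_wpM2l (ltW pN) jN'; rewrite (divfK (lt0r_neq0 N0')).
    by have := ler_wpM2l (ltW h0) (uB k); rewrite /t; lra.
  have hB0 : 0 < h * B by rewrite mulr_gt0.
  have ti : 0 < 2 * pi - t < 2 * pi by apply/andP; split; lra.
  have E : expi (h * u k - 2 * pi / N%:R * j%:R) = expi (2 * pi - t) :> R[i].
    by rewrite [RHS]expiB expi2pi div1r -expiNV /t opprB.
  rewrite /K /box_kernel E; apply: le_trans (box_kernel_le P Q ti) _.
  have -> : 2 * pi - (2 * pi - t) = t by ring.
  have s1 := inv_sqr_shift_le B0 h0 t1; have s2 := inv_sqr_shift_le B0 h0 t2.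
  have e1 : t / h = D * j%:R - u k.
    by rewrite /t -hD; field; rewrite gt_eqF.
  have e2 : (2 * pi - t) / h = D * N%:R - (D * j%:R - u k).
    by rewrite -e1 -hDN; field; rewrite gt_eqF.
  rewrite e1 in s1; rewrite e2 in s2.
  have -> : c = 16 * (4 / h ^+ 2) by rewrite /c; field; rewrite gt_eqF.
  by rewrite -mulrA ler_pM2l // [leRHS]mulrDr addrC lerD.
have K0 k j : 0 <= K k j by exact: rnorm_ge0.
(* Row sums run over the frequencies, separated by gam, and column sums over the transform points,
   separated by D. The factor 4 counts two directions, each with the 2 of [separated_sum_le]. *)
pose T1 := 4 * c * (B ^- 2 + (gam * B)^-1).
pose T2 := 4 * c * (B ^- 2 + (D * B)^-1).
have row j : (w <= j)%N -> (j < N)%N -> \sum_k K k j <= T1.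
  move=> wj jN; apply: le_trans (ler_sum _ (fun k _ => KB k j wj jN)) _.
  rewrite -mulr_sumr big_split /= /T1 -mulrA mulrCA ler_pM2l //.
  have S1 := @separated_sum_le R I (fun k => D * j%:R - u k) B gam B0 g0.
  have S2 := @separated_sum_le R I (fun k => D * N%:R - (D * j%:R - u k)) B gam B0 g0.
  have {}S1 := S1 _; have {}S2 := S2 _.
  rewrite /be; apply: le_trans (lerD (S1 _) (S2 _)) _.
  - move=> k l kl; have -> : D * j%:R - u k - (D * j%:R - u l) = u l - u k by ring.
    by rewrite distrC sep.
  - move=> k l kl; have -> : D * N%:R - (D * j%:R - u k) - (D * N%:R - (D * j%:R - u l)) = u k - u l by ring.
    exact: sep.
  lra.
have col k : \sum_(j < N | (w <= j)%N) K k j <= T2.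
  have nat_sep (i j : 'I_N) : i != j -> D <= `|D * i%:R - D * j%:R|.
    move=> ij; rewrite -mulrBr normrM gtr0_norm // ler_peMr ?(ltW D0) //; apply: natr_dist_ge1; exact: ij.
  apply: (@le_trans _ _ (\sum_(j < N | (w <= j)%N)
      c * (be (D * j%:R - u k) + be (D * N%:R - (D * j%:R - u k))))).
    by apply: ler_sum => j wj; apply: KB.
  apply: (@le_trans _ _ (\sum_(j < N)
      c * (be (D * j%:R - u k) + be (D * N%:R - (D * j%:R - u k))))).
    rewrite [leRHS](bigID (fun j : 'I_N => (w <= j)%N)) /= lerDl sumr_ge0 // => j _.
    by rewrite mulr_ge0 ?addr_ge0 // ltW.
  rewrite -mulr_sumr big_split /= /T2 -mulrA mulrCA ler_pM2l //.
  have S1 := @separated_sum_le R 'I_N (fun j => D * j%:R - u k) B D B0 D0.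
  have S2 := @separated_sum_le R 'I_N (fun j => D * N%:R - (D * j%:R - u k)) B D B0 D0.
  have {}S1 := S1 _; have {}S2 := S2 _.
  rewrite /be; apply: le_trans (lerD (S1 _) (S2 _)) _.
  - move=> i j ij; have -> : D * i%:R - u k - (D * j%:R - u k) = D * i%:R - D * j%:R by ring.
    exact: nat_sep.
  - move=> i j ij; have -> : D * N%:R - (D * i%:R - u k) - (D * N%:R - (D * j%:R - u k)) = D * j%:R - D * i%:R by ring.
    by apply: nat_sep; rewrite eq_sym.
  lra.
pose Y (j : 'I_N) := \sum_(m < N) (circ N j%:R ^+ m)^*%C *: ((box_count P Q m)%:R *: X m).
have YE j : Y j = \sum_k box_kernel P Q N (h * u k) j *: V k.
  pose F m := (circ N j%:R ^+ m)^*%C *: X m.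
  have -> : Y j = \sum_(p < P) \sum_(q < Q) F (p + q)%N.
    by rewrite (box_sum_count F PQN); apply: eq_bigr => m _; rewrite /F !scalerA mulrC.
  have FE m : F m = \sum_k expi (h * u k - 2 * pi / N%:R * j%:R) ^+ m *: V k.
    rewrite /F /X scaler_sumr; apply: eq_bigr => k _; rewrite scalerA; congr (_ *: _).
    have cX (z : R[i]) : (z ^+ m)^*%C = z^*%C ^+ m by rewrite rmorphXn.
    by rewrite cX mulrC -exprMn /circ -expiN -expiD.
  under eq_bigr do under eq_bigr do rewrite FE.
  under eq_bigr do rewrite exchange_big /=.
  rewrite exchange_big /=; apply: eq_bigr => k _.
  rewrite /box_kernel mulr_suml scaler_suml; apply: eq_bigr => p _.
  rewrite mulr_sumr scaler_suml; apply: eq_bigr => q _; by rewrite exprD.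
have T0 (y : R) : 0 < y -> 0 <= 4 * c * (B ^- 2 + (y * B)^-1).
  move=> y0; apply: mulr_ge0; first by rewrite mulr_ge0 // ltW.
  by rewrite addr_ge0 // invr_ge0 ?sqr_ge0 // mulr_ge0 // ltW.
have T10 : 0 <= T1 by exact: T0.
have YB (j : 'I_N) : (w <= j)%N -> rnorm (Y j) ^+ 2 <= T1 * \sum_k K k j * rnorm (V k) ^+ 2.
  move=> wj; rewrite YE.
  apply: (@le_trans _ _ ((\sum_k K k j * rnorm (V k)) ^+ 2)).
    rewrite lerXn2r ?nnegrE ?rnorm_ge0 ?sumr_ge0 //.
      by move=> k _; rewrite mulr_ge0 ?rnorm_ge0.
    by apply: le_trans (rnorm_sum _ _ _) _; apply: ler_sum => k _; rewrite rnormZ.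
  apply: le_trans (weighted_sqr_le (fun k => rnorm (V k)) (fun k => K0 k j)) _.
  by rewrite ler_wpM2r ?row // sumr_ge0 // => k _; rewrite mulr_ge0 ?sqr_ge0.
have PA := parseval hdot N (fun m => (box_count P Q m)%:R *: X m).
rewrite -/Y in PA.
have lo : Q%:R ^+ 2 * \sum_(Q.-1 <= m < P) rnorm (X m) ^+ 2 <=
    \sum_(m < N) rnorm ((box_count P Q m)%:R *: X m) ^+ 2.
  rewrite mulr_sumr; apply: (@le_trans _ _ (\sum_(Q.-1 <= m < P)
      rnorm ((box_count P Q m)%:R *: X m) ^+ 2)).
    rewrite big_nat [leRHS]big_nat; apply: ler_sum => m Qm.
    rewrite rnormZ rnorm_nat exprMn ler_wpM2r ?sqr_ge0 // lerXn2r ?nnegrE ?ler0n // ler_nat.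
    exact: box_count_ge.
  have PN : (P <= N)%N by apply: leq_trans PQN; exact: leq_addr.
  rewrite (big_nat_widenl _ 0) // (big_nat_widen _ _ N) // big_mkord.
  rewrite [leRHS](bigID (fun m : 'I_N => (Q.-1 <= m)%N && (m < P)%N)) /= lerDl sumr_ge0 // => m _.
  exact: sqr_ge0.
have hi : \sum_(j < N) rnorm (Y j) ^+ 2 <= T1 * (T2 * \sum_k rnorm (V k) ^+ 2).
  rewrite (bigID (fun j : 'I_N => (w <= j)%N)) /= [X in _ + X]big1 ?addr0; last first.
    by move=> j; rewrite -ltnNge => jw; rewrite YE ker // rnorm0 expr0n.
  apply: le_trans (ler_sum _ (fun j wj => YB j wj)) _.
  rewrite -mulr_sumr ler_wpM2l // exchange_big /= mulr_sumr; apply: ler_sum => k _.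
  by rewrite -mulr_suml ler_wpM2r ?sqr_ge0.
rewrite -/D -/X; apply: le_trans lo _.
rewrite mulrAC ler_pdivlMr // [leLHS]mulrC -PA; apply: le_trans hi _.
rewrite le_eqVlt; apply/orP; left; apply/eqP; rewrite /T1 /T2 /c.
move: (\sum_k rnorm (V k) ^+ 2) => s; rewrite mulrA; congr (_ * s).
move: (B ^- 2 + _) (B ^- 2 + _) => x y; field; rewrite gt_eqF //.
Qed.

End WindowEnergy.

Section FiniteEstimate.
Variables (R : realType) (H : completeNormedModType R[i]).
Variables (omega : int -> R) (U : int -> H).

(** The estimates speak of an L^2 sum f of the family extended by 0. The partial sums are constant
    beyond F, so f is at L^2 distance 0 from the finite sum, and the squared triangle inequality
    transfers the bound with a factor 2. *)
Lemma estimates_finite_lower (l r : bool) (a b : R) : estimates omega U (bounded_itv l r a b) ->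
  exists2 c : R, 0 < c & forall (x : int -> R[i]) (F : {fset int}),
    ((\sum_(k <- F) rnorm (x k) ^+ 2)%:E <=
      c%:E * L2_normsq (bounded_itv l r a b) (partial_sum omega U x F))%E.
Proof.
move=> [c1 [c2 [c10 c20 est]]]; exists (2 * c2); first by rewrite mulr_gt0.
move=> x F; pose y k := if k \in F then x k else 0.
pose D := bounded_itv l r a b; rewrite -/D.
have mD : measurable (D : set (measurableTypeR R)) by exact: measurable_itv.
have sumE (G : {fset int}) : \sum_(k <- G) rnorm (y k) ^+ 2 <= \sum_(k <- F) rnorm (x k) ^+ 2.
  rewrite [in leLHS](big_fsetID _ (mem F)) /= [X in _ + X]big1_fset ?addr0; last first.
    by move=> k; rewrite !inE /= => /andP[_ /negbTE kF] _; rewrite /y kF rnorm0 expr0n.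
  rewrite [leRHS](big_fsetID _ (mem G)) /=.
  have -> : [fset k in G | k \in F]%fset = [fset k in F | k \in G]%fset.
    by apply/fsetP => k; rewrite !inE /= andbC.
  rewrite -[leLHS]addr0; apply: lerD; last by apply: sumr_ge0 => k _; exact: sqr_ge0.
  rewrite big_seq [leRHS]big_seq; apply: ler_sum => k; rewrite !inE /= => /andP[kF _].
  by rewrite /y kF.
have yE : \sum_(k <- F) rnorm (y k) ^+ 2 = \sum_(k <- F) rnorm (x k) ^+ 2.
  by rewrite big_seq [RHS]big_seq; apply: eq_bigr => k kF; rewrite /y kF.
have SE (G : {fset int}) : (F `<=` G)%fset -> partial_sum omega U y G = partial_sum omega U x F.
  move=> FG; apply/funext => t; rewrite /partial_sum [RHS]big_seq.
  rewrite (big_fsetID _ (mem F)) /= [X in _ + X]big1_fset ?addr0; last first.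
    by move=> k; rewrite !inE /= => /andP[_ /negbTE kF] _; rewrite /y kF mul0r scale0r.
  have -> : [fset k in G | k \in F]%fset = F.
    by apply/fsetP => k; rewrite !inE /= andbC; case: (boolP (k \in F)) => // /(fsubsetP FG) ->.
  by rewrite big_seq; apply: eq_bigr => k kF; rewrite /y kF.
have /est[f [[[sf _] fS] _ up]] : (l2_normsq y < +oo)%E.
  by apply: le_lt_trans (ltry (\sum_(k <- F) rnorm (x k) ^+ 2)); apply: esum_le_fset => G; rewrite lee_fin.
have FT : Filter (@summability.totally int) by case: (@summability.totally_filter int).
have f0 : (L2_normsq D (fun t => (f t - partial_sum omega U x F t)%R) <= 0)%E.
  apply/lee_addgt0Pr => e e0; rewrite add0e.
  have [A _ HA] := (ecvg0P FT (fun K => L2_normsq_ge0 _ _)).1 fS e e0.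
  by have := HA (A `|` F)%fset (fsubsetUl _ _); rewrite -(SE _ (fsubsetUr A F)).
have [L L0 SL] := partial_sum_lipschitz omega U x F.
have mfS := strongly_measurable_sq sf SL.
have mS : measurable_sq D (partial_sum omega U x F) by exact: lipschitz_measurable_sq SL.
have mf : measurable_sq D f.
  have l0 : lipschitz_fun (fun _ : R => 0 : H) 0 by move=> s t; rewrite subrr rnorm0 mul0r.
  by have := strongly_measurable_sq sf l0; congr (measurable_sq D _); apply/funext => t; rewrite subr0.
apply: (@le_trans _ _ (l2_normsq y)).
  by rewrite -yE; apply: (@sum_fset_le_esum R (fun k => rnorm (y k) ^+ 2)) => k; exact: sqr_ge0.
apply: le_trans up _; rewrite mulrC EFinM -muleA; apply: lee_wpmul2l; first by rewrite lee_fin ltW.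
apply: (@le_trans _ _ (2%:E * L2_normsq D (fun t => (f t - partial_sum omega U x F t)%R) +
    2%:E * L2_normsq D (partial_sum omega U x F))%E).
  apply: L2_normsq_le2 => // t _; rewrite -{1}[f t](subrK (partial_sum omega U x F t)).
  exact: rnormD_sqr.
rewrite -[leRHS]add0e; apply: leeD => //.
by rewrite -[leRHS](mule0 2%:E); apply: lee_wpmul2l.
Qed.

End FiniteEstimate.

Section FiniteDimension.
Variables (R : realType) (H : completeNormedModType R[i]) (dot : {dot H for Num.conj}).
Hypothesis hdot : forall v : H, dot v v = `|v| ^+ 2.

(** In coordinates each of the w vector equations becomes d scalar ones, so there are more unknowns
    than equations. This is how the dimension enters the density bound. *)
Lemma window_kernel (I : finType) (w d : nat) (A : I -> nat -> R[i]) (V : I -> H) :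
  has_dimension H d -> (d * w < #|I|)%N ->
  exists x : I -> R[i], (exists k, x k != 0) /\
    forall j, (j < w)%N -> \sum_k A k j *: (x k *: V k) = 0.
Proof.
move=> [e eP] dw.
have /choice[co coP] (k : I) : exists c : {ffun 'I_d -> R[i]}, V k = \sum_(i < d) c i *: e i.
  by have [c [cE _]] := eP (V k); exists c.
have [|x [x0 xA]] := @exists_kernel _ I ('I_w * 'I_d)%type
    (fun k p => A k p.1 * co k p.2).
  by rewrite card_prod !card_ord mulnC.
exists x; split=> // j jw.
have -> : \sum_k A k j *: (x k *: V k) =
    \sum_(i < d) (\sum_k x k * (A k j * co k i)) *: e i.
  under [RHS]eq_bigr do rewrite scaler_suml.
  rewrite exchange_big /=; apply: eq_bigr => k _; rewrite coP !scaler_sumr.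
  by apply: eq_bigr => i _; rewrite !scalerA mulrCA mulrA.
by apply: big1 => i _; rewrite (xA (Ordinal jw, i)) scale0r.
Qed.

Lemma shift_width_le (E q : nat) : (E * q <= E.+1 * q - q.-1)%N.
Proof. by rewrite mulSn addnC -addnBA ?leq_pred // leq_addr. Qed.

(** For B >= 1 both factors are O(1 / B). The target 1/4 leaves room for a second quarter, the
    Riemann error. *)
Lemma window_decay (g D c : R) : 0 < g -> 0 < D -> 0 <= c ->
  exists2 B : R, 0 < B & c * (B ^- 2 + (g * B)^-1) * (B ^- 2 + (D * B)^-1) <= 1 / 4.
Proof.
move=> g0 D0 c0; pose G := (1 + g^-1) * (1 + D^-1).
have G0 : 0 <= G by rewrite mulr_ge0 // addr_ge0 // invr_ge0 ltW.
exists (1 + 4 * c * G); first by rewrite ltr_wpDr // mulr_ge0 // mulr_ge0.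
set B := 1 + _; have B1 : 1 <= B by rewrite lerDl mulr_ge0 // mulr_ge0.
have B0 : 0 < B by lra.
have bd (y : R) : 0 < y -> B ^- 2 + (y * B)^-1 <= (1 + y^-1) * B^-1.
  move=> y0; rewrite mulrDl mul1r [(y * B)^-1]invfM lerD2r lef_pV2 ?posrE ?exprn_gt0 //.
  by rewrite expr2 ler_peMl // ltW.
have p0 (y : R) : 0 < y -> 0 <= B ^- 2 + (y * B)^-1.
  by move=> y0; rewrite addr_ge0 // invr_ge0 ?sqr_ge0 // mulr_ge0 // ltW.
have s1 := ler_pM (p0 _ g0) (p0 _ D0) (bd _ g0) (bd _ D0).
rewrite -mulrA; apply: le_trans (ler_wpM2l c0 s1) _.
have -> : c * ((1 + g^-1) * B^-1 * ((1 + D^-1) * B^-1)) = c * G * B ^- 2.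
  by rewrite /G; move: (g^-1) (D^-1) => x y; field; rewrite gt_eqF.
rewrite ler_pdivrMr ?exprn_gt0 //; apply: (@le_trans _ _ (1 / 4 * B)).
  by rewrite /B; lra.
by rewrite ler_pM2l // expr2 ler_peMl // ltW.
Qed.

(* If #|I| > d w, some nonzero coefficients annihilate w consecutive Fourier
   coefficients of the samples; their energy is then too small for the lower
   estimate, once B and then the sampling rate q are large. *)
Lemma window_count (d E : nat) (a b gam c : R) :
    has_dimension H d -> a < b -> 0 < gam -> 0 < c -> (0 < E)%N ->
  exists2 B : R, 0 < B & forall (I : finType) (u : I -> R) (V : I -> H) (r : R) (w : nat),
    (forall k l, k != l -> gam <= `|u k - u l|) ->
    (forall k, B <= u k <= B + r) -> (forall k, rnorm (V k) = 1) ->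
    (forall x : I -> R[i], ((\sum_k rnorm (x k) ^+ 2)%:E <=
        c%:E * L2_normsq `[a, b[ (trig_sum u (fun k => x k *: V k)))%E) ->
    (r + 2 * B) * (E.+2%:R * (b - a)) <= 2 * pi * E%:R * w%:R ->
  (#|I| <= d * w)%N.
Proof.
move=> Hd ab g0 c0 E0; have l0 : 0 < b - a by rewrite subr_gt0.
have pi0 := pi_gt0 R; set l := b - a in l0 *.
have E0' : 0 < E%:R :> R by rewrite ltr0n.
have E20 : 0 < E.+2%:R :> R by rewrite ltr0n.
(* E q samples at step h = l / (E q) fill the interval, while the period is N = (E + 2) q, the 2 q
   extra samples serving the smoothing. The spacing 2 pi / (N h) is then free of q. *)
pose D := 2 * pi * E%:R / (E.+2%:R * l).
have D0 : 0 < D by rewrite divr_gt0 ?mulr_gt0.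
(* The prefactor of [window_energy] multiplied by h / q^2, in which all powers of q cancel; hence B
   can be chosen before q. *)
pose kap := 256%:R ^+ 2 * E%:R ^+ 3 / (l ^+ 3 * E.+2%:R).
have kap0 : 0 <= 2 * c * kap.
  by rewrite !mulr_ge0 ?invr_ge0 ?mulr_ge0 ?exprn_ge0 ?ler0n ?(ltW c0) ?(ltW l0) ?(ltW E20).
have [B B0 BP] := window_decay g0 D0 kap0.
exists B => // I u V r w sep uB V1 est rw; rewrite leqNgt; apply/negP => dw.
pose M := (\sum_k `|u k|) ^+ 2; have M0 : 0 <= M by exact: sqr_ge0.
have [q [q1 q2]] : exists q : nat, 1 <= q%:R :> R /\ 8 * c * l ^+ 3 * M <= q%:R.
  have : \forall n \near \oo, 1 <= n%:R :> R /\ 8 * c * l ^+ 3 * M <= n%:R.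
    near=> n; split; near: n; exact: natr_ge_all.
  by case=> n _ /(_ n (leqnn n)); exists n.
have q0 : 0 < q%:R :> R by lra.
have q0' : (0 < q)%N by rewrite -(ltr_nat R).
pose h := l / (E%:R * q%:R); have h0 : 0 < h by rewrite divr_gt0 ?mulr_gt0.
have hE : h * (E * q)%:R = l by rewrite natrM /h divfK // mulf_neq0 // gt_eqF.
pose N := (E.+2 * q)%N; have N0 : (0 < N)%N by rewrite muln_gt0.
have NE : N%:R = E.+2%:R * q%:R :> R by rewrite natrM.
have [x [[k0 xk0] xker]] := window_kernel (fun k => box_kernel (E.+1 * q) q N (h * u k)) V Hd dw.
have DE : 2 * pi / (N%:R * h) = D.
  by rewrite NE /D /h; move: (pi) => p; field; rewrite !gt_eqF.
have uw k : h * (u k + B) <= 2 * pi / N%:R * w%:R.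
  apply: (@le_trans _ _ (h * (r + 2 * B))).
    by rewrite ler_pM2l //; have /andP[_] := uB k; lra.
  have -> : 2 * pi / N%:R * w%:R = h * (2 * pi * E%:R * w%:R / (E.+2%:R * l)).
    by rewrite NE /h; move: (pi) => p; field; rewrite !gt_eqF.
  by rewrite ler_pM2l // ler_pdivlMr ?mulr_gt0.
have PQ : (E.+1 * q + q <= N)%N by rewrite /N [(E.+2 * q)%N]mulSn addnC.
have uB' k : B <= u k by case/andP: (uB k).
have WE := window_energy hdot g0 B0 h0 N0 PQ sep uB' uw xker.
rewrite DE in WE.
pose s := \sum_k rnorm (x k) ^+ 2.
have sV : \sum_k rnorm (x k *: V k) ^+ 2 = s.
  by apply: eq_bigr => k _; rewrite rnormZ V1 mulr1.
rewrite sV in WE.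
(* These phases place the E q samples of the interval at the indices from q - 1 on, inside the
   plateau of the window, without changing any modulus. *)
pose z k := expi (- (u k * a)) * expi (h * u k) ^+ q.-1 * x k.
have zE k : rnorm (z k) = rnorm (x k).
  by rewrite /z !rnormM rnorm_expi rnormX rnorm_expi expr1n !mul1r.
have gridE m : trig_sum u (fun k => z k *: V k) (a + h * m%:R) =
    \sum_k expi (h * u k) ^+ (m + q.-1) *: (x k *: V k).
  rewrite trig_sum_grid; apply: eq_bigr => k _; rewrite !scalerA exprD /z; congr (_ *: _).
  rewrite -!mulrA; congr (_ * _); rewrite !mulrA -expiD subrr expi0 mul1r //.
have sumS : h * \sum_(m < E * q) rnorm (trig_sum u (fun k => z k *: V k) (a + h * m%:R)) ^+ 2 <=
    kap * (B ^- 2 + (gam * B)^-1) * (B ^- 2 + (D * B)^-1) * s.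
  under eq_bigr do rewrite gridE.
  pose F m := rnorm (\sum_k expi (h * u k) ^+ m *: (x k *: V k)) ^+ 2.
  have le1 : \sum_(m < E * q) F (m + q.-1)%N <= \sum_(q.-1 <= m < E.+1 * q) F m.
    rewrite -(big_mkord xpredT (fun m => F (m + q.-1)%N)) -{2}[q.-1]add0n big_addn.
    rewrite [leRHS](@big_cat_nat _ _ _ (E * q)) //=; last exact: shift_width_le.
    by rewrite lerDl sumr_ge0 // => m _; exact: sqr_ge0.
  have hq0 : 0 <= h / q%:R ^+ 2 by rewrite divr_ge0 ?exprn_ge0 ?ltW.
  have := ler_wpM2l hq0 WE; move: le1; rewrite /F => le1 WE'.
  apply: le_trans (ler_wpM2l (ltW h0) le1) _.
  rewrite [leLHS](_ : _ = h / q%:R ^+ 2 * (q%:R ^+ 2 * \sum_(q.-1 <= m < E.+1 * q) F m)); last first.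
    by rewrite /F mulrA divfK // expf_neq0 // gt_eqF.
  apply: le_trans WE' _; rewrite le_eqVlt; apply/orP; left; apply/eqP.
  rewrite NE /kap /h; move: (B ^- 2 + (gam * B)^-1) (B ^- 2 + (D * B)^-1) => A1 A2.
  by field; rewrite !gt_eqF.
have L0 : 0 <= \sum_k `|u k| * rnorm (z k *: V k).
  by apply: sumr_ge0 => k _; rewrite mulr_ge0 ?rnorm_ge0.
have LM : (\sum_k `|u k| * rnorm (z k *: V k)) ^+ 2 <= M * s.
  apply: le_trans (weighted_sqr_le _ (fun k => normr_ge0 (u k))) _.
  rewrite /M expr2 -mulrA ler_wpM2l ?sumr_ge0 // mulr_sumr; apply: ler_sum => k _.
  rewrite rnormZ V1 mulr1 zE ler_wpM2r ?sqr_ge0 // (bigD1 k) //= lerDl sumr_ge0 //.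
have [+ _] := @lipschitz_riemann R H _ _ a h (E * q) L0 (ltW h0) (trig_sum_lipschitz_fun u (fun k => z k *: V k)).
rewrite hE addrC subrK => RI.
have := est z; under eq_bigr do rewrite zE; rewrite -/s => /le_trans/(_ (lee_wpmul2l _ RI)).
rewrite lee_fin => /(_ (ltW c0)); rewrite -EFinM lee_fin => fin.
have h2 : h ^+ 2 <= l ^+ 2 / q%:R.
  have Eq : q%:R <= (E%:R * q%:R) ^+ 2 :> R.
    have E1 : 1 <= E%:R :> R by rewrite ler1n.
    have Eq1 : 1 <= E%:R * q%:R :> R by rewrite mulr_ege1.
    apply: (@le_trans _ _ (E%:R * q%:R : R)); first by rewrite ler_peMl // ltW.
    by rewrite expr2 ler_peMl //; lra.
  rewrite /h expr_div_n ler_wpM2l ?sqr_ge0 // lef_pV2 ?posrE // exprn_gt0 // mulr_gt0 //.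
have s0 : 0 < s.
  rewrite /s (bigD1 k0) //= ltr_pwDl ?sumr_ge0 //; last by move=> k _; exact: sqr_ge0.
  by rewrite exprn_gt0 // lt_neqAle rnorm_ge0 eq_sym rnorm_eq0 xk0.
move: fin LM sumS; set L := \sum_k `|u k| * _; set SS := \sum_(m < _) _ => fin LM sumS.
(* The main term and the Riemann error are each at most s / 4, so the lower estimate would give s <=
   s / 2 although s > 0. *)
have t1 : c * (2 * h * SS) <= 1 / 4 * s.
  apply: (@le_trans _ _ (2 * c * (kap * (B ^- 2 + (gam * B)^-1) * (B ^- 2 + (D * B)^-1) * s))).
    have -> : c * (2 * h * SS) = 2 * c * (h * SS) by ring.
    by rewrite ler_pM2l // mulr_gt0.
  move: BP; move: (B ^- 2 + (gam * B)^-1) (B ^- 2 + (D * B)^-1) => A1 A2 BP.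
  have -> : 2 * c * (kap * A1 * A2 * s) = 2 * c * kap * A1 * A2 * s by ring.
  by rewrite ler_pM2r.
have t2 : c * (2 * l * (L * h) ^+ 2) <= 1 / 4 * s.
  apply: (@le_trans _ _ (2 * c * l * (M * s * (l ^+ 2 / q%:R)))).
    have -> : c * (2 * l * (L * h) ^+ 2) = 2 * c * l * (L ^+ 2 * h ^+ 2) by ring.
    by rewrite ler_wpM2l ?mulr_ge0 ?(ltW c0) ?(ltW l0) // ler_pM ?sqr_ge0.
  have -> : 2 * c * l * (M * s * (l ^+ 2 / q%:R)) = 1 / 4 * s * (8 * c * l ^+ 3 * M / q%:R).
    by field; rewrite gt_eqF.
  by rewrite ler_piMr ?mulr_ge0 ?(ltW s0) // ler_pdivrMr // mul1r.
lra.
Unshelve. all: by end_near.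
Qed.

End FiniteDimension.

(** Comparison of slopes at infinity, applied once to the length of the frequency window and once to
    E. *)
Lemma affine_growth_le (R : realType) (x y z : R) :
  (forall n : nat, x * n.+1%:R <= y * n.+1%:R + z) -> x <= y.
Proof.
move=> h; rewrite leNgt; apply/negP => yx; have d0 : 0 < x - y by rewrite subr_gt0.
have := h (Num.truncn `|z / (x - y)|); apply/negP; rewrite -ltNge.
have : z / (x - y) < (Num.truncn `|z / (x - y)|).+1%:R.
  by apply: le_lt_trans (ler_norm _) (truncnS_gt _).
by rewrite ltr_pdivrMr // mulrBr [x * _]mulrC [y * _]mulrC; lra.
Qed.

(** * Part (b): the density bound in dimension d *)

Section Necessity.
Variables (R : realType) (H : completeNormedModType R[i]) (dot : {dot H for Num.conj}).
Hypothesis hdot : forall v : H, dot v v = `|v| ^+ 2.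
Variables (omega : int -> R) (hgap : gap_condition omega).
Variables (U : int -> H) (hU : forall k, `|U k| = 1).

(** A translation of the frequencies multiplies the sum by a unimodular function; any frequency
    window may thus be moved to start at B. *)
Lemma trig_sum_shift (I : finType) (u : I -> R) (V : I -> H) (s : R) (D : set R) :
  L2_normsq D (trig_sum (fun k => u k + s) V) = L2_normsq D (trig_sum u V).
Proof.
apply: eq_integral => t _; congr ((_ ^+ 2)%:E).
rewrite -(rnorm_expiZ (s * t) (trig_sum u V t)); congr (rnorm _).
rewrite /trig_sum scaler_sumr; apply: eq_bigr => k _.
by rewrite scalerA -expiD; congr (expi _ *: _); ring.
Qed.

Lemma count_max_window (a b : R) (l r : bool) (d E : nat) : a < b -> (0 < E)%N ->
    has_dimension H d -> estimates omega U (bounded_itv l r a b) ->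
  exists2 B : R, 0 < B & forall s, 0 < s ->
    count_max omega s <= d%:R * ((s + 2 * B) * (E.+2%:R * (b - a)) / (2 * pi * E%:R) + 1).
Proof.
move=> ab E0 Hd est; have [c c0 low] := estimates_finite_lower est.
have [gam g0 sep] := gap_separated hgap; have pi0 := pi_gt0 R.
have E0' : 0 < E%:R :> R by rewrite ltr0n.
have E20 : 0 < E.+2%:R :> R by rewrite ltr0n.
have l0 : 0 < b - a by rewrite subr_gt0.
have [B B0 HB] := window_count hdot Hd ab g0 c0 E0; exists B => // s s0.
set y := _ / _; have y0 : 0 <= y.
  by rewrite ltW // divr_gt0 ?mulr_gt0 // addr_gt0 // mulr_gt0.
(* Rounding the required number of transform points up to an integer costs the final + 1. *)
pose w := (Num.truncn y).+1.
apply: (@le_trans _ _ (d * w)%:R); last first.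
  by rewrite natrM ler_wpM2l // /w -natr1 lerD2r; case/andP: (truncn_itv y0).
rewrite -lee_fin -(max_termsE hgap s0); apply: max_terms_le => F c1 Fc.
have -> : #|` F| = #|{: F}| by rewrite cardfE.
apply: (HB F (fun k => omega (val k) + (B - c1)) (fun k => U (val k)) s w).
- by move=> k k' kk; rewrite opprD addrACA subrr addr0 sep // (inj_eq val_inj).
- by move=> k; have /andP[h1 h2] := Fc _ (valP k); apply/andP; split; lra.
- by move=> k; exact: rnorm_unit.
- move=> x; pose x' k : R[i] := oapp x 0 (insub k).
  have x'E (k : F) : x' (val k) = x k by rewrite /x' valK.
  have := low x' F; rewrite big_seq_fsetE /=.
  rewrite (eq_bigr (fun k => rnorm (x k) ^+ 2)) => [|k _]; last by rewrite x'E.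
  rewrite partial_sum_trig L2_normsq_itv; last first.
    by have [L _ SL] := trig_sum_lipschitz (fun k : F => omega (val k))
      (fun k => x' (val k) *: U (val k)); exact: lipschitz_measurable_sq SL.
  rewrite -(trig_sum_shift _ _ (B - c1)).
  have -> : (fun k : F => x' (val k) *: U (val k)) = (fun k => x k *: U (val k)).
    by apply/funext => k; rewrite x'E.
  exact.
have : y <= w%:R by rewrite ltW // truncnS_gt.
by rewrite /y ler_pdivrMr ?mulr_gt0 // [w%:R * _]mulrC.
Qed.

Lemma necessity (a b : R) (l r : bool) (d : nat) : a < b ->
    has_dimension H d -> estimates omega U (bounded_itv l r a b) ->
  ((2 * pi)%:E * polya_upper_density omega / d%:R%:E <= (b - a)%:E)%E.
Proof.
move=> ab Hd est; have pi0 := pi_gt0 R; have l0 : 0 < b - a by rewrite subr_gt0.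
have [d0 [-> dle _]] := polya_densityP hgap.
(* The unit vector U 0 excludes d = 0, so the extended division by d is an ordinary one. *)
have dpos : 0 < d%:R :> R.
  rewrite ltr0n lt0n; apply/eqP => dz; move: Hd => [e eP].
  have [co [UE _]] := eP (U 0); have := hU 0.
  rewrite UE big1 ?normr0 => [/esym/eqP|i _]; first by rewrite oner_eq0.
  by exfalso; have := ltn_ord i; rewrite [X in (_ < X)%N]dz ltn0.
(* B depends on E but not on the window length, so letting the length tend to infinity removes
   it. *)
have bound (E : nat) : (0 < E)%N -> d0 <= d%:R * (E.+2%:R * (b - a) / (2 * pi * E%:R)).
  move=> E0; have [B B0 HB] := count_max_window ab E0 Hd est.
  have E0' : 0 < E%:R :> R by rewrite ltr0n.
  apply: (affine_growth_le (z := d%:R * (2 * B * (E.+2%:R * (b - a)) / (2 * pi * E%:R) + 1))) => n.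
  have n0 : 0 < n.+1%:R :> R by rewrite ltr0n.
  have := dle _ n0; rewrite ler_pdivlMr // => /le_trans/(_ (HB _ n0))/le_trans; apply.
  rewrite le_eqVlt; apply/orP; left; apply/eqP; move: (pi) pi0 => p p0.
  by field; rewrite !gt_eqF.
(* (E + 2) / E tends to 1: after multiplication by E = n + 1 the excess is a constant, and slopes
   are compared again. *)
have main : d0 <= d%:R * ((b - a) / (2 * pi)).
  apply: (affine_growth_le (z := 2 * d%:R * ((b - a) / (2 * pi)))) => n.
  have n0 : 0 < n.+1%:R :> R by rewrite ltr0n.
  have := bound n.+1 isT; rewrite -(ler_pM2r n0) => /le_trans; apply.
  rewrite le_eqVlt; apply/orP; left; apply/eqP; move: (pi) pi0 => p p0.
  have -> : n.+3%:R = n.+1%:R + 2 :> R by rewrite -natrD addn2.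
  by field; rewrite !gt_eqF.
rewrite inver gt_eqF // -!EFinM lee_fin ler_pdivrMr // mulrC -ler_pdivlMr ?mulr_gt0 //.
by apply: le_trans main _; rewrite mulrA [d%:R * _]mulrC.
Qed.

End Necessity.

Theorem theorem1p1 (R : realType)
    (H : completeNormedModType R[i]) (dot : {dot H for Num.conj})
    (hdot : forall v : H, dot v v = `|v| ^+ 2)
    (omega : int -> R) (hgap : gap_condition omega)
    (U : int -> H) (hU : forall k, `|U k| = 1)
    (a b : R) (hab : a < b) (l r : bool) :
  (((2 * pi)%:E * polya_upper_density omega < (b - a)%:E)%E ->
     estimates omega U (bounded_itv l r a b)) /\
  (forall d : nat, has_dimension H d ->
     estimates omega U (bounded_itv l r a b) ->
     ((2 * pi)%:E * polya_upper_density omega / d%:R%:E <= (b - a)%:E)%E).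
Proof.
split=> [|d Hd]; first exact: (sufficiency hdot hgap hU).
exact: (necessity hdot hgap hU).
Qed.
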